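(* Let $\Gamma$ be a self-dual $o_D$-lattice function of $V$ such that $\tilde{\mathfrak a}(\Gamma)$ is a maximal self-dual order and $P^0(\Gamma)$ is not a maximal parahoric subgroup of $G$. Then there exists a self-dual $o_D$-lattice function $\Gamma'$ of $V$ such that $P^0(\Gamma')=P^0(\Gamma)$ and $\tilde{\mathfrak a}(\Gamma')\subsetneqq\tilde{\mathfrak a}(\Gamma)$.
   Context: $F$ is a non-Archimedean local field of odd residue characteristic; $D$ is a skew-field of degree at most $2$ over $F$ (so $D$ is commutative or a quaternion division algebra) with an anti-involution $\bar{\ }$ (possibly trivial if $D$ is commutative); $o_D$ is its valuation ring, $\mathfrak p_D$ its maximal ideal, and $\varpi_D$ a uniformizer with $\bar\varpi_D=\pm\varpi_D$. $V$ is a finite-dimensional right $D$-vector space and $h:V\times V\to D$ a non-degenerate $\epsilon$-hermitian form ($\epsilon=\pm1$) with respect to $\bar{\ }$, with adjoint anti-involution $\sigma_h$ on $\mathrm{End}_D(V)$. $G$ is the group of isometries of $h$, where in case $h$ is orthogonal one requires in addition reduced norm $1$. An $o_D$-lattice function is a family $\Gamma=(\Gamma(t))_{t\in\mathbb R}$ of full $o_D$-lattices of $V$, decreasing in $t$, with $\Gamma(t)=\bigcap_{u<t}\Gamma(u)$ and $\Gamma(t)\varpi_D=\Gamma(t+\frac1d)$, $d$ the index of $D$. Put $\Gamma(t+)=\bigcup_{u>t}\Gamma(u)$ and $M^\#=\{v\in V:h(v,M)\subseteq\mathfrak p_D\}$; $\Gamma$ is self-dual if $\Gamma((-t)+)^\#=\Gamma(t)$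 for all $t$. Put $\tilde{\mathfrak a}_t(\Gamma)=\{a\in\mathrm{End}_D(V):a\Gamma(s)\subseteq\Gamma(s+t)\ \forall s\in\mathbb R\}$, $\tilde{\mathfrak a}(\Gamma)=\tilde{\mathfrak a}_0(\Gamma)$, $\tilde{\mathfrak a}_{0+}(\Gamma)=\bigcup_{t>0}\tilde{\mathfrak a}_t(\Gamma)$, $P(\Gamma)=\tilde{\mathfrak a}(\Gamma)^\times\cap G$, $P_{0+}(\Gamma)=(1+\tilde{\mathfrak a}_{0+}(\Gamma))\cap G$. A hereditary order of $\mathrm{End}_D(V)$ is called self-dual if it is stable under $\sigma_h$; a maximal self-dual order is a self-dual hereditary order which is maximal under inclusion among all self-dual hereditary orders. For self-dual $\Gamma$, $P(\Gamma)/P_{0+}(\Gamma)$ is the group of rational points of a reductive group $\mathbb P(\Gamma)$ over the residue field (the group of elements $x$ with $x\sigma_h(x)=1$ in the units of the finite-dimensional algebra $\tilde{\mathfrak a}(\Gamma)/\tilde{\mathfrak a}_{0+}(\Gamma)$, in the orthogonal case cut down by the norm condition). $P^0(\Gamma)$ is the preimage in $P(\Gamma)$ of the rational points of the identity component of $\mathbb P(\Gamma)$. The parahoric subgroups of $G$ are the groups $P^0(\Gamma)$ for $\Gamma$ a self-dual lattice function; a maximal parahoric is one maximal under inclusion among these. *)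

(* Defs.v *)
From HB Require Import structures.
From mathcomp Require Import all_boot all_order all_algebra all_field.
From mathcomp Require Import -(notations) mpoly.
From mathcomp Require Import boolp classical_sets reals topology.

Set Implicit Arguments.
Unset Strict Implicit.
Unset Printing Implicit Defensive.

Import Order.TTheory GRing.Theory Num.Theory.

Local Open Scope classical_set_scope.
Local Open Scope ring_scope.

(* A valuation is an integer-valued function whose value at 0 is irrelevant:
   [val_ge v m x] stands for "v(x) >= m" with the convention v(0) = +oo. *)
Section Valuations.
Variables (A : nzRingType) (v : A -> int).

Definition val_ge (m : int) : set A := [set x | x = 0 \/ m <= v x].
Definition val_ring : set A := val_ge 0.
Definition val_max_ideal : set A := val_ge 1.

Definition normalized_valuation : Prop :=
  [/\ forall x y, x != 0 -> y != 0 -> v (x * y) = v x + v y,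
      forall x y, x != 0 -> y != 0 -> x + y != 0 ->
        Num.min (v x) (v y) <= v (x + y) &
      exists2 x, x != 0 & v x = 1].

Definition val_complete : Prop :=
  forall u : nat -> A,
    (forall m : int, exists n : nat, forall i j : nat,
       (n <= i)%N -> (n <= j)%N -> val_ge m (u i - u j)) ->
    exists l : A, forall m : int, exists n : nat, forall i : nat,
       (n <= i)%N -> val_ge m (u i - l).

Definition finite_residue_ring : Prop :=
  exists s : seq A, forall x, val_ring x ->
    exists2 y, y \in s & val_max_ideal (x - y).

End Valuations.

Definition nonarch_local_field (F : fieldType) (v : F -> int) : Prop :=
  [/\ normalized_valuation v, val_complete v & finite_residue_ring v].

(* [f], of which only the restriction to the subring [O] matters, induces an
   injective ring morphism O / I -> B. *)
Definition embeds_quotient (A B : zmodType) (oneA : A) (mulA : A -> A -> A)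
    (oneB : B) (mulB : B -> B -> B) (O I : set A) (f : A -> B) : Prop :=
  [/\ f oneA = oneB,
      forall a b, O a -> O b -> f (a + b) = f a + f b,
      forall a b, O a -> O b -> f (mulA a b) = mulB (f a) (f b) &
      forall a, O a -> (f a = 0 <-> I a)].

(* Right D-vector spaces are left vector spaces over the converse ring D^c. *)
Definition rscale (D : nzRingType) (V : lmodType D^c) (v : V) (x : D) : V :=
  (x : D^c) *: v.

(* F is the centre of D and degD its index, so that either D = F or D is a
   quaternion division algebra over F.  bar is only required to be an
   anti-involution: it may be the identity or a non-trivial automorphism when
   D = F.  valD is the normalized valuation of D, that is, up to a factor, the
   unique valuation extending valF. *)
Record hermitian_datum (F : fieldType) (D : falgType F) (V : vectType D^c) :=
  HermitianDatum {
  valF : F -> int;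
  valD : D -> int;
  degD : nat;
  unif : D;
  bar : D -> D;
  sgn : D;
  hform : V -> V -> D;

  valF_local : nonarch_local_field valF;
  valF_odd : ~ val_max_ideal valF 2%:R;

  D_skew_field : forall x : D, x != 0 -> x \is a GRing.unit;
  D_central : 'Z({:D})%VS = 1%VS;
  D_dim : \dim {:D} = (degD ^ 2)%N;
  degD_le2 : (degD <= 2)%N;
  valD_valuation : normalized_valuation valD;
  valD_extends : exists2 e : nat, (0 < e)%N &
    forall c : F, c != 0 -> valD c%:A = e%:Z * valF c;

  bar_add : forall x y, bar (x + y) = bar x + bar y;
  bar_mul : forall x y, bar (x * y) = bar y * bar x;
  bar_invol : forall x, bar (bar x) = x;

  unif_uniformizer : unif != 0 /\ valD unif = 1;
  bar_uniformizer : bar unif = unif \/ bar unif = - unif;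

  sgn_unit : sgn = 1 \/ sgn = -1;
  hformDr : forall v w w', hform v (w + w') = hform v w + hform v w';
  hformZr : forall v w x, hform v (rscale w x) = hform v w * x;
  hform_sgn : forall v w, hform w v = sgn * bar (hform v w);
  hform_nondeg : forall v, (forall w, hform v w = 0) -> v = 0
}.

(* The Zariski topology on n x n matrices over K: a set is open iff it is a
   union of principal open sets. *)
Definition zariski (K : fieldType) (n : nat) : Type := 'M[K]_n.

Section Zariski.
Variables (K : fieldType) (n : nat).

Definition principal_open (f : mpoly (n * n) K) : set (zariski K n) :=
  [set x : 'M[K]_n | meval (fun i => mxvec x 0 i) f != 0].

Definition zariski_open (U : set (zariski K n)) : Prop :=
  forall x, U x -> exists2 f, principal_open f x & principal_open f `<=` U.

Lemma zariski_openT : zariski_open setT.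
Proof.
move=> x _; exists 1 => //.
by rewrite /principal_open /= rmorph1 oner_neq0.
Qed.

Lemma zariski_openI (U W : set (zariski K n)) :
  zariski_open U -> zariski_open W -> zariski_open (U `&` W).
Proof.
move=> oU oW x [/oU[f fx fU] /oW[g gx gW]]; exists (f * g).
  by rewrite /principal_open /= rmorphM mulf_neq0.
move=> y; rewrite /principal_open /= rmorphM mulf_eq0 negb_or => /andP[fy gy].
by split; [apply: fU | apply: gW].
Qed.

Lemma zariski_open_bigU (I : Type) (U : I -> set (zariski K n)) :
  (forall i, zariski_open (U i)) -> zariski_open (\bigcup_i U i).
Proof.
move=> oU x [i _ /oU[f fx fU]]; exists f => // y /fU Uy.
by exists i.
Qed.

HB.instance Definition _ := Choice.copy (zariski K n) 'M[K]_n.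
HB.instance Definition _ := isOpenTopological.Build (zariski K n)
  zariski_openT zariski_openI zariski_open_bigU.

End Zariski.

Section Endomorphisms.
Variables (F : fieldType) (D : falgType F) (V : vectType D^c).
Variable X : hermitian_datum V.

Definition homothety (c : F) : 'End(V) := linfun (fun v : V => rscale v c%:A).

Lemma homothetyE c v : homothety c v = rscale v c%:A.
Proof.
have lin : linear (fun u : V => rscale u c%:A).
  move=> x u w; rewrite /rscale scalerDr !scalerA; congr (_ *: _ + _).
  exact: (etrans (mulr_algr c (x : D)) (esym (mulr_algl c (x : D)))).
pose f : {linear V -> V} := HB.pack (fun u : V => rscale u c%:A)
  (GRing.isLinear.Build _ _ _ _ _ lin).
by rewrite /homothety -[RHS]/(f v) -(lfunE f v).
Qed.

(* [adjoint a b] means that b = sigma_h(a). *)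
Definition adjoint (a b : 'End(V)) : Prop :=
  forall v w, hform X (a v) w = hform X v (b w).

Definition isometry (g : 'End(V)) : Prop :=
  forall v w, hform X (g v) (g w) = hform X v w.

(* N = deg End_D(V), that is, N ^ 2 = dim_F End_D(V). *)
Definition endo_degree : nat := (degD X * vector.dim V)%N.

(* By central simplicity and equality of dimensions, an F-algebra morphism
   End_D(V) -> M_N(L) induces an isomorphism End_D(V) (x)_F L = M_N(L). *)
Definition splitting (L : fieldType) (i : {rmorphism F -> L})
    (phi : 'End(V) -> 'M[L]_endo_degree) : Prop :=
  [/\ forall a b, phi (a + b) = phi a + phi b,
      forall a b, phi (a \o b)%VF = phi a *m phi b &
      forall c, phi (homothety c) = (i c)%:M].

Definition reduced_norm_is (a : 'End(V)) (x : F) : Prop :=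
  exists (L : fieldType) (i : {rmorphism F -> L})
         (phi : 'End(V) -> 'M[L]_endo_degree),
    splitting i phi /\ \det (phi a) = i x.

(* sigma_h is of orthogonal type: over a splitting field it becomes the adjoint
   involution of a symmetric bilinear form (2 is invertible in F). *)
Definition orthogonal : Prop :=
  exists (L : fieldType) (i : {rmorphism F -> L})
         (phi : 'End(V) -> 'M[L]_endo_degree) (B : 'M[L]_endo_degree),
    [/\ splitting i phi, B \in unitmx, B^T = B &
        forall a b, adjoint a b -> phi b = invmx B *m (phi a)^T *m B].

Definition isometry_group : set 'End(V) :=
  [set g | isometry g /\ (orthogonal -> reduced_norm_is g 1)].

(* Orders of End_D(V) over o_F. *)
Definition is_order (S : set 'End(V)) : Prop :=
  [/\ S \1%VF,
      forall a b, S a -> S b -> S (a \o b)%VF &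
      exists n (e : 'I_n -> 'End(V)),
        S = [set a | exists2 c : 'I_n -> F, forall i, val_ring (valF X) (c i) &
               a = \sum_i (homothety (c i) \o e i)%VF] /\
        forall a, exists c : 'I_n -> F, a = \sum_i (homothety (c i) \o e i)%VF].

Definition left_ideal (S I : set 'End(V)) : Prop :=
  [/\ I `<=` S, I 0, forall a b, I a -> I b -> I (a + b) &
      forall s a, S s -> I a -> I (s \o a)%VF].

(* The left S-module I is a direct summand of some S ^ n: [f] is an S-linear
   map I -> S ^ n, and the S-linear map S ^ n -> I sending the i-th basis
   vector to [x i] is a retraction of f.  A finite n suffices because left
   ideals of an o_F-order are finitely generated. *)
Definition projective_ideal (S I : set 'End(V)) : Prop :=
  exists n (f : 'End(V) -> 'I_n -> 'End(V)) (x : 'I_n -> 'End(V)),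
    [/\ forall i, I (x i),
        forall a i, I a -> S (f a i),
        forall a b i, I a -> I b -> f (a + b) i = f a i + f b i,
        forall s a i, S s -> I a -> f (s \o a)%VF i = (s \o f a i)%VF &
        forall a, I a -> \sum_i (f a i \o x i)%VF = a].

(* For orders, left hereditary and right hereditary are equivalent. *)
Definition hereditary_order (S : set 'End(V)) : Prop :=
  is_order S /\ forall I, left_ideal S I -> projective_ideal S I.

Definition self_dual_order (S : set 'End(V)) : Prop :=
  hereditary_order S /\ forall a b, S a -> adjoint a b -> S b.

Definition maximal_self_dual_order (S : set 'End(V)) : Prop :=
  self_dual_order S /\
  forall S', self_dual_order S' -> S `<=` S' -> S' = S.

End Endomorphisms.

Section LatticeFunctions.
Variables (R : realType) (F : fieldType) (D : falgType F) (V : vectType D^c).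
Variable X : hermitian_datum V.
Implicit Type Gamma : R -> set V.

Definition full_lattice (M : set V) : Prop :=
  exists n (e : 'I_n -> V),
    M = [set v | exists2 c : 'I_n -> D, forall i, val_ring (valD X) (c i) &
           v = \sum_i rscale (e i) (c i)] /\
    forall v, exists c : 'I_n -> D, v = \sum_i rscale (e i) (c i).

Definition lattice_function Gamma : Prop :=
  [/\ forall t, full_lattice (Gamma t),
      forall s t, s <= t -> Gamma t `<=` Gamma s,
      forall t, Gamma t = \bigcap_(u in [set u | u < t]) Gamma u &
      forall t, [set rscale v (unif X) | v in Gamma t] =
                Gamma (t + (degD X)%:R^-1)].

(* Gamma(t+) *)
Definition right_part Gamma (t : R) : set V :=
  \bigcup_(u in [set u | t < u]) Gamma u.

(* M^# *)
Definition dual_lattice (M : set V) : set V :=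
  [set v | forall w, M w -> val_max_ideal (valD X) (hform X v w)].

Definition self_dual_lattice_function Gamma : Prop :=
  lattice_function Gamma /\
  forall t, dual_lattice (right_part Gamma (- t)) = Gamma t.

Definition filt Gamma (t : R) : set 'End(V) :=
  [set a : 'End(V) | forall s v, Gamma s v -> Gamma (s + t) (a v)].
Definition filt0 Gamma : set 'End(V) := filt Gamma 0.
Definition filt0plus Gamma : set 'End(V) :=
  \bigcup_(t in [set t | 0 < t]) filt Gamma t.

(* P(Gamma) *)
Definition stabilizer Gamma : set 'End(V) :=
  [set g | isometry_group X g /\ filt0 Gamma g /\
     exists g', [/\ filt0 Gamma g', (g \o g')%VF = \1%VF
                  & (g' \o g)%VF = \1%VF]].

(* Valuation ring and maximal ideal of F_0, the subfield of F fixed by bar. *)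
Definition fixed_val_ring : set F :=
  [set c | val_ring (valF X) c /\ bar X c%:A = c%:A].
Definition fixed_max_ideal : set F :=
  [set c | val_max_ideal (valF X) c /\ bar X c%:A = c%:A].

(* A concrete description of P(Gamma) as a linear algebraic group over the
   residue field k = resk of F_0.  With d the index of D, the finite-dimensional
   k-vector space W = (+)_{0 <= t < 1/d} Gamma(t) / Gamma(t+) is identified with
   column vectors through the maps [redV t] : Gamma(t) -> W, and the k-algebra
   A = filt0 Gamma / filt0plus Gamma is identified through [redE] with a
   subalgebra of End_k(W).  K = resK is an algebraic closure of k, and [sigmaK]
   is the K-linear extension to A (x)_k K of the involution of A induced by
   sigma_h; its values outside of A (x)_k K are irrelevant.  Such data exist and
   are unique up to isomorphism. *)
Record residual_model Gamma := ResidualModel {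
  resk : finFieldType;
  redF : F -> resk;
  redF_quotient :
    embeds_quotient 1 *%R 1 *%R fixed_val_ring fixed_max_ideal redF;
  redF_onto : forall x, exists2 c, fixed_val_ring c & redF c = x;

  resK : closedFieldType;
  resemb : {rmorphism resk -> resK};
  resK_algebraic : forall z : resK, algebraicOver resemb z;

  W_dim : nat;
  redV : R -> V -> 'cV[resk]_W_dim;
  redV_add : forall t v w, Gamma t v -> Gamma t w ->
    redV t (v + w) = redV t v + redV t w;
  redV_scale : forall t v c, Gamma t v -> fixed_val_ring c ->
    redV t (rscale v c%:A) = redF c *: redV t v;
  redV_ker : forall t v, Gamma t v ->
    (redV t v = 0 <-> right_part Gamma t v);
  redV_span : forall w, exists n (t : 'I_n -> R) (v : 'I_n -> V),
    (forall i, [/\ 0 <= t i, t i < (degD X)%:R^-1 & Gamma (t i) (v i)]) /\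
    w = \sum_i redV (t i) (v i);
  redV_direct : forall n (t : 'I_n -> R) (v : 'I_n -> V), injective t ->
    (forall i, [/\ 0 <= t i, t i < (degD X)%:R^-1 & Gamma (t i) (v i)]) ->
    \sum_i redV (t i) (v i) = 0 -> forall i, redV (t i) (v i) = 0;

  redE : 'End(V) -> 'M[resk]_W_dim;
  redE_action : forall a t v, filt0 Gamma a ->
    0 <= t -> t < (degD X)%:R^-1 -> Gamma t v ->
    redE a *m redV t v = redV t (a v);
  redE_quotient : embeds_quotient \1%VF (fun a b => (a \o b)%VF) 1%:M mulmx
    (filt0 Gamma) (filt0plus Gamma) redE;

  sigmaK : {linear 'M[resK]_W_dim -> 'M[resK]_W_dim};
  sigmaK_adjoint : forall a b, filt0 Gamma a -> adjoint X a b ->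
    sigmaK (map_mx resemb (redE a)) = map_mx resemb (redE b)
}.

Section ReductiveQuotient.
Variables (Gamma : R -> set V) (M : residual_model Gamma).

(* A (x)_k K *)
Definition geometric_algebra : set 'M[resK M]_(W_dim M) :=
  [set x | exists n (c : 'I_n -> resK M) (a : 'I_n -> 'End(V)),
     (forall i, filt0 Gamma (a i)) /\
     x = \sum_i c i *: map_mx (resemb M) (redE M (a i))].

(* The group of K-points.  The determinant on W is the norm in question: for a
   in filt0 Gamma (and bar trivial on F, as it is in the orthogonal case) it is
   the reduction of the reduced norm of a. *)
Definition geometric_group : set (zariski (resK M) (W_dim M)) :=
  [set x : 'M[resK M]_(W_dim M) |
     [/\ geometric_algebra x, x *m sigmaK M x = 1%:M &
         orthogonal X -> \det x = 1]].

Definition identity_component : set (zariski (resK M) (W_dim M)) :=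
  connected_component geometric_group (1%:M : 'M[resK M]_(W_dim M)).

End ReductiveQuotient.

Arguments identity_component {Gamma} M.

(* P^0(Gamma) *)
Definition connected_stabilizer Gamma : set 'End(V) :=
  [set g | stabilizer Gamma g /\
     exists M : residual_model Gamma,
       identity_component M (map_mx (resemb M) (redE M g))].

Definition parahoric (H : set 'End(V)) : Prop :=
  exists2 Gamma, self_dual_lattice_function Gamma &
                 H = connected_stabilizer Gamma.

Definition maximal_parahoric (H : set 'End(V)) : Prop :=
  parahoric H /\ forall H', parahoric H' -> H `<=` H' -> H' = H.

End LatticeFunctions.

(* Main.v *)
(* Write Gamma as a chain (L_m) with jumps in (1/4d)Z.  Maximality of the order
   leaves jumps only at 0 and 1/2d modulo 1/d: L_{-1} = L_0 and L_1 = L_2.  As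
   P^0(Gamma) is not maximal, it lies in a different P^0(Gamma1).  Intersecting
   L_c (c = 0 or 2) with a late step of Gamma1 and adding L_{c+1} gives an
   isotropic lattice M strictly between L_{c+1} and L_c, stable under
   P^0(Gamma).  Then M is stable under every skew x of the order with x^3
   in its radical, because the Cayley transform of x lies in
   P^0(Gamma).  Applied to the x attached to a hyperbolic pair (e, f) with e in
   M, this forces M / L_{c+1} to be a Lagrangian line of a hyperbolic plane
   L_c / L_{c+1}, on which the form is split orthogonal: O(2) is not connected,
   its identity component is a torus preserving both isotropic lines.  So
   inserting M in the chain yields a smaller order with the same connected
   stabilizer.  The comparison of identity components takes place in the
   geometric reductive quotient, with p = e h(f, -) and q = f eps h(e, -) in
   the role of the two projections of the plane. *)

Require Import Defs.
From HB Require Import structures.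
From mathcomp Require Import all_boot all_order all_algebra all_field.
From mathcomp Require Import -(notations) mpoly.
From mathcomp Require Import boolp classical_sets reals topology.
From mathcomp Require Import zify ring lra.

Set Implicit Arguments.
Unset Strict Implicit.
Unset Printing Implicit Defensive.

Import Order.TTheory GRing.Theory Num.Theory.

Local Open Scope classical_set_scope.
Local Open Scope ring_scope.

(** * Valuations *)

(** The definition of $P^0$ shapes the proof: membership means lying in a Zariski identity component
    over an algebraic closure, so curves are needed to enter $P^0$ and clopen conditions to bound
    it. The Cayley transform gives the curves: it is an exact isometry over $F$ as soon as $1+x$ is
    invertible, and modulo the radical it is a polynomial curve through 1. Only $x^3$ in the radical
    can be asked, not $x^3=0$, because the pair (e, f) is isotropic only modulo a power of
    $\mathfrak p_D$. The clopen condition is the vanishing of an idempotent. The mesh $1/4d$ comes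
    from duality: it sends a jump at $t$ to one at $-t$, so the jump at $c/4d$, its own mirror image
    modulo $1/d$, splits into the symmetric jumps $(c\pm1)/4d$. The two identity components can be
    compared as sets because the reductive quotient of the refined chain is modelled on the
    coordinate space of the original one. *)

Section ValuationTheory.
Variables (A : unitRingType) (v : A -> int).
Hypothesis unitA : forall x : A, x != 0 -> x \is a GRing.unit.
Hypothesis v_val : normalized_valuation v.
Implicit Types x y : A.

Lemma val_mul_neq0 (x y : A) : x != 0 -> y != 0 -> x * y != 0.
Proof.
move=> x0 y0; apply/eqP => xy0; move: y0.
by rewrite -[y](mulKr (unitA x0)) xy0 mulr0 eqxx.
Qed.

Lemma val_mul x y : x != 0 -> y != 0 -> v (x * y) = v x + v y.
Proof. by case: v_val => vM _ _; apply: vM. Qed.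

Lemma val_one : v 1 = 0.
Proof.
have := val_mul (oner_neq0 A) (oner_neq0 A).
by rewrite mulr1 => /eqP; rewrite -subr_eq0 opprD addrA subrr sub0r oppr_eq0 => /eqP.
Qed.

Lemma val_inv x : x != 0 -> v x^-1 = - v x.
Proof.
move=> x0; have xV0 : x^-1 != 0.
  by apply/eqP => xV; have := divrr (unitA x0); rewrite xV mulr0 => /esym/eqP; rewrite oner_eq0.
by apply/eqP; rewrite -addr_eq0 -val_mul // mulVr ?val_one ?unitA.
Qed.

Lemma val_inv_neq0 x : x != 0 -> x^-1 != 0.
Proof.
move=> x0; apply/eqP => xV; have := divrr (unitA x0).
by rewrite xV mulr0 => /esym/eqP; rewrite oner_eq0.
Qed.

Lemma val_opp x : v (- x) = v x.
Proof.
have [->|x0] := eqVneq x 0; first by rewrite oppr0.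
have N0 : (-1 : A) != 0 by rewrite oppr_eq0 oner_neq0.
have : v (-1) + v (-1) = 0 by rewrite -val_mul // mulrNN mulr1 val_one.
move=> e; have e0 : v (-1) = 0 by move: e; move: (v (-1)) => z; lia.
by rewrite -mulN1r val_mul // e0 add0r.
Qed.

Lemma val_geW m n x : n <= m -> val_ge v m x -> val_ge v n x.
Proof. by move=> nm [->|h]; [left|right; apply: le_trans h]. Qed.

Lemma val_geN m x : val_ge v m x -> val_ge v m (- x).
Proof. by case=> [->|h]; [left; rewrite oppr0|right; rewrite val_opp]. Qed.

Lemma val_geD m x y : val_ge v m x -> val_ge v m y -> val_ge v m (x + y).
Proof.
case=> [->|hx]; first by rewrite add0r.
case=> [->|hy]; first by rewrite addr0; right.
have [xy0|xy0] := eqVneq (x + y) 0; [by left|right].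
have [x0|x0] := eqVneq x 0; first by rewrite x0 add0r.
have [y0|y0] := eqVneq y 0; first by rewrite y0 addr0.
case: v_val => _ vD _; apply: le_trans (vD _ _ x0 y0 xy0).
by rewrite le_min hx hy.
Qed.

Lemma val_geB m x y : val_ge v m x -> val_ge v m y -> val_ge v m (x - y).
Proof. by move=> hx hy; apply: val_geD => //; apply: val_geN. Qed.

Lemma val_geM m n x y : val_ge v m x -> val_ge v n y -> val_ge v (m + n) (x * y).
Proof.
have [->|x0] := eqVneq x 0; first by rewrite mul0r; left.
have [->|y0] := eqVneq y 0; first by rewrite mulr0; left.
case=> [/eqP|hx]; first by rewrite (negPf x0).
case=> [/eqP|hy]; first by rewrite (negPf y0).
by right; rewrite val_mul // lerD.
Qed.

Lemma val_geMW m n k x y : k <= m + n ->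
  val_ge v m x -> val_ge v n y -> val_ge v k (x * y).
Proof. by move=> kmn hx hy; apply: val_geW kmn _; apply: val_geM. Qed.

Lemma val_ge_sum m (I : Type) (r : seq I) (P : pred I) (E : I -> A) :
  (forall i, P i -> val_ge v m (E i)) -> val_ge v m (\sum_(i <- r | P i) E i).
Proof. by move=> h; elim/big_ind: _ => //; [left|apply: val_geD]. Qed.

Lemma val_geNP m x : ~ val_ge v m x -> x != 0 /\ v x < m.
Proof.
move=> h; split; first by apply/eqP => x0; apply: h; left.
by rewrite ltNge; apply/negP => mx; apply: h; right.
Qed.

Lemma val_ge_neq0 m x : x != 0 -> val_ge v m x -> m <= v x.
Proof. by move=> x0 [/eqP|//]; rewrite (negPf x0). Qed.

Lemma val_geV m x : x != 0 -> v x <= m -> val_ge v (- m) x^-1.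
Proof. by move=> x0 xm; right; rewrite val_inv // lerN2. Qed.

Lemma val_ge1 : val_ge v 0 1. Proof. by right; rewrite val_one. Qed.

Lemma val_ge_eq0 x : (forall n : nat, val_ge v n x) -> x = 0.
Proof.
move=> h; apply/eqP; apply: contraT => x0.
by have := val_ge_neq0 x0 (h `|v x|.+1); lia.
Qed.

Lemma val_exp x n : x != 0 -> x ^+ n != 0 /\ v (x ^+ n) = v x * n%:Z.
Proof.
move=> x0; elim: n => [|n [IH0 IH]]; first by rewrite expr0 val_one mulr0 oner_neq0.
by rewrite exprS val_mul_neq0 // val_mul // IH; split=> //; lia.
Qed.

Lemma val_geX m x n : val_ge v m x -> val_ge v (m * n%:Z) (x ^+ n).
Proof.
move=> h; elim: n => [|n IH]; first by rewrite mulr0 expr0; exact: val_ge1.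
have -> : m * n.+1%:Z = m + m * n%:Z by lia.
by rewrite exprS; apply: val_geM.
Qed.

Lemma exprz_neq0 x (n : int) : x != 0 -> x ^ n != 0.
Proof.
move=> x0; case: n => n; first by case: (val_exp n x0).
rewrite NegzE -exprz_inv; apply: (val_exp _ _).1; exact: val_inv_neq0.
Qed.

Lemma val_exprz x (n : int) : x != 0 -> v (x ^ n) = v x * n.
Proof.
move=> x0; case: n => n; first by case: (val_exp n x0).
rewrite NegzE -exprz_inv [LHS](val_exp _ (val_inv_neq0 x0)).2 val_inv //.
by rewrite mulrN mulNr.
Qed.

End ValuationTheory.

(** * Limits and square roots in a complete valued field *)

Section CompleteFields.
Variables (F : fieldType) (v : F -> int).
Hypothesis v_val : normalized_valuation v.
Hypothesis v_complete : val_complete v.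

Let unitF (x : F) : x != 0 -> x \is a GRing.unit.
Proof. by rewrite unitfE. Qed.

(** By the ultrametric inequality consecutive differences control all differences, so the limit is
    approached at the same rate from the first term on. *)
Lemma complete_limit (u : nat -> F) :
  (forall n : nat, val_ge v n (u n.+1 - u n)) ->
  exists l, forall n : nat, val_ge v n (l - u n).
Proof.
move=> hu.
have hmono (n k : nat) : val_ge v n (u (n + k)%N - u n).
  elim: k => [|k IH]; first by rewrite addn0 subrr; left.
  have -> : u (n + k.+1)%N - u n = (u (n + k).+1 - u (n + k)%N) + (u (n + k)%N - u n).
    by rewrite addnS addrA subrK.
  by apply: (val_geD v_val) => //; apply: val_geW (hu _); lia.
suff [l hl] : exists l : F, forall m : int, exists n : nat, forall i : nat,
    (n <= i)%N -> val_ge v m (u i - l).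
  exists l => n; have [n0 h0] := hl n.
  have -> : l - u n = - (u (n + n0)%N - l) + (u (n + n0)%N - u n) by ring.
  by apply: (val_geD v_val) => //; apply: (val_geN v_val) => //; apply: h0; rewrite leq_addl.
apply: v_complete => m; exists `|m|%N => i j hi hj.
have -> : u i - u j = (u i - u `|m|%N) - (u j - u `|m|%N) by ring.
apply: (@val_geW _ _ `|m|%N); first by lia.
by apply: (val_geB v_val) => //; [rewrite -(subnKC hi)|rewrite -(subnKC hj)].
Qed.

Hypothesis v_odd : ~ val_max_ideal v 2%:R.

Lemma val_two : (2%:R : F) != 0 /\ v 2%:R = 0.
Proof.
have [n0 n1] := val_geNP v_odd; split=> //.
suff : 0 <= v 2%:R by move: n1; move: (v _) => z; lia.
apply: val_ge_neq0 n0 _.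
by rewrite (natrD _ 1 1); apply: (val_geD v_val) => //; apply: val_ge1.
Qed.

Lemma complete_sqrt (x : F) : val_ge v 1 x ->
  exists2 y, val_ge v 1 (y - 1) & y ^+ 2 = 1 + x.
Proof.
move=> hx; have [two0 v2] := val_two.
have half : val_ge v 0 (2%:R^-1 : F).
  by rewrite -oppr0; apply: val_geV => //; rewrite v2.
(* The equation $(1+l)^2=1+x$ reads $l=(x-l^2)/2$, and on $\mathfrak p_F$ the right-hand side is a
   contraction because 2 is a unit. *)
pose u := fix u n := if n is n'.+1 then (x - u n' ^+ 2) / 2%:R else 0.
have u1 n : val_ge v 1 (u n).
  elim: n => [|n IH] /=; first by left.
  apply: (val_geMW v_val (m := 1) (n := 0)) => //; apply: (val_geB v_val) => //.
  exact: (val_geMW v_val (m := 1) (n := 1)).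
have hu (n : nat) : val_ge v n (u n.+1 - u n).
  apply: (@val_geW _ _ (n.+1 : int)); first by lia.
  elim: n => [|n IH]; first by rewrite /u; rewrite [X in _ - X]/= subr0; exact: (u1 1%N).
  have -> : u n.+2 - u n.+1 = (- (u n.+1 - u n)) * ((u n.+1 + u n) * 2%:R^-1).
    by rewrite /=; field.
  apply: (val_geMW v_val (m := n.+1) (n := 1)); first by lia.
    exact: (val_geN v_val).
  apply: (val_geMW v_val (m := 1) (n := 0)) => //.
  by apply: (val_geD v_val) => //; apply: u1.
have [l hl] := complete_limit hu.
have l1 : val_ge v 1 l.
  by rewrite -(subrK (u 1%N) l); apply: (val_geD v_val) => //; exact: hl 1%N.
exists (1 + l); first by rewrite addrC addKr.
suff hlx : l - (x - l ^+ 2) / 2%:R = 0.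
  have -> : (1 + l) ^+ 2 = 1 + x + 2%:R * (l - (x - l ^+ 2) / 2%:R) by field.
  by rewrite hlx mulr0 addr0.
apply: (@val_ge_eq0 _ v) => n.
(* With $T$ the iterated map, $l-T(l)=(l-u_{n+1})+(T(u_n)-T(l))$, and both terms tend to 0. *)
have -> : l - (x - l ^+ 2) / 2%:R =
    (l - u n.+1) + ((l - u n) * (l + u n)) * 2%:R^-1 by rewrite /=; field.
apply: (val_geD v_val) => //; first by apply: (@val_geW _ _ n.+1); [lia|exact: hl].
apply: (val_geMW v_val (m := n) (n := 0)) => //; first by lia.
apply: (val_geMW v_val (m := n) (n := 1)) => //; first by lia.
exact: (val_geD v_val).
Qed.

End CompleteFields.

(** * The valuation ring of the division algebra and its anti-involution *)

Section DivisionAlgebra.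
Variables (F : fieldType) (D : falgType F) (V : vectType D^c).
Variable X : hermitian_datum V.
Local Notation vF := (valF X).
Local Notation vD := (valD X).

Lemma unitF (x : F) : x != 0 -> x \is a GRing.unit.
Proof. by rewrite unitfE. Qed.

Lemma valF_val : normalized_valuation vF.
Proof. by case: (valF_local X). Qed.

Lemma valF_complete : val_complete vF.
Proof. by case: (valF_local X). Qed.

Let uD := D_skew_field X.
Let nD := valD_valuation X.
Let nF := valF_val.

Lemma alg_neq0 (c : F) : c != 0 -> (c%:A : D) != 0.
Proof. by move=> c0; rewrite scaler_eq0 (negPf c0) oner_eq0. Qed.

Lemma val_ge_alg m c : 0 <= m -> val_ge vF m c -> val_ge vD m c%:A.
Proof.
move=> m0; have [->|c0] := eqVneq c 0; first by rewrite scale0r; left.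
move=> /(val_ge_neq0 c0) h; right.
by have [e e0 ->] := valD_extends X => //; nia.
Qed.

(** Dividing a linear relation over $F$ by its coefficient of least valuation gives an integral
    relation with a coefficient 1, which residual independence forbids. *)
Lemma residually_indep_bound (e : int) n (w : 'I_n -> D) :
  0 < e ->
  (forall c : 'I_n -> F, (forall i, val_ge vF 0 (c i)) ->
     val_ge vD e (\sum_i c i *: w i) -> forall i, val_ge vF 1 (c i)) ->
  (n <= \dim {:D})%N.
Proof.
move=> e0 hw; pose t : n.-tuple D := [tuple w i | i < n].
suff : free t.
  by move/eqP; rewrite size_tuple => <-; apply: dimvS; apply: subvf.
apply/freeP => k; under eq_bigr => i _ do rewrite -tnth_nth tnth_mktuple.
move=> k0 i1; apply/eqP; apply: contraT => ki1.
case: (@arg_minP _ _ _ i1 (fun i => k i != 0) (fun i => vF (k i)) ki1) => i0 ki0 hmin.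
have := hw (fun i => k i / k i0) _ _ i0; rewrite divff //.
case.
- move=> i; have [->|ki] := eqVneq (k i) 0; first by rewrite mul0r; left.
  right; rewrite (val_mul nF) ?invr_eq0 // (val_inv unitF nF) //.
  by rewrite subr_ge0; apply: hmin.
- under eq_bigr => i _ do rewrite mulrC -scalerA.
  by rewrite -scaler_sumr k0 scaler0; left.
- by move/eqP; rewrite oner_eq0.
- by rewrite (val_one nF).
Qed.

(** A maximal family of integers that is independent modulo $\mathfrak p_F o_D$ spans $o_D$ modulo
    $\mathfrak p_F o_D$; completeness of $F$ then turns successive approximation into an exact
    expansion. Here [e] is the ramification index, so valuation at least [e] means lying in
    $\mathfrak p_F o_D$. *)
Lemma val_ring_fg : exists m (w : 'I_m -> D),
  (forall i, val_ge vD 0 (w i)) /\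
  forall x, val_ge vD 0 x -> exists2 c : 'I_m -> F,
    forall i, val_ge vF 0 (c i) & x = \sum_i c i *: w i.
Proof.
have [e e0 he] := valD_extends X.
have [_ _ [pi pi0 vpi]] := nF.
have vpiA : vD pi%:A = e%:Z by rewrite he // vpi mulr1.
pose indep n (w : 'I_n -> D) := (forall i, val_ge vD 0 (w i)) /\
  forall c : 'I_n -> F, (forall i, val_ge vF 0 (c i)) ->
     val_ge vD e (\sum_i c i *: w i) -> forall i, val_ge vF 1 (c i).
have ex0 : exists n, `[< exists w, @indep n w >].
  by exists 0%N; apply/asboolP; exists (fun _ => 0); split=> [[]|c _ _ []].
have bnd n : `[< exists w, @indep n w >] -> (n <= \dim {:D})%N.
  by move=> /asboolP[w [_ hw]]; apply: (@residually_indep_bound e n w) => //; lia.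
have [n /asboolP[w [w_int w_ind]] n_max] := ex_maxnP ex0 bnd.
exists n, w; split=> //.
have e_scale c x : val_ge vF 1 c -> val_ge vD 0 x -> val_ge vD e (c *: x).
  move=> hc hx; rewrite -mulr_algl -(addr0 e%:Z); apply: (val_geM nD) => //.
  have [->|c0] := eqVneq c 0; first by rewrite scale0r; left.
  by right; rewrite he //; have := val_ge_neq0 c0 hc; nia.
have o_scale c x : val_ge vF 0 c -> val_ge vD 0 x -> val_ge vD 0 (c *: x).
  move=> hc hx; rewrite -mulr_algl -(addr0 0); apply: (val_geM nD) => //.
  exact: val_ge_alg.
have step x : exists p : ('I_n -> F) * D, val_ge vD 0 x ->
   [/\ forall i, val_ge vF 0 (p.1 i), val_ge vD 0 p.2 &
       x = \sum_i p.1 i *: w i + pi *: p.2].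
  have [hx|hx] := pselect (val_ge vD 0 x); last by exists (fun=> 0, 0).
  (* By maximality of [n], adjoining [x] creates a dependence. Its coefficient at [x] is a unit,
     since otherwise independence of [w] would put all coefficients in $\mathfrak p_F$. *)
  pose w' (i : 'I_n.+1) := if unlift ord0 i is Some j then w j else x.
  have : ~ indep n.+1 w'.
    move=> h; suff : (n.+1 <= n)%N by rewrite ltnn.
    by apply: n_max; apply/asboolP; exists w'.
  move/not_andP; case.
    by case=> i; rewrite /w'; case: unliftP.
  move=> /existsNP[c /not_implyP[c_int /not_implyP[hc /existsNP[i0 ci0]]]].
  move: hc; rewrite big_ord_recl {1}/w' unlift_none.
  under eq_bigr => i _ do rewrite /w' liftK.
  move=> hc.
  have c0 : ~ val_ge vF 1 (c ord0).
    move=> c0; apply: ci0; case: (unliftP ord0 i0) => [j ->|-> //].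
    apply: (w_ind (fun j => c (lift ord0 j))) => [i|]; first exact: c_int.
    rewrite -[X in val_ge _ _ X](addKr (c ord0 *: x)) addrC.
    by apply: (val_geB nD) => //; apply: e_scale.
  have [cn0 cv] := val_geNP c0.
  have cv0 : vF (c ord0) = 0 by have := val_ge_neq0 cn0 (c_int ord0); lia.
  have cV : val_ge vF 0 (c ord0)^-1.
    by right; rewrite (val_inv unitF nF) // cv0.
  set s := \sum_(i < n) _ in hc.
  exists (fun i => - (c ord0)^-1 * c (lift ord0 i),
          pi^-1 *: ((c ord0)^-1 *: (c ord0 *: x + s))) => _; split=> /=.
  - move=> i; rewrite -(addr0 0); apply: (val_geM nF) => //.
    exact: (val_geN nF).
  - rewrite -mulr_algl; have -> : (0 : int) = - e%:Z + e%:Z by rewrite addNr.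
    apply: (val_geM nD) => //.
      right; rewrite he ?invr_eq0 // (val_inv unitF nF) // vpi; lia.
    rewrite -mulr_algl -(add0r e%:Z); apply: (val_geM nD) => //.
    exact: val_ge_alg.
  - rewrite (scalerA pi) divff // scale1r scalerDr scalerA mulVf // scale1r.
    rewrite /s scaler_sumr addrCA -big_split /= big1 ?addr0 // => i _.
    by rewrite scalerA mulNr scaleNr addNr.
have {step} /choice[f hf] := step.
(* [y] lists the successive remainders of [x], and [s] below the partial sums of the coordinates. *)
move=> x hx; pose y k := iter k (fun x => (f x).2) x.
have hy k : val_ge vD 0 (y k).
  by elim: k => //= k IH; case: (hf _ IH).
pose s i N := \sum_(k < N) pi ^+ k * (f (y k)).1 i.
have hs i (N : nat) : val_ge vF N (s i N.+1 - s i N).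
  rewrite /s big_ord_recr /= addrAC subrr add0r.
  rewrite -(addr0 N%:Z); apply: (val_geM nF).
    by right; rewrite (val_exp unitF nF _ pi0).2 vpi mul1r.
  by case: (hf _ (hy N)).
have hxs N : x = \sum_i s i N *: w i + pi ^+ N *: y N.
  elim: N => [|N IH].
    by rewrite big1 ?add0r ?scale1r // => i _; rewrite /s big_ord0 scale0r.
  have [_ _ e1] := hf _ (hy N); rewrite {1}IH {1}e1 /=.
  rewrite scalerDr scalerA -exprSr addrA scaler_sumr -big_split /=.
  congr (_ + _); apply: eq_bigr => i _.
  by rewrite /s big_ord_recr /= scalerDl scalerA.
have /choice[l hl] i := complete_limit nF valF_complete (hs i).
exists l.
  by move=> i; have := hl i 0%N; rewrite /s big_ord0 subr0.
apply/eqP; rewrite -subr_eq0; apply/eqP.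
apply: (@val_ge_eq0 _ vD) => N; rewrite {1}(hxs N) addrAC -sumrB.
apply: (val_geD nD) => //.
  apply: (val_ge_sum nD) => // i _; rewrite -scalerBl -mulr_algl.
  rewrite -(addr0 N%:Z); apply: (val_geM nD) => //.
  apply: val_ge_alg => //; rewrite -opprB.
  exact: (val_geN nF).
rewrite -mulr_algl -(addr0 N%:Z); apply: (val_geM nD) => //.
apply: val_ge_alg => //.
by right; rewrite (val_exp unitF nF _ pi0).2 vpi mul1r.
Qed.

Lemma bar0 : bar X 0 = 0.
Proof. by have := bar_add X 0 0; rewrite addr0 -{1}[bar X 0]addr0 => /addrI <-. Qed.

Lemma bar1 : bar X 1 = 1.
Proof. by rewrite -[RHS](bar_invol X) -[in RHS](mulr1 (bar X 1)) bar_mul bar_invol mulr1. Qed.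

Lemma barN x : bar X (- x) = - bar X x.
Proof. by apply/eqP; rewrite -addr_eq0 -bar_add addNr bar0. Qed.

Lemma barB x y : bar X (x - y) = bar X x - bar X y.
Proof. by rewrite bar_add barN. Qed.

Lemma bar_sum (I : Type) (r : seq I) (P : pred I) (E : I -> D) :
  bar X (\sum_(i <- r | P i) E i) = \sum_(i <- r | P i) bar X (E i).
Proof. by elim/big_rec2: _ => [|i x y _ <-]; rewrite ?bar0 ?bar_add. Qed.

Lemma bar_neq0 x : x != 0 -> bar X x != 0.
Proof. by apply: contra => /eqP h; rewrite -(bar_invol X x) h bar0. Qed.

Lemma bar_exp x n : bar X (x ^+ n) = bar X x ^+ n.
Proof. by elim: n => [|n IH]; rewrite ?bar1 // exprS bar_mul IH -exprSr. Qed.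

Lemma algX (c : F) n : (c ^+ n)%:A = c%:A ^+ n :> D.
Proof. exact: (rmorphXn (in_alg D)). Qed.

Lemma algM (c c' : F) : (c * c')%:A = c%:A * c'%:A :> D.
Proof. exact: (rmorphM (in_alg D)). Qed.

(* 1 + p_F is 2-divisible because the residue characteristic is odd, so any
   valuation of F vanishes on it. *)
Lemma val_bar_alg c : val_ge vF 0 c -> val_ge vD 0 (bar X c%:A).
Proof.
have hp x : val_ge vF 1 x -> val_ge vD 0 (bar X x%:A).
  move=> hx; have root k : exists2 y, val_ge vF 1 (y - 1) & y ^+ (2 ^ k) = 1 + x.
    elim: k => [|k [y hy yk]].
      by exists (1 + x); rewrite ?expr1 // addrC addKr.
    have [z hz zy] := complete_sqrt nF valF_complete (@valF_odd _ _ _ X) hy.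
    by exists z => //; rewrite expnS exprM zy addrC subrK.
  have x1 : 1 + x != 0.
    apply/eqP => /eqP; rewrite addrC addr_eq0 => /eqP xe.
    have := hx; rewrite xe => /(val_ge_neq0 _); rewrite oppr_eq0 oner_eq0.
    by rewrite (val_opp nF) (val_one nF) => /(_ isT).
  suff h : vD (bar X (1 + x)%:A) = 0.
    have -> : x%:A = (1 + x)%:A - 1 :> D by rewrite scalerDl scale1r addrC addKr.
    by rewrite barB bar1; apply: (val_geB nD); [..|right; rewrite h|exact: (val_ge1 nD)].
  (* The exponent makes $2^k$ exceed the absolute value of the integer that it divides, so this
     integer is 0. *)
  have [y _ yk] := root `|vD (bar X (1 + x)%:A)|%N.
  have y0 : y != 0.
    by apply: contraNneq x1 => y0; rewrite -yk y0 expr0n expn_eq0.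
  move: yk => /(congr1 (fun c => vD (bar X c%:A))).
  rewrite algX bar_exp.
  rewrite (val_exp uD nD _ (bar_neq0 (alg_neq0 y0))).2.
  have := ltn_expl `|vD (bar X (1 + x)%:A)|%N (isT : 1 < 2)%N.
  move: (vD (bar X y%:A)) (vD (bar X (1 + x)%:A)) => z N.
  move: (2 ^ `|N|)%N => M NM zM.
  have [z0|[z1|z1]] : z = 0 \/ 1 <= z \/ z <= -1 by lia.
  - by rewrite -zM z0 mul0r.
  - have : M%:Z <= z * M%:Z by nia.
    by rewrite zM; lia.
  - have : z * M%:Z <= - M%:Z by nia.
    by rewrite zM; lia.
move=> hc; have [->|c0] := eqVneq c 0; first by rewrite scale0r bar0; left.
have [_ _ [pi pi0 vpi]] := nF.
have bc0 := bar_neq0 (alg_neq0 c0); have bp0 := bar_neq0 (alg_neq0 pi0).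
(* All $\pi c^n$ lie in $\mathfrak p_F$; letting $n$ grow excludes a negative valuation of $\bar
   c$. *)
right; have h n : 0 <= vD (bar X pi%:A) + vD (bar X c%:A) * n%:Z.
  have [cn vcn] := val_exp uD nD n bc0.
  rewrite -vcn -val_mul //.
  apply: (@val_ge_neq0 _ vD); first exact: val_mul_neq0.
  have -> : bar X pi%:A * bar X c%:A ^+ n = bar X (pi * c ^+ n)%:A.
    by rewrite -bar_exp -bar_mul -algX -algM mulrC.
  apply: hp; rewrite -(addr0 1); apply: (val_geM nF).
    by right; rewrite vpi.
  by rewrite -(mul0r n%:Z); apply: (val_geX nF).
have := h `|vD (bar X pi%:A)|.+1; move: (vD _) (vD _) => a b; nia.
Qed.

(** Continuity of bar is not assumed. All powers of an integer [y] are combinations of the finitely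
    many generators of $o_D$ over $o_F$, so the valuations of the powers of $\bar y$ are bounded
    below, which excludes a negative valuation of $\bar y$. The general case follows by scaling with
    the uniformizer. *)
Lemma val_ge_bar m x : val_ge vD m x -> val_ge vD m (bar X x).
Proof.
have ho y : val_ge vD 0 y -> val_ge vD 0 (bar X y).
  move=> hy; have [->|y0] := eqVneq y 0; first by rewrite bar0; left.
  have [k [w [_ hw]]] := val_ring_fg.
  have [N hN] : exists N : nat, forall i, val_ge vD (- N%:Z) (bar X (w i)).
    exists (\max_i `|vD (bar X (w i))|)%N => i.
    right; have := @leq_bigmax _ (fun i => `|vD (bar X (w i))|%N) i; lia.
  have by0 := bar_neq0 y0.
  have h n : - N%:Z <= vD (bar X y) * n%:Z.
    have [yn <-] := val_exp uD nD n by0.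
    apply: (@val_ge_neq0 _ vD) => //; rewrite -bar_exp.
    have [|c hc ->] := hw (y ^+ n).
      by rewrite -(mul0r n%:Z); apply: (val_geX nD).
    rewrite bar_sum; apply: (val_ge_sum nD) => // i _.
    rewrite -mulr_algl bar_mul -(addr0 (- N%:Z)); apply: (val_geM nD) => //.
    exact: val_bar_alg.
  by right; have := h N.+1; nia.
have [u0 vu] := unif_uniformizer X.
have bu : vD (bar X (unif X)) = 1.
  by case: (bar_uniformizer X) => ->; rewrite ?(val_opp nD).
have uz0 n : unif X ^ n != 0 by apply: (exprz_neq0 uD nD).
move=> hx; have -> : x = unif X ^ m * (unif X ^ (- m) * x).
  by rewrite mulrA -exprzDr ?uD // subrr expr0z mul1r.
rewrite bar_mul; apply: (val_geMW nD (m := 0) (n := m)); first by lia.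
  apply: ho; apply: (val_geMW nD (m := - m) (n := m)) => //; first by lia.
  by right; rewrite (val_exprz uD nD) // vu mul1r.
have -> : bar X (unif X ^ m) = bar X (unif X) ^ m.
  case: m {hx} => n; first exact: bar_exp.
  rewrite NegzE -!exprz_inv [LHS]bar_exp; congr (_ ^+ _).
  apply: (@mulrI _ (bar X (unif X))); first by apply: uD; apply: bar_neq0.
  by rewrite -bar_mul mulVr ?divrr ?bar1 // uD // bar_neq0.
right; rewrite (val_exprz uD nD) ?bar_neq0 // bu; lia.
Qed.

End DivisionAlgebra.

(** * Submodules over a valuation ring, for an abstract scaling that covers both $V$ over $o_D$ and
    $\mathrm{End}_D(V)$ over $o_F$ *)

Section FinitelyGenerated.
Variables (K : unitRingType) (v : K -> int).
Hypothesis unitK : forall x : K, x != 0 -> x \is a GRing.unit.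
Hypothesis v_val : normalized_valuation v.
Variables (U : zmodType) (sc : U -> K -> U).
Hypothesis sc1 : forall u, sc u 1 = u.
Hypothesis scDl : forall u w x, sc (u + w) x = sc u x + sc w x.
Hypothesis scDr : forall u x y, sc u (x + y) = sc u x + sc u y.
Hypothesis scA : forall u x y, sc (sc u x) y = sc u (x * y).

Let sc0 u : sc u 0 = 0.
Proof. by have := scDr u 0 0; rewrite addr0 -{1}[sc u 0]addr0 => /addrI <-. Qed.

Let scN u x : sc u (- x) = - sc u x.
Proof. by apply/eqP; rewrite -addr_eq0 -scDr addNr sc0. Qed.

Let sc0l x : sc 0 x = 0.
Proof. by have := scDl 0 0 x; rewrite addr0 -{1}[sc 0 x]addr0 => /addrI <-. Qed.

Let sc_sum I (r : seq I) (P : pred I) (E : I -> U) x :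
  sc (\sum_(i <- r | P i) E i) x = \sum_(i <- r | P i) sc (E i) x.
Proof. by elim/big_rec2: _ => [|i u w _ <-]. Qed.

(* One step per generator: an element whose last coefficient has minimal
   valuation, together with generators of the subset where that coefficient
   vanishes, generates M. *)
Lemma noetherian_submodule n (e : 'I_n -> U) (M : set U) :
  M 0 -> (forall u w, M u -> M w -> M (u + w)) ->
  (forall u x, M u -> val_ge v 0 x -> M (sc u x)) ->
  (forall u, M u -> exists2 c : 'I_n -> K, forall i, val_ge v 0 (c i) &
     u = \sum_i sc (e i) (c i)) ->
  exists m (e' : 'I_m -> U),
    M = [set u | exists2 c : 'I_m -> K, forall i, val_ring v (c i) &
           u = \sum_i sc (e' i) (c i)].
Proof.
elim: n e M => [|n IH] e M M0 MD MZ Me.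
  exists 0%N, (fun=> 0); apply/seteqP; split=> u /=.
    by move=> /Me[c _]; rewrite big_ord0 => ->; exists (fun=> 0) => [[]//|]; rewrite big_ord0.
  by case=> c _; rewrite big_ord0 => ->.
have MB u w : M u -> M w -> M (u - w).
  move=> hu hw; apply: MD => //; rewrite -[w]sc1 -scN; apply: MZ => //.
  by apply: (val_geN v_val); apply: (val_ge1 v_val).
pose span k (e : 'I_k -> U) := [set u | exists2 c : 'I_k -> K,
  forall i, val_ge v 0 (c i) & u = \sum_i sc (e i) (c i)].
pose M' := M `&` span n (fun i => e (lift ord0 i)).
have spanD k (e' : 'I_k -> U) u w : span k e' u -> span k e' w -> span k e' (u + w).
  move=> [c hc ->] [c' hc' ->]; exists (fun i => c i + c' i).
    by move=> i; apply: (val_geD v_val).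
  by rewrite -big_split; apply: eq_bigr => i _; rewrite scDr.
have spanZ k (e' : 'I_k -> U) u x : span k e' u -> val_ge v 0 x -> span k e' (sc u x).
  move=> [c hc ->] hx; exists (fun i => c i * x).
    by move=> i; apply: (val_geMW v_val (m := 0) (n := 0)).
  by rewrite sc_sum; apply: eq_bigr => i _; rewrite scA.
have [m [e' M'E]] : exists m (e' : 'I_m -> U),
    M' = [set u | exists2 c : 'I_m -> K, forall i, val_ring v (c i) &
           u = \sum_i sc (e' i) (c i)].
  apply: (IH (fun i => e (lift ord0 i))).
  - by split=> //; exists (fun=> 0) => [i|]; [left|rewrite big1].
  - by move=> u w [hu su] [hw sw]; split; [apply: MD|apply: spanD].
  - by move=> u x [hu su] hx; split; [apply: MZ|apply: spanZ].
  - by move=> u [].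
(* The generators may be dependent, so [c0] is only one possible coefficient of [u] at the generator
   [e ord0]. *)
pose lead u c0 := [/\ M u, val_ge v 0 c0 & span n (fun i => e (lift ord0 i)) (u - sc (e ord0) c0)].
have leadP u : M u -> exists c0, lead u c0.
  move=> hu; have [c hc ue] := Me _ hu; exists (c ord0); split=> //.
  exists (fun i => c (lift ord0 i)) => [i|]; first exact: hc.
  by rewrite {1}ue big_ord_recl addrC addKr.
have [[u0 [c0 [l0 c00]]]|no] := pselect (exists u c, lead u c /\ c != 0); last first.
  exists m, e'; rewrite -M'E; apply/seteqP; split=> u; last by case.
  move=> hu; split=> //; have [c lc] := leadP _ hu; case: (lc) => _ _ hs.
  have c0 : c = 0.
    by apply/eqP; apply: contraT => c0; case: no; exists u, c.
  by move: hs; rewrite c0 sc0 subr0.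
pose P k := `[< exists u c, [/\ lead u c, c != 0 & `|v c|%N = k] >].
have exP : exists k, P k by exists `|v c0|%N; apply/asboolP; exists u0, c0.
have [k /asboolP[u1 [c1 [l1 c10 vc1]]] kmin] := ex_minnP exP.
pose e1 (i : 'I_m.+1) := if unlift ord0 i is Some j then e' j else u1.
exists m.+1, e1; apply/seteqP; split=> u.
  move=> hu; have [c lc] := leadP _ hu; case: (lc) => _ hc hs.
  have hx : val_ge v 0 (c1^-1 * c).
    have [->|cn0] := eqVneq c 0; first by rewrite mulr0; left.
    have : (k <= `|v c|)%N by apply: kmin; apply/asboolP; exists u, c.
    move=> kc; case: l1 => _ hc1 _.
    right; rewrite (val_mul v_val) ?(val_inv_neq0 unitK) // (val_inv unitK) //.
    by have := val_ge_neq0 cn0 hc; have := val_ge_neq0 c10 hc1; lia.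
  have : M' (u - sc u1 (c1^-1 * c)).
    case: (l1) => M1 _ [d1 hd1 hs1]; split; first by apply: MB => //; apply: MZ.
    have -> : u - sc u1 (c1^-1 * c) = (u - sc (e ord0) c) +
        sc (u1 - sc (e ord0) c1) (- (c1^-1 * c)).
      have c1K : c1 * (c1^-1 * c) = c by rewrite mulrA divrr ?mul1r ?unitK.
      move: (c1^-1 * c) c1K => y <-.
      rewrite -scA scN scDl opprD -[- sc (e ord0) c1]scN !scA mulNr scN opprK.
      by rewrite addrACA addNr addr0.
    apply: spanD => //; apply: spanZ; last exact: (val_geN v_val).
    by exists d1.
  rewrite M'E => -[d hd ud].
  exists (fun i => if unlift ord0 i is Some j then d j else c1^-1 * c).
    by move=> i; case: unliftP => [j _|_].
  rewrite big_ord_recl /e1 unlift_none -[LHS](subrK (sc u1 (c1^-1 * c))) ud addrC.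
  by congr (_ + _); apply: eq_bigr => i _; rewrite liftK.
case=> c hc ->; rewrite big_ord_recl /e1 unlift_none; apply: MD.
  by have [Mu1 _ _] := l1; apply: MZ => //; apply: hc.
have : M' (\sum_(i < m) sc (e' i) (c (lift ord0 i))).
  by rewrite M'E; exists (fun i => c (lift ord0 i)).
by case=> + _; congr M; apply: eq_bigr => i _; rewrite liftK.
Qed.

End FinitelyGenerated.

(** * Right vector spaces, hermitian forms and lattices *)

Section RightScaling.
Import VectorInternalTheory.
Variables (F : fieldType) (D : falgType F) (V : vectType D^c).
Implicit Types (v w : V) (x y : D).

Lemma rscaleDl v w x : rscale (v + w) x = rscale v x + rscale w x.
Proof. exact: scalerDr. Qed.

Lemma rscaleDr v x y : rscale v (x + y) = rscale v x + rscale v y.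
Proof. exact: scalerDl. Qed.

Lemma rscaleA v x y : rscale (rscale v x) y = rscale v (x * y).
Proof. exact: scalerA. Qed.

Lemma rscale1 v : rscale v 1 = v.
Proof. exact: scale1r. Qed.

Lemma rscale0r v : rscale v 0 = 0.
Proof. exact: scale0r. Qed.

Lemma rscale0l x : rscale (0 : V) x = 0.
Proof. exact: scaler0. Qed.

Lemma rscaleNr v x : rscale v (- x) = - rscale v x.
Proof. exact: scaleNr. Qed.

Lemma rscaleNl v x : rscale (- v) x = - rscale v x.
Proof. exact: scalerN. Qed.

Lemma rscaleBr v x y : rscale v (x - y) = rscale v x - rscale v y.
Proof. exact: scalerBl. Qed.

Lemma rscaleBl v w x : rscale (v - w) x = rscale v x - rscale w x.
Proof. exact: scalerBr. Qed.

Lemma rscale_suml I (r : seq I) (P : pred I) (E : I -> V) x :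
  rscale (\sum_(i <- r | P i) E i) x = \sum_(i <- r | P i) rscale (E i) x.
Proof. exact: scaler_sumr. Qed.

Lemma rscale_sumr I (r : seq I) (P : pred I) (E : I -> D) v :
  rscale v (\sum_(i <- r | P i) E i) = \sum_(i <- r | P i) rscale v (E i).
Proof. exact: scaler_suml. Qed.

Lemma lfun_rscale (a : 'End(V)) v x : a (rscale v x) = rscale (a v) x.
Proof. exact: linearZ. Qed.

Lemma lfunD (a : 'End(V)) v w : a (v + w) = a v + a w.
Proof. exact: linearD. Qed.

Lemma lfunB (a : 'End(V)) v w : a (v - w) = a v - a w.
Proof. exact: linearB. Qed.

Lemma lfun0 (a : 'End(V)) : a 0 = 0.
Proof. exact: linear0. Qed.

Lemma lfun_sum (a : 'End(V)) I (r : seq I) (P : pred I) (E : I -> V) :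
  a (\sum_(i <- r | P i) E i) = \sum_(i <- r | P i) a (E i).
Proof. exact: linear_sum. Qed.

Definition vcoord (i : 'I_(vector.dim V)) v : D := v2r v 0 i.
Definition vbase (i : 'I_(vector.dim V)) : V := r2v (delta_mx 0 i).

Lemma vcoord_sum v : v = \sum_i rscale (vbase i) (vcoord i v).
Proof.
rewrite -[LHS]v2rK [v2r v]row_sum_delta.
by rewrite linear_sum; apply: eq_bigr => i _; rewrite linearZ.
Qed.

Lemma vcoordD i v w : vcoord i (v + w) = vcoord i v + vcoord i w.
Proof. by rewrite /vcoord linearD mxE. Qed.

Lemma vcoordZ i v x : vcoord i (rscale v x) = vcoord i v * x.
Proof. by rewrite /vcoord /rscale linearZ mxE. Qed.

Lemma vcoord_base i j : vcoord i (vbase j) = (i == j)%:R.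
Proof. by rewrite /vcoord /vbase r2vK mxE eqxx. Qed.

Lemma vcoord_inj v w : (forall i, vcoord i v = vcoord i w) -> v = w.
Proof. by move=> h; rewrite (vcoord_sum v) (vcoord_sum w); apply: eq_bigr => i _; rewrite h. Qed.

Lemma lfun_from (f : V -> V) :
  (forall v w, f (v + w) = f v + f w) ->
  (forall v x, f (rscale v x) = rscale (f v) x) ->
  exists a : 'End(V), forall v, a v = f v.
Proof.
move=> fD fZ; have lin : linear f by move=> x v w; rewrite fD -[x *: v]/(rscale v x) fZ.
pose g : {linear V -> V} := HB.pack f (GRing.isLinear.Build _ _ _ _ _ lin).
by exists (linfun g) => v; rewrite -[RHS]/(g v) -(lfunE g v).
Qed.

(* V is finite-dimensional over F as well, through its coordinates. *)
Lemma lfun_inj_surj (a : 'End(V)) : (forall v, a v = 0 -> v = 0) ->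
  forall w, exists v, a v = w.
Proof.
move=> a_inj.
pose to (f : {ffun 'I_(vector.dim V) -> D}) := \sum_i rscale (vbase i) (f i).
have to_coord v : to [ffun i => vcoord i v] = v.
  by rewrite [RHS]vcoord_sum; apply: eq_bigr => i _; rewrite ffunE.
have to_inj f : to f = 0 -> f = 0.
  move=> f0; apply/ffunP => i; rewrite ffunE.
  have : vcoord i (to f) = f i.
    rewrite /to (big_morph (vcoord i) (vcoordD i) (_ : _ = 0)); last first.
      by rewrite -(rscale0r 0) vcoordZ mulr0.
    rewrite (bigD1 i) //= vcoordZ vcoord_base eqxx mul1r big1 ?addr0 // => j ji.
    by rewrite vcoordZ vcoord_base eq_sym (negPf ji) mul0r.
  by rewrite f0 -(rscale0r 0) vcoordZ mulr0.
have toP c f g : to (c *: f + g) = rscale (to f) c%:A + to g.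
  rewrite /to rscale_suml -big_split; apply: eq_bigr => i _ /=.
  by rewrite !ffunE rscaleDr rscaleA mulr_algr.
pose phi f : {ffun 'I_(vector.dim V) -> D} := [ffun i => vcoord i (a (to f))].
have phi_lin : linear phi.
  move=> c f g; apply/ffunP => i; rewrite !ffunE toP lfunD lfun_rscale.
  by rewrite vcoordD vcoordZ mulr_algr.
pose phiL : {linear {ffun 'I_(vector.dim V) -> D} -> {ffun 'I_(vector.dim V) -> D}} :=
  HB.pack phi (GRing.isLinear.Build _ _ _ _ _ phi_lin).
have ker : lker (linfun phiL) == 0%VS.
  apply/lker0P => f g; rewrite !lfunE /= => /eqP; rewrite -subr_eq0 -[phi f]/(phiL f) -[phi g]/(phiL g) -linearB /= => /eqP h.
  apply/eqP; rewrite -subr_eq0; apply/eqP; apply: to_inj; apply: a_inj.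
  by rewrite -[a _]to_coord -[[ffun i => _]]/(phi (f - g)) h /to big1 // => i _; rewrite ffunE rscale0r.
move=> w; exists (to ((linfun phiL)^-1%VF [ffun i => vcoord i w])).
have := lker0_lfunVK ker [ffun i => vcoord i w].
rewrite lfunE /= => h; apply: vcoord_inj => i.
by move/ffunP/(_ i): h; rewrite !ffunE.
Qed.

Lemma lfun_inv (a : 'End(V)) : (forall v, a v = 0 -> v = 0) ->
  exists b : 'End(V), (a \o b)%VF = \1%VF /\ (b \o a)%VF = \1%VF.
Proof.
move=> a_inj; have /choice[f fP] := lfun_inj_surj a_inj.
have inj v w : a v = a w -> v = w.
  move=> /eqP; rewrite -subr_eq0 -lfunB => /eqP /a_inj /eqP.
  by rewrite subr_eq0 => /eqP.
have [|v x|b bE] := @lfun_from f.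
- by move=> v w; apply: inj; rewrite lfunD !fP.
- by apply: inj; rewrite lfun_rscale !fP.
exists b; split; apply/lfunP => v; rewrite comp_lfunE id_lfunE bE //.
by apply: inj.
Qed.

End RightScaling.

(** * Hermitian forms and adjoints *)

Section HermitianForm.
Variables (F : fieldType) (D : falgType F) (V : vectType D^c).
Variable X : hermitian_datum V.
Local Notation h := (hform X).
Local Notation vD := (valD X).
Local Notation eps := (sgn X).
Let uD := D_skew_field X.
Let nD := valD_valuation X.
Implicit Types (u v w : V) (x y : D) (a b : 'End(V)).

Lemma sgnK : eps * eps = 1.
Proof. by case: (sgn_unit X) => ->; rewrite ?mulr1 // mulrNN mulr1. Qed.

Lemma sgn_comm x : eps * x = x * eps.
Proof. by case: (sgn_unit X) => ->; rewrite ?mulr1 ?mul1r // mulrN mulNr mulr1 mul1r. Qed.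

Lemma bar_sgn : bar X eps = eps.
Proof. by case: (sgn_unit X) => ->; rewrite ?barN bar1. Qed.

Lemma val_ge_sgn m x : val_ge vD m x -> val_ge vD m (eps * x).
Proof.
by case: (sgn_unit X) => ->; rewrite ?mul1r // mulN1r; apply: (val_geN nD).
Qed.

Lemma hZl v w x : h (rscale v x) w = bar X x * h v w.
Proof.
rewrite hform_sgn hformZr bar_mul mulrA sgn_comm -mulrA.
by congr (_ * _); rewrite [RHS]hform_sgn.
Qed.

Lemma hDl v v' w : h (v + v') w = h v w + h v' w.
Proof.
by rewrite hform_sgn hformDr bar_add mulrDr; congr (_ + _); rewrite [RHS]hform_sgn.
Qed.

Lemma h0r v : h v 0 = 0.
Proof. by rewrite -(rscale0r 0) hformZr mulr0. Qed.

Lemma h0l v : h 0 v = 0.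
Proof. by rewrite -(rscale0r 0) hZl bar0 mul0r. Qed.

Lemma hNr v w : h v (- w) = - h v w.
Proof. by rewrite -[- w]rscale1 rscaleNl -rscaleNr hformZr mulrN1. Qed.

Lemma hNl v w : h (- v) w = - h v w.
Proof. by rewrite -[- v]rscale1 rscaleNl -rscaleNr hZl barN bar1 mulN1r. Qed.

Lemma hBr v w w' : h v (w - w') = h v w - h v w'.
Proof. by rewrite hformDr hNr. Qed.

Lemma hBl v v' w : h (v - v') w = h v w - h v' w.
Proof. by rewrite hDl hNl. Qed.

Lemma h_suml v I (r : seq I) (P : pred I) (E : I -> V) :
  h (\sum_(i <- r | P i) E i) v = \sum_(i <- r | P i) h (E i) v.
Proof. by elim/big_rec2: _ => [|i x y _ <-]; rewrite ?h0l ?hDl. Qed.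

Lemma val_ge_hC m v w : val_ge vD m (h v w) -> val_ge vD m (h w v).
Proof. by move=> hm; rewrite hform_sgn; apply: val_ge_sgn; apply: val_ge_bar. Qed.

Lemma h_nondegl v : (forall w, h w v = 0) -> v = 0.
Proof.
by move=> h0; apply: (hform_nondeg (h := X)) => w; rewrite hform_sgn h0 bar0 mulr0.
Qed.

Lemma rank1_ex u w : exists a : 'End(V), forall v, a v = rscale u (h w v).
Proof.
by apply: lfun_from => [v v'|v x]; rewrite ?hformDr ?rscaleDr // hformZr rscaleA.
Qed.

Definition rank1 u w : 'End(V) := sval (cid (rank1_ex u w)).

Lemma rank1E u w v : rank1 u w v = rscale u (h w v).
Proof. exact: (svalP (cid (rank1_ex u w))). Qed.

Lemma adjoint_rank1 u w : adjoint X (rank1 u w) (rank1 (rscale w eps) u).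
Proof.
move=> v v'; rewrite !rank1E hZl rscaleA hformZr mulrA; congr (_ * _).
by rewrite hform_sgn bar_mul bar_invol bar_sgn.
Qed.

Lemma adjoint_sym a b : adjoint X a b -> adjoint X b a.
Proof. by move=> ab v w; rewrite hform_sgn -ab [RHS]hform_sgn. Qed.

Lemma adjointD a a' b b' : adjoint X a b -> adjoint X a' b' -> adjoint X (a + a') (b + b').
Proof. by move=> h1 h2 v w; rewrite !add_lfunE hDl hformDr h1 h2. Qed.

Lemma adjointN a b : adjoint X a b -> adjoint X (- a) (- b).
Proof. by move=> h1 v w; rewrite !opp_lfunE hNl hNr h1. Qed.

Lemma adjointB a a' b b' : adjoint X a b -> adjoint X a' b' -> adjoint X (a - a') (b - b').
Proof. by move=> h1 h2; apply: adjointD => //; apply: adjointN. Qed.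

Lemma adjoint_comp a a' b b' : adjoint X a b -> adjoint X a' b' ->
  adjoint X (a \o a')%VF (b' \o b)%VF.
Proof. by move=> h1 h2 v w; rewrite !comp_lfunE h1 h2. Qed.

Lemma adjoint_id : adjoint X \1%VF \1%VF.
Proof. by move=> v w; rewrite !id_lfunE. Qed.

Lemma adjoint_homothety c : bar X c%:A = c%:A ->
  adjoint X (homothety V c) (homothety V c).
Proof.
move=> bc v w; rewrite !homothetyE hZl hformZr bc.
by rewrite mulr_algl mulr_algr.
Qed.

(** The map [psi] collects the values of [h] against a basis. Non-degeneracy makes it injective,
    hence invertible, and the adjoint of [a] is [psi] inverse followed after the analogous map [chi]
    built with [a]. *)
Lemma adjoint_ex a : exists b, adjoint X a b.
Proof.
have psi_ex b : exists psi : 'End(V), forall w,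
    psi w = \sum_i rscale (vbase i) (h (b (vbase i)) w).
  apply: lfun_from => [v w|v x].
    by rewrite -big_split; apply: eq_bigr => i _; rewrite hformDr rscaleDr.
  by rewrite rscale_suml; apply: eq_bigr => i _; rewrite hformZr rscaleA.
have psi_coord (psi : 'End(V)) b i w :
    (forall w, psi w = \sum_i rscale (vbase i) (h (b (vbase i)) w)) ->
    vcoord i (psi w) = h (b (vbase i)) w.
  move=> ->; rewrite (big_morph (vcoord i) (vcoordD i) (_ : _ = 0)); last first.
    by rewrite -(rscale0r 0) vcoordZ mulr0.
  rewrite (bigD1 i) //= vcoordZ vcoord_base eqxx mul1r big1 ?addr0 // => j ji.
  by rewrite vcoordZ vcoord_base eq_sym (negPf ji) mul0r.
have [psi psiE] := psi_ex \1%VF; have [chi chiE] := psi_ex a.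
have [inv [psiK _]] : exists b : 'End(V), (psi \o b)%VF = \1%VF /\ (b \o psi)%VF = \1%VF.
  apply: lfun_inv => w psi0; apply: h_nondegl => v; rewrite (vcoord_sum v) h_suml big1 // => i _.
  by rewrite hZl -[X in h X]id_lfunE -(psi_coord _ _ i w psiE) psi0 -(rscale0r 0) vcoordZ !mulr0.
exists (inv \o chi)%VF => v w.
rewrite (vcoord_sum v) lfun_sum !h_suml; apply: eq_bigr => i _.
rewrite lfun_rscale !hZl; congr (_ * _).
rewrite -(psi_coord _ _ i w chiE) -[X in _ = h X _]id_lfunE -(psi_coord _ _ i _ psiE).
by rewrite comp_lfunE -[psi _]comp_lfunE psiK id_lfunE.
Qed.

Local Notation pi := (unif X).

Lemma unif_neq0 : pi != 0. Proof. by case: (unif_uniformizer X). Qed.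
Lemma val_unif : vD pi = 1. Proof. by case: (unif_uniformizer X). Qed.

Lemma val_ge_unifz n : val_ge vD n (pi ^ n).
Proof. by right; rewrite (val_exprz uD nD) ?unif_neq0 // val_unif mul1r. Qed.

Lemma unifzD m n : pi ^ (m + n) = pi ^ m * pi ^ n.
Proof. by rewrite exprzDr // uD // unif_neq0. Qed.

Lemma unifzK n : pi ^ n * pi ^ (- n) = 1.
Proof. by rewrite -unifzD subrr. Qed.

Lemma unifzNK n : pi ^ (- n) * pi ^ n = 1.
Proof. by rewrite -unifzD addNr. Qed.

Lemma val_ge_div m x : val_ge vD m x -> exists2 y, val_ge vD 0 y & x = pi ^ m * y.
Proof.
move=> hx; exists (pi ^ (- m) * x); last by rewrite mulrA unifzK mul1r.
by apply: (val_geMW nD (m := - m) (n := m)) => //; [lia|exact: val_ge_unifz].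
Qed.

End HermitianForm.
Arguments rank1 {F D V} X u w.

(** * Lattices and their duals *)

Section Lattices.
Variables (F : fieldType) (D : falgType F) (V : vectType D^c).
Variable X : hermitian_datum V.
Local Notation h := (hform X).
Local Notation vD := (valD X).
Local Notation pi := (unif X).
Let uD := D_skew_field X.
Let nD := valD_valuation X.
Implicit Types (u v w : V) (x y : D) (a b : 'End(V)) (M L : set V).

Definition submodule M : Prop :=
  [/\ M 0, forall v w, M v -> M w -> M (v + w) &
      forall v x, M v -> val_ge vD 0 x -> M (rscale v x)].

Definition absorbing M : Prop := forall v, exists n : nat, M (rscale v (pi ^+ n)).

Lemma submoduleN M v : submodule M -> M v -> M (- v).
Proof.
case=> _ _ MZ hv; rewrite -[- v]rscale1 rscaleNl -rscaleNr; apply: MZ => //.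
by apply: (val_geN nD); apply: (val_ge1 nD).
Qed.

Lemma submoduleB M v w : submodule M -> M v -> M w -> M (v - w).
Proof. by move=> sM hv hw; have [_ MD _] := sM; apply: MD => //; apply: submoduleN. Qed.

Lemma submodule_sum M I (r : seq I) (P : pred I) (E : I -> V) : submodule M ->
  (forall i, P i -> M (E i)) -> M (\sum_(i <- r | P i) E i).
Proof. by case=> M0 MD _ hE; elim/big_ind: _. Qed.

Lemma full_lattice_submodule M : full_lattice X M -> submodule M.
Proof.
case=> n [e [-> _]]; split.
- by exists (fun=> 0) => [i|]; [left|rewrite big1 // => i _; rewrite rscale0r].
- move=> _ _ [c hc ->] [c' hc' ->]; exists (fun i => c i + c' i).
    by move=> i; apply: (val_geD nD); [apply: hc|apply: hc'].
  by rewrite -big_split; apply: eq_bigr => i _; rewrite rscaleDr.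
- move=> _ x [c hc ->] hx; exists (fun i => c i * x).
    by move=> i; apply: (val_geMW nD (m := 0) (n := 0)) => //; apply: hc.
  by rewrite rscale_suml; apply: eq_bigr => i _; rewrite rscaleA.
Qed.

Lemma val_ge_finite n (c : 'I_n -> D) : exists N : nat, forall i, val_ge vD (- N%:Z) (c i).
Proof.
exists (\max_i `|vD (c i)|)%N => i; right.
by have := @leq_bigmax _ (fun i => `|vD (c i)|%N) i; lia.
Qed.

Lemma full_lattice_absorbing M : full_lattice X M -> absorbing M.
Proof.
case=> n [e [-> span]] v; have [c ->] := span v; have [N hN] := val_ge_finite c.
exists N; exists (fun i => c i * pi ^+ N).
  move=> i; apply: (val_geMW nD (m := - N%:Z) (n := N%:Z)) => //; first by lia.
  exact: (val_ge_unifz X N).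
by rewrite rscale_suml; apply: eq_bigr => i _; rewrite rscaleA.
Qed.

(** Noetherianity yields the generators; being absorbing yields that they span $V$. *)
Lemma full_lattice_sub L M : full_lattice X L -> submodule M -> M `<=` L ->
  absorbing M -> full_lattice X M.
Proof.
case=> n [e [LE _]] [M0 MD MZ] ML abs.
have [|m [e' ME]] := @noetherian_submodule _ vD uD nD V (@rscale D V)
  (@rscale1 F D V) (@rscaleDl F D V) (@rscaleDr F D V) (@rscaleA F D V) n e M M0 MD MZ.
  by move=> u /ML; rewrite LE => -[c hc ->]; exists c.
exists m, e'; split=> // v; have [N] := abs v; rewrite {1}ME => -[c _ vN].
exists (fun i => c i * pi ^ (- N%:Z)); rewrite -[LHS]rscale1 -(unifzK X N) -rscaleA vN.
by rewrite rscale_suml; apply: eq_bigr => i _; rewrite rscaleA.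
Qed.

Lemma full_lattice_bounded M : full_lattice X M ->
  exists N : nat, forall v i, M v -> val_ge vD (- N%:Z) (vcoord i v).
Proof.
case=> n [e [-> _]].
have [N hN] : exists N : nat, forall i j, val_ge vD (- N%:Z) (vcoord i (e j)).
  exists (\max_i \max_j `|vD (vcoord i (e j))|)%N => i j; right.
  have := @leq_bigmax _ (fun i => \max_j `|vD (vcoord i (e j))|)%N i.
  have := @leq_bigmax _ (fun j => `|vD (vcoord i (e j))|%N) j; lia.
exists N => _ i [c hc ->]; rewrite (big_morph (vcoord i) (vcoordD i) (_ : _ = 0)); last first.
  by rewrite -(rscale0r 0) vcoordZ mulr0.
apply: (val_ge_sum nD) => j _; rewrite vcoordZ.
by apply: (val_geMW nD (m := - N%:Z) (n := 0)) => //; [lia|apply: hc].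
Qed.

Lemma full_lattice_separated M v : full_lattice X M ->
  (forall n : nat, M (rscale v (pi ^ (- n%:Z)))) -> v = 0.
Proof.
move=> /full_lattice_bounded[N hN] hv; apply: vcoord_inj => i.
rewrite -[in RHS](rscale0r 0) vcoordZ mulr0; apply: (@val_ge_eq0 _ vD) => n.
rewrite -[v]rscale1 -(unifzNK X (n + N)%N) -rscaleA vcoordZ.
apply: (val_geMW nD (m := - N%:Z) (n := (n + N)%N)); [lia|exact: hN|exact: val_ge_unifz].
Qed.

(** Dualizing reverses scaling: the left-hand set is the dual of $M\varpi^n$. Only the valuations of
    $\varpi^n$ and of its image under bar matter, and both equal $n$. *)
Lemma dual_lattice_shift M v (n : int) :
  dual_lattice X [set w | M (rscale w (pi ^ (- n)))] v <->
  dual_lattice X M (rscale v (pi ^ n)).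
Proof.
have bpi k : val_ge vD k (bar X (pi ^ k)) by apply: val_ge_bar; apply: val_ge_unifz.
split=> hv w Mw; rewrite ?hZl.
- have /= := hv (rscale w (pi ^ n)); rewrite rscaleA unifzK rscale1 => /(_ Mw).
  rewrite hformZr => hvw; apply: (val_geMW nD (m := n) (n := 1 - n)) => //; first by lia.
  rewrite -[h v w]mulr1 -(unifzK X n) mulrA.
  by apply: (val_geMW nD (m := 1) (n := - n)) => //; apply: val_ge_unifz.
- have := hv _ Mw; rewrite hZl hformZr => hvw.
  have hx : val_ge vD (1 - n) (h v w * pi ^ (- n)).
    rewrite -[_ * _]mul1r -[X in X * _](bar1 X) -(unifzK X n) bar_mul -mulrA.
    by apply: (val_geMW nD (m := - n) (n := 1)) => //; lia.
  rewrite -[h v w]mulr1 -(unifzNK X n) mulrA.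
  by apply: (val_geMW nD (m := 1 - n) (n := n)) => //; [lia|apply: val_ge_unifz].
Qed.

End Lattices.

(** * Lattice functions: jumps and duality *)

Section LatticeFunctionTheory.
Variables (R : realType) (F : fieldType) (D : falgType F) (V : vectType D^c).
Variable X : hermitian_datum V.
Local Notation h := (hform X).
Local Notation vD := (valD X).
Local Notation pi := (unif X).
Local Notation d := ((degD X)%:R : R).
Let uD := D_skew_field X.
Let nD := valD_valuation X.
Implicit Types (Gamma : R -> set V) (v w : V) (x : D).

Lemma degD_gt0 : (0 < degD X)%N.
Proof.
rewrite lt0n; apply/eqP => d0; have := D_dim X; rewrite d0 => /eqP.
rewrite dimv_eq0 -subv0 => /subvP/(_ 1 (memvf _)).
by rewrite memv0 oner_eq0.
Qed.

Lemma degDR_gt0 : 0 < d.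
Proof. by rewrite ltr0n degD_gt0. Qed.

Section OneFunction.
Variable Gamma : R -> set V.
Hypothesis lfG : lattice_function X Gamma.

Lemma lf_full t : full_lattice X (Gamma t). Proof. by case: lfG. Qed.
Lemma lf_sub t : submodule X (Gamma t). Proof. exact/full_lattice_submodule/lf_full. Qed.
Lemma lf_mono s t v : s <= t -> Gamma t v -> Gamma s v.
Proof. by case: lfG => _ mono _ _ /mono; apply. Qed.

Lemma lf_shift t v (n : int) : Gamma t v <-> Gamma (t + n%:~R / d) (rscale v (pi ^ n)).
Proof.
have sh s w : Gamma s w <-> Gamma (s + d^-1) (rscale w pi).
  case: lfG => _ _ _ sh; rewrite -(sh s); split=> [hw|[u hu uw]]; first by exists w.
  have -> // : w = u.
  rewrite -[w]rscale1 -[u]rscale1 -(divrr (uD (unif_neq0 X))) -!rscaleA.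
  by congr rscale; rewrite uw.
have shn (k : nat) s w : Gamma s w <-> Gamma (s + k%:R / d) (rscale w (pi ^+ k)).
  elim: k => [|k IH]; first by rewrite mul0r addr0 rscale1.
  rewrite IH sh rscaleA -exprSr.
  by have -> : s + k%:R / d + d^-1 = s + k.+1%:R / d by rewrite -natr1 mulrDl mul1r addrA.
case: n => k; first exact: shn.
rewrite NegzE; set w := rscale v _.
have -> : v = rscale w (pi ^+ k.+1).
  by rewrite /w rscaleA -[pi ^+ _]/(pi ^ k.+1%:Z) unifzNK rscale1.
rewrite (shn k.+1 (t + (- k.+1%:Z)%:~R / d) w).
by rewrite mulrNz mulNr addrNK.
Qed.

(** The union defining [right_part] is again a full lattice, so its finitely many generators already
    occur at a single [u] after [t]: jumps are discrete. *)
Lemma lf_right_ex t : exists2 u, t < u & right_part Gamma t = Gamma u.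
Proof.
have sub : submodule X (right_part Gamma t).
  split.
  - exists (t + 1) => /=; first by rewrite ltrDl.
    by case: (lf_sub (t + 1)).
  - move=> v w [s hs sv] [s' hs' s'w]; exists (Num.min s s') => /=.
      by rewrite lt_min hs hs'.
    have [_ GD _] := lf_sub (Num.min s s').
    by apply: GD; [apply: lf_mono sv|apply: lf_mono s'w]; rewrite ge_min lexx ?orbT.
  - by move=> v x [s hs sv] hx; exists s => //; have [_ _ GZ] := lf_sub s; apply: GZ.
have abs : absorbing X (right_part Gamma t).
  move=> v; have [n hn] := full_lattice_absorbing (lf_full (t + 1)) v.
  by exists n; exists (t + 1) => //=; rewrite ltrDl.
have [|n [e [ME _]]] := full_lattice_sub (lf_full t) sub _ abs.
  by move=> v [s /= /ltW ts]; apply: lf_mono.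
have he i : right_part Gamma t (e i).
  rewrite ME; exists (fun j => (j == i)%:R) => [j|].
    by case: (j == i); [apply: (val_ge1 nD)|left].
  rewrite (bigD1 i) //= eqxx rscale1 big1 ?addr0 // => j /negPf ->.
  by rewrite rscale0r.
have [u hu uall] : exists2 u, t < u & forall i, Gamma u (e i).
  have /choice[f hf] i : exists s, t < s /\ Gamma s (e i).
    by have [s ts se] := he i; exists s.
  (* The default [t + 1] keeps the minimum beyond [t] when there is no generator. *)
  exists (\big[Num.min/t + 1]_i f i).
    elim/big_ind: _ => [|x y hx hy|i _]; [by rewrite ltrDl|by rewrite lt_min hx|].
    by case: (hf i).
  by move=> i; apply: lf_mono (hf i).2; apply: bigmin_le_cond.
exists u => //; apply/seteqP; split=> v; last by move=> hv; exists u.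
rewrite ME => -[c hc ->]; apply: submodule_sum; first exact: lf_sub.
by move=> i _; have [_ _ GZ] := lf_sub u; apply: GZ => //; apply: hc.
Qed.

Lemma lf_right_full t : full_lattice X (right_part Gamma t).
Proof. by have [u _ ->] := lf_right_ex t; apply: lf_full. Qed.

Lemma lf_right_le t v : right_part Gamma t v -> Gamma t v.
Proof. by case=> s /= /ltW; apply: lf_mono. Qed.

Lemma lf_right_shift t v (n : int) :
  right_part Gamma t v <-> right_part Gamma (t + n%:~R / d) (rscale v (pi ^ n)).
Proof.
split=> -[s /= ts sv].
  by exists (s + n%:~R / d) => /=; [rewrite ltrD2r|apply: (lf_shift _ _ _).1].
exists (s - n%:~R / d) => /=; first by rewrite ltrBrDr.
by apply: (lf_shift _ _ n).2; rewrite subrK.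
Qed.

End OneFunction.

Section SelfDual.
Variable Gamma : R -> set V.
Hypothesis sdG : self_dual_lattice_function X Gamma.
Let lfG : lattice_function X Gamma := sdG.1.

Lemma sd_dual_right t : dual_lattice X (right_part Gamma (- t)) = Gamma t.
Proof. by case: sdG. Qed.

(** This is the second half of self-duality, obtained without biduality of lattices: [s] is taken
    strictly inside an interval after [-t] on which [Gamma] is constant, so that
    $\Gamma(-s)=\Gamma(t)$ and the defining duality applies at [s]. *)
Lemma sd_dual t : dual_lattice X (Gamma t) = right_part Gamma (- t).
Proof.
apply/seteqP; split=> v; last first.
  case=> s /= ts; rewrite -(sd_dual_right s) => hv w tw; apply: hv.
  by exists t => //=; rewrite ltrNl.
move=> hv; have [u tu uE] := lf_right_ex lfG (- t).
pose s := (u - t) / 2.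
have ts : - t < s by rewrite /s; lra.
have su : s < u by rewrite /s; lra.
have sE : right_part Gamma s = right_part Gamma (- t).
  apply/seteqP; split=> [w [r /= sr rw]|w]; first by exists r => //=; lra.
  by rewrite uE => uw; exists u.
have tE : Gamma (- s) = Gamma t.
  by rewrite -sd_dual_right opprK sE sd_dual_right.
exists s => //=; rewrite -sd_dual_right => w /(lf_right_le lfG).
by rewrite tE; apply: hv.
Qed.

End SelfDual.

End LatticeFunctionTheory.

(** * Self-dual chains of lattices *)

Section Chains.
Variables (F : fieldType) (D : falgType F) (V : vectType D^c).
Variable X : hermitian_datum V.
Local Notation h := (hform X).
Local Notation vD := (valD X).
Local Notation pi := (unif X).
Let uD := D_skew_field X.
Let nD := valD_valuation X.
Implicit Types (v w : V) (x : D) (a b : 'End(V)).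

(* A self-dual lattice function with jumps in (1/4d)Z, as a Z-indexed chain. *)
Definition sd_chain (L : int -> set V) : Prop :=
  [/\ forall m, full_lattice X (L m), forall m, L (m + 1) `<=` L m,
      forall m v, L m v <-> L (m + 4) (rscale v pi) &
      forall m, dual_lattice X (L (1 - m)) = L m].

(** The index counts steps of $1/4d$: [n = 0] gives the order and [n = 1] its radical
    $\tilde{\mathfrak a}_{0+}$. *)
Definition chain_filt (L : int -> set V) (n : int) : set 'End(V) :=
  [set a : 'End(V) | forall m v, L m v -> L (m + n) (a v)].

Section OneChain.
Variable L : int -> set V.
Hypothesis sdL : sd_chain L.

Lemma chain_full m : full_lattice X (L m). Proof. by case: sdL. Qed.
Lemma chain_sub m : submodule X (L m). Proof. exact/full_lattice_submodule/chain_full. Qed.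
Lemma chain_dual m : dual_lattice X (L (1 - m)) = L m. Proof. by case: sdL. Qed.

Lemma chain_le m n v : m <= n -> L n v -> L m v.
Proof.
case: sdL => _ LS _ _ mn; have -> : n = m + `|n - m|%N by lia.
elim: `|n - m|%N => [|k IH]; first by rewrite addr0.
have -> : m + k.+1 = m + k + 1 :> int by lia.
by move=> /LS /IH.
Qed.

Lemma chain_shift m v (n : int) : L m v <-> L (m + 4 * n) (rscale v (pi ^ n)).
Proof.
case: sdL => _ _ sh _.
have shn (k : nat) m' w : L m' w <-> L (m' + 4 * k%:Z) (rscale w (pi ^+ k)).
  elim: k => [|k IH]; first by rewrite mulr0 addr0 rscale1.
  rewrite IH sh rscaleA -exprSr.
  by have -> : m' + 4 * k%:Z + 4 = m' + 4 * k.+1 by lia.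
case: n => k; first exact: shn.
rewrite NegzE; set w := rscale v _.
have -> : v = rscale w (pi ^+ k.+1).
  by rewrite /w rscaleA -[pi ^+ _]/(pi ^ k.+1%:Z) unifzNK rscale1.
rewrite (shn k.+1 _ w).
by have -> : m + 4 * - (k.+1)%:Z + 4 * k.+1 = m by lia.
Qed.

Lemma chain_scale m n v x : val_ge vD n x -> L m v -> L (m + 4 * n) (rscale v x).
Proof.
move=> /val_ge_div[y hy ->] hv; rewrite -rscaleA.
by have [_ _ GZ] := chain_sub (m + 4 * n); apply: GZ => //; apply: (chain_shift _ _ _).1.
Qed.

Lemma chain_scale_le m n k v x : val_ge vD n x -> L m v -> k <= m + 4 * n ->
  L k (rscale v x).
Proof. by move=> hx hv kn; apply: chain_le kn _; apply: chain_scale. Qed.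

(** Duality pairs $L_m$ and $L_{1-m}$ into $\mathfrak p_D$, so an index sum of 1 gives valuation 1,
    and each further period of 4 gives one more. *)
Lemma chain_h k m n v w : 4 * k - 3 <= m + n -> L m v -> L n w -> val_ge vD k (h v w).
Proof.
move=> kmn; rewrite -chain_dual => hv hw.
have := hv (rscale w (pi ^ (1 - k))); rewrite hformZr => hvw.
have -> : h v w = h v w * pi ^ (1 - k) * pi ^ (k - 1).
  by rewrite -mulrA -unifzD (_ : 1 - k + (k - 1) = 0) ?mulr1 //; lia.
apply: (val_geMW nD (m := 1) (n := k - 1)); first by lia.
  apply: hvw; apply: (@chain_le _ (n + 4 * (1 - k))); first by lia.
  exact: (chain_shift _ _ _).1.
exact: val_ge_unifz.
Qed.

Lemma chain_rank1 m n u w : L m u -> L n w -> chain_filt L (m + n) (rank1 X u w).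
Proof.
move=> hu hw k v hv; rewrite rank1E.
(* [j] is the ceiling of $(n+k)/4$, the valuation that [chain_h] guarantees for [h w v]. *)
pose j := ((n + k + 3) %/ 4)%Z.
apply: (@chain_scale_le m j) => //; last by rewrite /j; lia.
by apply: chain_h hw hv; rewrite /j; lia.
Qed.

Lemma chain_filt_adjoint n a b : chain_filt L n a -> adjoint X a b -> chain_filt L n b.
Proof.
move=> ha ab m v hv; rewrite -chain_dual => w hw.
apply: val_ge_hC; rewrite -ab; apply: (@chain_h _ (1 - m) m) => //; first by lia.
by have := ha _ _ hw; rewrite (_ : 1 - (m + n) + n = 1 - m) //; lia.
Qed.

Lemma chain_filt_comp m n a b : chain_filt L m a -> chain_filt L n b ->
  chain_filt L (m + n) (a \o b)%VF.
Proof.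
move=> ha hb k v hv; rewrite comp_lfunE (_ : k + (m + n) = k + n + m); last by lia.
by apply: ha; apply: hb.
Qed.

Lemma chain_filtD n a b : chain_filt L n a -> chain_filt L n b -> chain_filt L n (a + b).
Proof.
move=> ha hb k v hv; rewrite add_lfunE; have [_ LD _] := chain_sub (k + n).
by apply: LD; [apply: ha|apply: hb].
Qed.

Lemma chain_filtN n a : chain_filt L n a -> chain_filt L n (- a).
Proof.
move=> ha k v hv; rewrite opp_lfunE; apply: submoduleN; first exact: chain_sub.
exact: ha.
Qed.

Lemma chain_filtB n a b : chain_filt L n a -> chain_filt L n b -> chain_filt L n (a - b).
Proof. by move=> ha hb; apply: chain_filtD => //; apply: chain_filtN. Qed.

Lemma chain_filt_id : chain_filt L 0 \1%VF.
Proof. by move=> m v; rewrite id_lfunE addr0. Qed.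

Lemma chain_filt_zero n : chain_filt L n 0.
Proof. by move=> m v _; rewrite zero_lfunE; case: (chain_sub (m + n)). Qed.

Lemma chain_exhaust m v : exists n : nat, L (m - n%:Z) v.
Proof.
have [n hn] := full_lattice_absorbing (chain_full m) v.
exists (4 * n)%N; apply: (chain_shift _ _ n%:Z).2.
by rewrite (_ : m - (4 * n)%N%:Z + 4 * n%:Z = m) //; lia.
Qed.

Lemma chain_separated m v : v != 0 -> exists n : nat, ~ L (m + n%:Z) v.
Proof.
move=> v0; apply: contrapT => /forallNP no; move/eqP: v0; apply.
apply: (full_lattice_separated (chain_full m)) => n.
have /contrapT := no (4 * n)%N; move/(chain_shift _ _ (- n%:Z)).
by rewrite (_ : m + (4 * n)%N%:Z + 4 * - n%:Z = m) //; lia.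
Qed.

(* An element n of N outside the next lattice pairs to a unit with some y in
   L(-m), so the operators w h(y, -) map n onto all of L(m). *)
Lemma chain_stable (N : set V) m0 v0 :
  (forall a v, chain_filt L 0 a -> N v -> N (a v)) -> N `<=` L m0 ->
  N v0 -> v0 != 0 ->
  exists m n y, [/\ N = L m, N n, L (- m) y & h y n = 1].
Proof.
move=> Nst N0 Nv0 v00.
have [k0 hk0] := chain_separated m0 v00.
have exP : exists k : nat, `[< N `<=` L (m0 + k%:Z) >].
  by exists 0%N; apply/asboolP; rewrite addr0.
have bnd k : `[< N `<=` L (m0 + k%:Z) >] -> (k <= k0)%N.
  move=> /asboolP hk; rewrite leqNgt; apply/negP => kk; apply: hk0.
  by apply: (@chain_le _ (m0 + k%:Z)); [lia|apply: hk].
have [k /asboolP Nk kmax] := ex_maxnP exP bnd.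
set m := m0 + k%:Z in Nk *.
have [n Nn hn] : exists2 n, N n & ~ L (m + 1) n.
  apply: contrapT => /forall2NP no.
  suff /kmax : `[< N `<=` L (m0 + k.+1%:Z) >] by rewrite ltnn.
  apply/asboolP => v Nv; have [//|/contrapT] := no v.
  by rewrite (_ : m0 + k.+1%:Z = m + 1) // /m; lia.
have [y hy hny] : exists2 y, L (- m) y & ~ val_ge vD 1 (h n y).
  apply: contrapT => /forall2NP no; apply: hn; rewrite -chain_dual => y.
  rewrite (_ : 1 - (m + 1) = - m); last by lia.
  by move=> hy; have [//|/contrapT] := no y.
have hyn : ~ val_ge vD 1 (h y n) by move=> hyn; apply: hny; apply: val_ge_hC.
have [c0 cv] := val_geNP hyn.
have cval : vD (h y n) = 0.
  suff : 0 <= vD (h y n) by lia.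
  apply: val_ge_neq0 c0 _; apply: (@chain_h _ (- m) m) => //; first by lia.
  exact: Nk.
pose y' := rscale y (bar X (h y n)^-1).
have hy' : L (- m) y'.
  apply: (@chain_scale_le (- m) 0) => //; last by lia.
  by apply: val_ge_bar; rewrite -oppr0; apply: (val_geV uD nD); rewrite ?cval.
have hy'n : h y' n = 1 by rewrite hZl bar_invol mulVr // uD.
exists m, n, y'; split=> //; apply/seteqP; split=> // w hw.
have : rank1 X w y' n = w by rewrite rank1E hy'n rscale1.
move=> <-; apply: Nst => //.
by have := chain_rank1 hw hy'; rewrite subrr.
Qed.

(** Induction on the number of basis vectors on which the ideal may be nonzero. The values of [I] at
    the last such vector [e] form a stable module, hence some $L_m$ by [chain_stable]; evaluation at
    [e] then splits, and the elements killing [e] form a smaller ideal. *)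
Lemma chain_hereditary I : left_ideal (chain_filt L 0) I -> projective_ideal (chain_filt L 0) I.
Proof.
move=> idI.
suff gen k : forall I, left_ideal (chain_filt L 0) I ->
    (forall a (i : 'I_(vector.dim V)), I a -> (k <= i)%N -> a (vbase i) = 0) ->
    projective_ideal (chain_filt L 0) I.
  apply: (gen (vector.dim V)) => // a i _; by rewrite leqNgt ltn_ord.
elim: k => [|k IH] {idI}I idI hI.
  exists 0%N, (fun _ _ => 0), (fun=> 0); split=> [[]|? []|? ? []|? ? []|a Ia] //.
  rewrite big_ord0; apply/lfunP => v; rewrite zero_lfunE (vcoord_sum v) lfun_sum.
  by rewrite big1 // => i _; rewrite lfun_rscale (hI _ i Ia) ?rscale0l.
have [kd|kd] := ltnP k (vector.dim V); last first.
  by apply: IH => // a i _ ki; have := ltn_ord i; rewrite ltnNge (leq_trans kd ki).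
pose e := vbase (V := V) (Ordinal kd).
have eE (i : 'I_(vector.dim V)) : (k <= i)%N -> i != k :> nat -> (k.+1 <= i)%N.
  by move=> ki ik; rewrite ltn_neqAle eq_sym ik ki.
case: (idI) => IS I0 ID IZ.
have [[b [Ib be]]|no] := pselect (exists b, I b /\ b e != 0); last first.
  apply: IH => // a i Ia ki; have [ik|ik] := eqVneq (i : nat) k; last first.
    by apply: (hI _ i) => //; apply: eE.
  have -> : vbase i = e by congr vbase; apply: val_inj.
  by apply/eqP; apply: contraT => ae; case: no; exists a.
have [j0 ej0] := chain_exhaust 0 e; rewrite sub0r in ej0.
have [|_ /= [a Ia <-]|||m [n [y [NE Nn hy hyn]]]] :=
  @chain_stable [set a e | a in I] (- j0%:Z) (b e).
- by move=> s _ hs [a Ia <-]; exists (s \o a)%VF; rewrite ?comp_lfunE //; apply: IZ.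
- by have := IS _ Ia _ _ ej0; rewrite addr0.
- by exists b.
- exact: be.
case: Nn => c Ic ce.
(* As [h y (c e) = 1], the composite of [r a] with [c] agrees with [a] at [e]. So [r] is the new
   coordinate, [c] the new generator, and the remainder [p a] kills [e]. *)
pose r a := rank1 X (a e) y.
have rS a : I a -> chain_filt L 0 (r a).
  move=> Ia; rewrite -(subrr m); apply: chain_rank1 => //.
  by rewrite -NE; exists a.
have rD a a' : r (a + a') = r a + r a'.
  by apply/lfunP => v; rewrite !(add_lfunE, rank1E) rscaleDl.
have rZ s a : r (s \o a)%VF = (s \o r a)%VF.
  by apply/lfunP => v; rewrite !(comp_lfunE, rank1E) lfun_rscale.
pose p a := a - (r a \o c)%VF.
have IN a : I a -> I (- a).
  move=> Ia; have -> : - a = ((- \1) \o a)%VF.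
    by apply/lfunP => v; rewrite comp_lfunE !opp_lfunE id_lfunE.
  by apply: IZ => //; apply: chain_filtN; apply: chain_filt_id.
have Ip a : I a -> I (p a).
  by move=> Ia; apply: ID => //; apply: IN; apply: IZ => //; apply: rS.
pose I' := [set a | I a /\ a e = 0].
have I'p a : I a -> I' (p a).
  move=> Ia; split; first exact: Ip.
  rewrite /p add_lfunE opp_lfunE comp_lfunE ce rank1E hyn rscale1.
  by rewrite subrr.
have [||n' [f' [x' [hx' f'S f'D f'Z f'K]]]] := IH I'.
- split=> [a [/IS]//|||].
  + by split=> //; rewrite zero_lfunE.
  + by move=> a a' [Ia ae] [Ia' ae']; split; [apply: ID|rewrite add_lfunE ae ae' addr0].
  + by move=> s a hs [Ia ae]; split; [apply: IZ|rewrite comp_lfunE ae lfun0].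
- move=> a i [Ia ae] ki; have [ik|ik] := eqVneq (i : nat) k; last first.
    by apply: (hI _ i) => //; apply: eE.
  by rewrite -[RHS]ae; congr (a (vbase _)); apply: val_inj.
exists n'.+1, (fun a i => if unlift ord0 i is Some j then f' (p a) j else r a),
  (fun i => if unlift ord0 i is Some j then x' j else c); split.
- by move=> i; case: unliftP => [j _|_] //; case: (hx' j).
- by move=> a i Ia; case: unliftP => [j _|_]; [apply: f'S; apply: I'p|apply: rS].
- move=> a a' i Ia Ia'; case: unliftP => [j _|_]; last exact: rD.
  rewrite -f'D; [|exact: I'p..]; congr f'.
  by rewrite /p rD comp_lfunDl opprD addrACA.
- move=> s a i hs Ia; case: unliftP => [j _|_]; last exact: rZ.
  rewrite -f'Z //; [|exact: I'p]; congr f'.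
  by rewrite /p rZ comp_lfunDr comp_lfunNr comp_lfunA.
- move=> a Ia; rewrite big_ord_recl unlift_none.
  under eq_bigr => i _ do rewrite liftK.
  rewrite (f'K _ (I'p _ Ia)) /p; apply/lfunP => v.
  by rewrite !add_lfunE opp_lfunE addrC subrK.
Qed.

End OneChain.
End Chains.

(** * The order attached to a chain *)

Section ChainOrder.
Variables (F : fieldType) (D : falgType F) (V : vectType D^c).
Variable X : hermitian_datum V.
Local Notation h := (hform X).
Local Notation vD := (valD X).
Local Notation vF := (valF X).
Local Notation pi := (unif X).
Let uD := D_skew_field X.
Let nD := valD_valuation X.
Let nF := valF_val X.
Variable L : int -> set V.
Hypothesis sdL : sd_chain X L.

Let sc (a : 'End(V)) (c : F) := (homothety V c \o a)%VF.

Let scE a c v : sc a c v = rscale (a v) c%:A.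
Proof. by rewrite /sc comp_lfunE homothetyE. Qed.

(** An element of the order is determined by its values at a basis contained in $L_0$, and these
    values are integral combinations. The [G] only bound the order from outside; they need not
    belong to it. *)
Lemma chain_full_generators : exists n (G : 'I_n -> 'End(V)),
  forall a, chain_filt L 0 a -> exists2 c : 'I_n -> F,
    forall i, val_ge vF 0 (c i) & a = \sum_i sc (G i) (c i).
Proof.
have [n [e [LE span]]] := chain_full sdL 0.
have [m [om [hom homP]]] := val_ring_fg X.
have [N hN] : exists N : nat, forall i, L 0 (rscale (vbase i) (pi ^+ N)).
  have /choice[f hf] i := full_lattice_absorbing (chain_full sdL 0) (vbase i).
  exists (\max_i f i)%N => i.
  have fi := @leq_bigmax _ f i; rewrite -(subnKC fi) exprD -rscaleA.
  have [_ _ LZ] := chain_sub sdL 0; apply: LZ; first exact: hf.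
  by apply: (val_geW _ (val_ge_unifz X (_ - _)%N%:Z)).
pose b (i : 'I_(vector.dim V)) : V := rscale (vbase i) (pi ^+ N).
pose coord (i : 'I_(vector.dim V)) (v : V) := pi ^ (- N%:Z) * vcoord i v.
have vE v : v = \sum_i rscale (b i) (coord i v).
  rewrite [LHS]vcoord_sum; apply: eq_bigr => i _.
  by rewrite /b /coord rscaleA mulrA -[pi ^+ N]/(pi ^ N%:Z) unifzK mul1r.
(* Each [G] sends one basis vector [b i] to a generator of $L_0$ times a generator of $o_D$ over
   $o_F$, and the other basis vectors to 0. *)
have /choice[G hG] (t : 'I_(vector.dim V) * ('I_n * 'I_m)) : exists G : 'End(V),
    forall v, G v = rscale (e t.2.1) (om t.2.2 * coord t.1 v).
  apply: lfun_from => [v w|v x]; rewrite /coord ?vcoordD ?vcoordZ.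
    by rewrite !mulrDr rscaleDr.
  by rewrite rscaleA !mulrA.
exists #|{: 'I_(vector.dim V) * ('I_n * 'I_m)}|, (fun k => G (enum_val k)) => a ha.
have /choice[cl hcl] i : exists cl : 'I_n -> 'I_m -> F,
    (forall l k, val_ge vF 0 (cl l k)) /\
    a (b i) = \sum_l rscale (e l) (\sum_k cl l k *: om k).
  have : L 0 (a (b i)) by have := ha _ _ (hN i); rewrite addr0.
  rewrite LE => -[c hc ->].
  have /choice[cl hcl] l : exists c' : 'I_m -> F, (forall k, val_ge vF 0 (c' k)) /\
      c l = \sum_k c' k *: om k.
    by have [c' h1 h2] := homP _ (hc l); exists c'.
  by exists cl; split=> [l|]; [case: (hcl l)|apply: eq_bigr => l _; rewrite -(hcl l).2].
exists (fun k => let t := enum_val k in cl t.1 t.2.1 t.2.2).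
  by move=> k; case: (hcl (enum_val k).1).
rewrite -(big_enum_val (fun t => sc (G t) (cl t.1 t.2.1 t.2.2))) /=.
apply/lfunP => v; rewrite sum_lfunE {1}(vE v) lfun_sum.
transitivity (\sum_i \sum_l \sum_k sc (G (i, (l, k))) (cl i l k) v); last first.
  under eq_bigr => i _ do rewrite (pair_bigA _ (fun l k => sc (G (i, (l, k))) (cl i l k) v)) /=.
  rewrite (pair_bigA _ (fun i p => sc (G (i, (p.1, p.2))) (cl i p.1 p.2) v)) /=.
  by apply: eq_big => [[i [l k]]|[i [l k]] _].
apply: eq_bigr => i _.
rewrite lfun_rscale (hcl i).2 rscale_suml; apply: eq_bigr => l _.
rewrite rscaleA mulr_suml rscale_sumr; apply: eq_bigr => k _.
by rewrite scE hG /= rscaleA mulr_algr scalerAl.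
Qed.

Lemma chain_filt_bounded a : exists n : nat, chain_filt L (- n%:Z) a.
Proof.
have [n [e [LE _]]] := chain_full sdL 0.
have [N hN] : exists N : nat, forall l, L (- N%:Z) (a (e l)).
  have /choice[f hf] l := chain_exhaust sdL 0 (a (e l)).
  exists (\max_l f l)%N => l; apply: (chain_le sdL _ (hf l)).
  by have := @leq_bigmax _ f l; lia.
(* The extra 4 absorbs the rounding of [m] down to a multiple of the period. *)
exists (N + 4)%N => m v hv.
pose j := (m %/ 4)%Z.
have : L 0 (rscale v (pi ^ (- j))).
  apply: (@chain_le _ _ _ _ _ sdL _ (m + 4 * - j)); first by rewrite /j; lia.
  exact: (chain_shift sdL _ _ _).1.
rewrite LE => -[c hc vE].
have -> : v = rscale (\sum_i rscale (e i) (c i)) (pi ^ j).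
  by rewrite -vE rscaleA unifzNK rscale1.
rewrite lfun_rscale; apply: (@chain_le _ _ _ _ _ sdL _ (- N%:Z + 4 * j)); first by rewrite /j; lia.
apply: (chain_shift sdL _ _ _).1; rewrite lfun_sum.
apply: (submodule_sum _ (chain_sub sdL _)) => i _; rewrite lfun_rscale.
by have [_ _ LZ] := chain_sub sdL (- N%:Z); apply: LZ => //; apply: hc.
Qed.

(** Noetherianity over $o_F$ extracts generators from the outer bound. They span over $F$ because
    every endomorphism enters the order after scaling by a power of a uniformizer of $F$. *)
Lemma chain_is_order : is_order X (chain_filt L 0).
Proof.
split; first exact: chain_filt_id.
  by move=> a b ha hb; have := chain_filt_comp ha hb; rewrite addr0.
have [n [G hG]] := chain_full_generators.
have sc1 a : sc a 1 = a by apply/lfunP => v; rewrite scE scale1r rscale1.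
have scDl a b c : sc (a + b) c = sc a c + sc b c.
  by apply/lfunP => v; rewrite scE !add_lfunE !scE rscaleDl.
have scDr a b c : sc a (b + c) = sc a b + sc a c.
  by apply/lfunP => v; rewrite scE !add_lfunE !scE scalerDl rscaleDr.
have scA a b c : sc (sc a b) c = sc a (b * c).
  by apply/lfunP => v; rewrite !scE rscaleA algM.
have [|a b|a c||m [e' ME]] := @noetherian_submodule _ vF (@unitF F) nF _ sc sc1 scDl scDr scA
  n G (chain_filt L 0).
- exact: (chain_filt_zero sdL).
- exact: (chain_filtD sdL).
- move=> ha hc k v hv; rewrite scE; have [_ _ LZ] := chain_sub sdL (k + 0).
  by apply: LZ; [apply: ha|apply: val_ge_alg].
- exact: hG.
exists m, e'; split=> // a.
have [_ _ [p p0 vp]] := nF.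
have [N hN] := chain_filt_bounded a.
have : chain_filt L 0 (sc a (p ^+ N)).
  move=> k v hv; rewrite scE; apply: (@chain_scale_le _ _ _ _ _ sdL (k - N%:Z) N%:Z).
  - apply: val_ge_alg => //; right.
    by rewrite (val_exp (@unitF F) nF _ p0).2 vp mul1r.
  - exact: hN.
  - by lia.
rewrite {1}ME => -[c _ cE]; exists (fun i => c i * p ^- N).
have -> : a = sc (sc a (p ^+ N)) (p ^- N) by rewrite scA divff ?sc1 // expf_neq0.
rewrite cE; apply/lfunP => v; rewrite scE !sum_lfunE rscale_suml.
by apply: eq_bigr => i _; rewrite -/(sc (e' i) _) -scA !scE.
Qed.

Lemma chain_self_dual_order : self_dual_order X (chain_filt L 0).
Proof.
split; last by move=> a b; apply: (chain_filt_adjoint sdL).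
by split; [exact: chain_is_order|exact: (chain_hereditary sdL)].
Qed.

End ChainOrder.

(** * The lattice function of a chain *)

Section ChainFunctions.
Variables (R : realType) (F : fieldType) (D : falgType F) (V : vectType D^c).
Variable X : hermitian_datum V.
Local Notation h := (hform X).
Local Notation vD := (valD X).
Local Notation pi := (unif X).
Local Notation d := ((degD X)%:R : R).
Implicit Types (v w : V) (x : D) (a b : 'End(V)).

(** The ceiling makes the function left-continuous: it equals [L m] on the interval from $(m-1)/4d$,
    excluded, to $m/4d$, included. *)
Definition chain_fun (L : int -> set V) (t : R) : set V := L (Num.ceil (4 * d * t)).

Let d4_gt0 : 0 < 4 * d.
Proof. by rewrite mulr_gt0 // degDR_gt0. Qed.

Let d4_neq0 : 4 * d != 0. Proof. by rewrite gt_eqF. Qed.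

Let d4_divK (y : R) : 4 * d * (y / (4 * d)) = y.
Proof. by rewrite mulrC divfK. Qed.

Let d4_lt (x y : R) : (4 * d * x < 4 * d * y) = (x < y).
Proof. by rewrite ltr_pM2l. Qed.

Let d4_shift (t : R) n : 4 * d * (t + n%:~R / d) = 4 * d * t + (4 * n)%:~R.
Proof.
have d0 : d != 0 by rewrite gt_eqF // degDR_gt0.
by rewrite intrM mulrDr; congr (_ + _); field.
Qed.

Section OneChain.
Variable L : int -> set V.

Lemma chain_fun_int m : chain_fun L (m%:~R / (4 * d)) = L m.
Proof. by rewrite /chain_fun d4_divK intrKceil. Qed.

Hypothesis sdL : sd_chain X L.

Lemma chain_fun_right t :
  right_part (chain_fun L) t = L (Num.floor (4 * d * t) + 1).
Proof.
apply/seteqP; split=> v.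
  case=> u /= tu; apply: (chain_le sdL); rewrite lezD1 ceil_gt_int.
  by apply: le_lt_trans (floor_le _) _; rewrite d4_lt.
move=> hv; exists ((Num.floor (4 * d * t) + 1)%:~R / (4 * d)); last by rewrite chain_fun_int.
by rewrite /= -d4_lt d4_divK floorD1_gt.
Qed.

Lemma chain_fun_right_int m : right_part (chain_fun L) (m%:~R / (4 * d)) = L (m + 1).
Proof. by rewrite chain_fun_right d4_divK intrKfloor. Qed.

Lemma chain_fun_self_dual : self_dual_lattice_function X (chain_fun L).
Proof.
split; [split|].
- by move=> t; apply: chain_full.
- move=> s t st v; apply: (chain_le sdL); apply: le_ceil.
  by rewrite ler_pM2l.
- move=> t; apply/seteqP; split=> v hv.
    move=> u /= ut; apply: (chain_le sdL _ hv); apply: le_ceil.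
    by rewrite ler_pM2l // ltW.
  pose c := Num.ceil (4 * d * t).
  have /andP[c1 c2] := ceil_itv (4 * d * t).
  pose y := ((c - 1)%:~R + 4 * d * t) / 2.
  have y1 : (c - 1)%:~R < y by rewrite /y /c; lra.
  have y2 : y < 4 * d * t by rewrite /y /c; lra.
  have := hv (y / (4 * d)); rewrite /= -d4_lt /chain_fun d4_divK => /(_ y2).
  rewrite (ceil_def (m := c)) // y1 /=; apply: le_trans (ltW y2) _.
  exact: ceil_ge.
- move=> t; have e1 : 4 * d * (t + d^-1) = 4 * d * t + 4%:~R.
    by have := d4_shift t 1; rewrite mulr1z div1r mulr1.
  rewrite /chain_fun e1 ceilDrz ?intr_int // (intrKceil 4%:Z).
  have sh m v := chain_shift sdL m v 1; rewrite mulr1 expr1z in sh.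
  apply/seteqP; split=> [_ [v hv <-]|v hv]; first exact: (sh _ _).1.
  exists (rscale v (pi ^ (-1))).
    by apply: (sh _ _).2; rewrite rscaleA -[X in _ * X]expr1z unifzNK rscale1.
  by rewrite rscaleA -[X in _ * X]expr1z unifzNK rscale1.
- move=> t; rewrite chain_fun_right /chain_fun mulrN.
  have -> : Num.floor (- (4 * d * t)) = - Num.ceil (4 * d * t).
    by rewrite ceilNfloor opprK.
  by rewrite addrC (chain_dual sdL).
Qed.

Lemma filt0_chain_fun : filt0 (chain_fun L) = chain_filt L 0.
Proof.
apply/seteqP; split=> a ha m v.
  by rewrite addr0 -chain_fun_int => /ha; rewrite addr0.
by rewrite addr0 => /ha; rewrite addr0.
Qed.

Lemma filt0plus_chain_fun : filt0plus (chain_fun L) = chain_filt L 1.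
Proof.
apply/seteqP; split=> a.
  case=> t /= t0 ha m v; rewrite -[in X in X -> _]chain_fun_int => /ha.
  rewrite /chain_fun mulrDr d4_divK; apply: (chain_le sdL).
  rewrite lezD1 ceil_gt_int ltrDl.
  by rewrite mulr_gt0.
move=> ha; exists (4 * d)^-1 => /=; first by rewrite invr_gt0.
move=> s v hv; rewrite /chain_fun mulrDr divff //.
have -> : Num.ceil (4 * d * s + 1) = Num.ceil (4 * d * s) + 1.
  by rewrite -[X in Num.ceil (_ + X)]/(1%:~R) ceilDrz ?intr_int // intrKceil.
exact: ha.
Qed.

End OneChain.

End ChainFunctions.

(** * Chains built from one period *)

Section Periodic.
Variables (F : fieldType) (D : falgType F) (V : vectType D^c).
Variable X : hermitian_datum V.
Local Notation pi := (unif X).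
Local Notation vD := (valD X).
Let nD := valD_valuation X.

Lemma full_lattice_shift M (n : int) : full_lattice X M ->
  full_lattice X [set v | M (rscale v (pi ^ n))].
Proof.
have conj k x : val_ge vD 0 x -> val_ge vD 0 (pi ^ (- k) * x * pi ^ k).
  move=> hx; apply: (val_geMW nD (m := - k) (n := k)); first by lia.
    apply: (val_geMW nD (m := - k) (n := 0)) => //; first by lia.
    exact: val_ge_unifz.
  exact: val_ge_unifz.
case=> k [e [ME span]]; exists k, (fun i => rscale (e i) (pi ^ (- n))); split.
  apply/seteqP; split=> v; rewrite ME /=.
    move=> [c hc vE]; exists (fun i => pi ^ n * c i * pi ^ (- n)).
      by move=> i; have := conj (- n) _ (hc i); rewrite opprK.
    rewrite -[LHS]rscale1 -(unifzK X n) -rscaleA vE rscale_suml.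
    by apply: eq_bigr => i _; rewrite !rscaleA !mulrA unifzNK mul1r.
  move=> [c hc ->]; exists (fun i => pi ^ (- n) * c i * pi ^ n).
    by move=> i; apply: conj; apply: hc.
  by rewrite rscale_suml; apply: eq_bigr => i _; rewrite !rscaleA !mulrA.
move=> v; have [c vE] := span v; exists (fun i => pi ^ n * c i).
by rewrite vE; apply: eq_bigr => i _; rewrite rscaleA mulrA unifzNK mul1r.
Qed.

(* The chain with L(r + 4q) = A(r) pi^q for 0 <= r < 4. *)
Definition periodic (A : int -> set V) (m : int) : set V :=
  [set v | A (m %% 4)%Z (rscale v (pi ^ (- (m %/ 4)%Z)))].

Lemma periodicE A (r q : int) v : 0 <= r < 4 ->
  periodic A (r + 4 * q) v = A r (rscale v (pi ^ (- q))).
Proof.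
move=> hr; rewrite /periodic /=.
have -> : ((r + 4 * q) %% 4)%Z = r by lia.
by have -> : ((r + 4 * q) %/ 4)%Z = q by lia.
Qed.

Lemma periodic_decomp (m : int) : exists r q : int, 0 <= r < 4 /\ m = r + 4 * q.
Proof. by exists (m %% 4)%Z, (m %/ 4)%Z; lia. Qed.

Lemma periodic_base A r : 0 <= r < 4 -> periodic A r = A r.
Proof.
move=> hr; apply/seteqP; split=> v; have := periodicE A 0 v hr;
by rewrite mulr0 addr0 oppr0 expr0z rscale1 => ->.
Qed.

Lemma periodic_shift A m v n :
  periodic A (m + 4 * n) v = periodic A m (rscale v (pi ^ (- n))).
Proof.
have [r [q [hr ->]]] := periodic_decomp m.
rewrite -addrA -mulrDr !periodicE // rscaleA -unifzD.
by rewrite opprD (addrC (- q)).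
Qed.

(** The duality $m\mapsto 1-m$ exchanges the residues 0 and 1, and sends 2 and 3 to $-1$ and $-2$.
    This is why the lattices at 3 and 2 enter the last two hypotheses divided by the uniformizer. *)
Lemma periodic_sd_chain A :
  (forall r, 0 <= r < 4 -> full_lattice X (A r)) ->
  [/\ A 1 `<=` A 0, A 2 `<=` A 1, A 3 `<=` A 2 & forall v, A 0 v -> A 3 (rscale v pi)] ->
  [/\ dual_lattice X (A 0) = A 1, dual_lattice X (A 1) = A 0,
      dual_lattice X [set v | A 3 (rscale v pi)] = A 2 &
      dual_lattice X [set v | A 2 (rscale v pi)] = A 3] ->
  sd_chain X (periodic A).
Proof.
move=> fullA [A10 A21 A32 A03] [dA0 dA1 dA3 dA2].
have sh m v := periodic_shift A m v 1.
have base r : 0 <= r < 4 -> periodic A r = A r by exact: periodic_base.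
split.
- move=> m; have [r [q [hr ->]]] := periodic_decomp m.
  have -> : periodic A (r + 4 * q) = [set v | A r (rscale v (pi ^ (- q)))].
    by apply/seteqP; split=> v; rewrite periodicE.
  by apply: full_lattice_shift; apply: fullA.
- move=> m v; have [r [q [hr ->]]] := periodic_decomp m.
  rewrite (_ : r + 4 * q + 1 = r + 1 + 4 * q) ?periodic_shift; last by lia.
  move: (rscale _ _) => w.
  have [->|[->|[->|->]]] : r = 0 \/ r = 1 \/ r = 2 \/ r = 3 by lia.
  + by rewrite !base //; apply: A10.
  + by rewrite !base //; apply: A21.
  + by rewrite !base //; apply: A32.
  + rewrite (_ : 3 + 1 = 0 + 4 * 1 :> int) // periodic_shift !base // => /A03.
    by rewrite rscaleA -[X in _ * X]expr1z unifzNK rscale1.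
- move=> m v; rewrite (_ : m + 4 = m + 4 * 1) // sh rscaleA.
  by rewrite -[X in X * _]expr1z unifzK rscale1.
- move=> m; have [r [q [hr ->]]] := periodic_decomp m.
  have -> : periodic A (1 - (r + 4 * q)) =
      [set w | periodic A (1 - r) (rscale w (pi ^ (- - q)))].
    apply/seteqP; split=> w; rewrite (_ : 1 - (r + 4 * q) = 1 - r + 4 * - q);
      by rewrite ?periodic_shift //; lia.
  apply/seteqP.
  suff e v : dual_lattice X (periodic A (1 - r)) v <-> A r v.
    split=> v; rewrite periodicE // => hv.
      by apply/e; apply: (dual_lattice_shift _ _ _ _).1; exact: hv.
    by apply: (dual_lattice_shift _ _ _ _).2; apply/e.
  have [->|[->|[->|->]]] : r = 0 \/ r = 1 \/ r = 2 \/ r = 3 by lia.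
  + by rewrite subr0 base // dA1.
  + by rewrite subrr base // dA0.
  + rewrite -dA3; have -> // : periodic A (1 - 2) = [set v0 | A 3 (rscale v0 pi)].
    apply/seteqP; split=> w; rewrite (_ : 1 - 2 = 3 + 4 * - 1 :> int) //;
    by rewrite periodicE // opprK expr1z.
  + rewrite -dA2; have -> // : periodic A (1 - 3) = [set v0 | A 2 (rscale v0 pi)].
    apply/seteqP; split=> w; rewrite (_ : 1 - 3 = 2 + 4 * - 1 :> int) //;
    by rewrite periodicE // opprK expr1z.
Qed.

End Periodic.

(** * Lattice functions whose order is maximal *)

Section TwoStep.
Variables (R : realType) (F : fieldType) (D : falgType F) (V : vectType D^c).
Variable X : hermitian_datum V.
Local Notation pi := (unif X).
Local Notation d := ((degD X)%:R : R).
Variable Gamma : R -> set V.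

(* Moving all jumps in the interval ]-1/2d, 1/2d[ to 0 enlarges the order of
   Gamma, so the jumps of Gamma already are in (1/2d)Z. *)
Lemma maximal_two_step : self_dual_lattice_function X Gamma ->
  maximal_self_dual_order X (filt0 Gamma) ->
  exists L, [/\ sd_chain X L, Gamma = chain_fun X L, L (-1) = L 0 & L 1 = L 2].
Proof.
move=> sdG [_ maxG]; have lfG := sdG.1.
have d0 : 0 < d by exact: degDR_gt0.
have d4 : 4 * d != 0 by rewrite mulf_neq0 // gt_eqF.
pose t0 : R := 2 / (4 * d).
have t00 : 0 < t0 by rewrite /t0 divr_gt0 // mulr_gt0.
have t0t0 : t0 + t0 = 1%:~R / d by rewrite /t0; field; rewrite gt_eqF.
pose K0 := right_part Gamma (- t0); pose K1 := Gamma t0.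
(* The coarsened chain has $K_0$ at 0, $K_1$ at 1 and 2, and at 3 already the value $K_0\varpi$ of
   index 4. *)
pose A (r : int) := if r == 0 then K0 else if r == 3 then [set v | K0 (rscale v (pi ^ (-1)))] else K1.
have dK0 : dual_lattice X K0 = K1 by rewrite /K0 (sd_dual_right sdG).
have dK1 : dual_lattice X K1 = K0 by rewrite /K1 (sd_dual sdG).
have G0K0 t : - t0 < t -> Gamma t `<=` K0 by move=> h v hv; exists t.
have K1K0 : K1 `<=` K0 by apply: G0K0; lra.
have K0full : full_lattice X K0 by apply: lf_right_full.
have pi1 (v : V) : rscale (rscale v pi) (pi ^ (-1)) = v.
  by rewrite rscaleA -[X in X * _]expr1z unifzK rscale1.
have sdL : sd_chain X (periodic X A).
  apply: periodic_sd_chain.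
  - move=> r hr; rewrite /A; case: ifP => // _; case: ifP => _; last exact: lf_full.
    exact: full_lattice_shift.
  - split; rewrite /A //= => v; last by rewrite pi1.
    move=> /(lf_right_shift lfG _ _ 1).1; rewrite rscaleA unifzNK rscale1.
    by rewrite -t0t0 addKr => /(lf_right_le lfG).
  - rewrite /A /= dK0 dK1; split=> //.
      rewrite -[RHS]dK0; congr dual_lattice.
      by apply/seteqP; split=> v /=; rewrite pi1.
    have -> : [set v | K1 (rscale v pi)] = [set v | K1 (rscale v (pi ^ (- - 1)))].
      by rewrite opprK expr1z.
    by apply/seteqP; split=> v; rewrite -dK1; [apply: (dual_lattice_shift _ _ _ _).1|apply: (dual_lattice_shift _ _ _ _).2].
have fG : filt0 (chain_fun X (periodic X A) : R -> set V) = filt0 Gamma.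
  apply: maxG.
    rewrite filt0_chain_fun //; exact: chain_self_dual_order.
  rewrite filt0_chain_fun // => a ha m v; rewrite addr0.
  have aG t w : Gamma t w -> Gamma t (a w) by move=> /ha; rewrite addr0.
  have aK0 w : K0 w -> K0 (a w) by case=> s ts /aG sw; exists s.
  have [r [q [hr ->]]] := periodic_decomp m.
  rewrite !periodicE // -lfun_rscale; move: (rscale v _) => w.
  rewrite /A; case: ifP => _; first exact: aK0.
  case: ifP => _; last exact: aG.
  by rewrite /= -lfun_rscale; apply: aK0.
have base r := periodic_base X A (r := r).
(* The order of [Gamma] now equals that of the coarse chain, so [chain_stable] makes $\Gamma(0)$ a
   member of that chain between $K_1$ and $K_0$. *)
have G0 : Gamma 0 = K0 \/ Gamma 0 = K1.
  have K1G : K1 `<=` Gamma 0 by move=> v; apply: (lf_mono lfG); lra.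
  have G0K : Gamma 0 `<=` K0 by apply: G0K0; lra.
  have [[v0 [hv0 v00]]|no] := pselect (exists v, Gamma 0 v /\ v != 0); last first.
    right; apply/seteqP; split=> // v hv.
    have -> : v = 0 by apply/eqP; apply: contraT => vn; case: no; exists v.
    by case: (lf_sub lfG t0).
  have [||m [n [y [G0E _ _ _]]]] := chain_stable sdL (N := Gamma 0) (m0 := 0) _ _ hv0 v00.
  - move=> a v ha hv; have : filt0 Gamma a by rewrite -fG filt0_chain_fun.
    by move=> /(_ 0 v hv); rewrite addr0.
  - by rewrite base.
  have [m0|m0] := leP m 0.
    left; apply/seteqP; split=> //; rewrite G0E => v hv.
    by apply: (chain_le sdL m0); rewrite base.
  right; apply/seteqP; split=> //; rewrite G0E => v hv.
  by have : periodic X A 1 v; [apply: (chain_le sdL _ hv)|rewrite base].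
(* If $\Gamma(0)=K_1$, then duality gives $\Gamma(0+)=K_0$, so $K_0$ is contained in $\Gamma(0)$ in
   this case too. *)
have {}G0 : Gamma 0 = K0.
  case: G0 => // G0; apply/seteqP; split; first by apply: G0K0; lra.
  by have := sd_dual sdG 0; rewrite G0 dK1 oppr0 => -> v /(lf_right_le lfG); rewrite G0.
have G0r : right_part Gamma 0 = K1.
  by have := sd_dual sdG 0; rewrite G0 dK0 oppr0.
have Lm1 : periodic X A (-1) = periodic X A 0.
  have -> : periodic X A (-1) = periodic X A (3 + 4 * -1) by [].
  apply/seteqP; split=> v; rewrite periodicE // base //;
  by rewrite /A /= opprK expr1z pi1.
exists (periodic X A); split=> //.
apply/funext => t; rewrite /chain_fun.
set m := Num.ceil _.
(* The period from $-1$ to 2 surrounds the jump at 0, so that $r\le 0$ corresponds to $K_0$ and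
   $r\ge 1$ to $K_1$. *)
pose q := ((m + 1) %/ 4)%Z; pose r := m - 4 * q.
have hr : -1 <= r <= 2 by rewrite /r /q; lia.
pose t' := t - q%:~R / d.
have tE : t = t' + q%:~R / d by rewrite /t' subrK.
have t'E : 4 * d * t' = 4 * d * t - (4 * q)%:~R.
  by rewrite /t' intrM mulrBr; congr (_ - _); field; rewrite gt_eqF.
have /andP[c1 c2] := ceil_itv (4 * d * t); rewrite -/m in c1 c2.
have r1 : (r - 1)%:~R < 4 * d * t'.
  by rewrite t'E ltrBrDr -intrD (_ : r - 1 + 4 * q = m - 1) // /r; lia.
have r2 : 4 * d * t' <= r%:~R.
  by rewrite t'E lerBlDr -intrD (_ : r + 4 * q = m) // /r; lia.
have lo : - t0 < t'.
  rewrite /t0 -mulNr ltr_pdivrMr ?mulr_gt0 // mulrC; apply: le_lt_trans r1.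
  by rewrite -[- 2]/((-2)%:~R) ler_int; lia.
have hi : t' <= t0.
  rewrite /t0 ler_pdivlMr ?mulr_gt0 // mulrC; apply: le_trans r2 _.
  by rewrite -[2]/(2%:~R) ler_int; lia.
have G't : Gamma t' = periodic X A r.
  have [r0|r0] := leP r 0.
    have -> : periodic X A r = K0.
      have [->|->] : r = 0 \/ r = -1 by lia.
        by rewrite base.
      by rewrite Lm1 base.
    apply/seteqP; split; first exact: G0K0.
    rewrite -G0 => v; apply: (lf_mono lfG).
    have : 4 * d * t' <= 0 by apply: le_trans r2 _; rewrite -[0]/(0%:~R) ler_int.
    by rewrite pmulr_rle0 // mulr_gt0.
  have -> : periodic X A r = K1.
    by have [->|->] : r = 1 \/ r = 2; [lia|rewrite base|rewrite base].
  apply/seteqP; split; last by move=> v; apply: (lf_mono lfG).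
  rewrite -G0r => v hv; exists t' => //=.
  have : 0 < 4 * d * t' by apply: le_lt_trans r1; rewrite -[0]/(0%:~R) ler_int; lia.
  by rewrite pmulr_rgt0 // mulr_gt0.
apply/seteqP; split=> v; rewrite (_ : m = r + 4 * q) ?periodic_shift -?G't; try by rewrite /r; lia.
  by rewrite {1}tE => hv; apply: (lf_shift lfG _ _ q).2; rewrite rscaleA unifzNK rscale1.
by move=> /(lf_shift lfG _ _ q).1; rewrite rscaleA unifzNK rscale1 -tE.
Qed.

End TwoStep.

Section Half.
Variables (F : fieldType) (D : falgType F) (V : vectType D^c).
Variable X : hermitian_datum V.
Local Notation vD := (valD X).

Definition half : D := (2%:R^-1 : F)%:A.

Lemma two_neq0 : (2%:R : F) != 0.
Proof. by case: (val_two (valF_val X) (@valF_odd _ _ _ X)). Qed.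

Lemma halfD : half + half = 1.
Proof.
rewrite /half -scalerDl -mulr2n -[X in X *: _]mulr_natr mulVf ?scale1r //.
exact: two_neq0.
Qed.

Lemma half_comm x : half * x = x * half.
Proof. by rewrite /half mulr_algl mulr_algr. Qed.

Lemma half_double x : x * half + x * half = x.
Proof. by rewrite -mulrDr halfD mulr1. Qed.

Lemma val_half : val_ge vD 0 half.
Proof.
apply: val_ge_alg => //.
have [n0 v2] := val_two (valF_val X) (@valF_odd _ _ _ X).
by right; rewrite (val_inv (@unitF F) (valF_val X)) // v2.
Qed.

Lemma bar_half : bar X half = half.
Proof.
rewrite -[LHS]half_double -mulrDl -bar_add halfD bar1; exact: mul1r.
Qed.

End Half.

(** * Isotropic lattices stable under unipotent elements *)

Section Hyperbolic.
Variables (F : fieldType) (D : falgType F) (V : vectType D^c).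
Variable X : hermitian_datum V.
Local Notation h := (hform X).
Local Notation vD := (valD X).
Local Notation pi := (unif X).
Local Notation eps := (sgn X).
Let uD := D_skew_field X.
Let nD := valD_valuation X.
Variable L : int -> set V.
Hypothesis sdL : sd_chain X L.
(** On $L_c$ the form takes values in $\mathfrak p_D^j$, and $L_{c+1}$ is its radical modulo
    $\mathfrak p_D^{j+1}$. So [M_iso] says that $M/L_{c+1}$ is totally isotropic. Since
    $L_{-c}=L_c\varpi^{-j}$, vectors of $L_c$ can be paired to 1 with vectors of $L_{-c}$. *)
Variables (j c : int) (M : set V).
Hypothesis cE : c = 2 * j.
Hypothesis M_sub : submodule X M.
Hypothesis LM : L (c + 1) `<=` M.
Hypothesis ML : M `<=` L c.
Hypothesis M_neq : exists2 m, M m & ~ L (c + 1) m.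
Hypothesis M_iso : forall v w, M v -> M w -> val_ge vD (j + 1) (h v w).
Hypothesis M_stab : forall x : 'End(V), adjoint X x (- x) -> chain_filt L 0 x ->
  chain_filt L 1 (x \o x \o x)%VF -> forall v, M v -> M (x v).
Implicit Types (v w z : V) (x y : D).

Let MD v w : M v -> M w -> M (v + w). Proof. by case: M_sub => _ + _; apply. Qed.
Let MZ v x : M v -> val_ge vD 0 x -> M (rscale v x).
Proof. by move=> hv hx; case: M_sub => _ _ sZ; apply: sZ. Qed.
Let MB v w : M v -> M w -> M (v - w). Proof. exact: (submoduleB M_sub). Qed.
Let val_eps : val_ge vD 0 eps.
Proof. by rewrite -[eps]mulr1; apply: val_ge_sgn; apply: val_ge1. Qed.

Let scaleL m n k v x := @chain_scale_le _ _ _ X L sdL m n k v x.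
Let LD m v w : L m v -> L m w -> L m (v + w).
Proof. by case: (chain_sub sdL m) => _ + _; apply. Qed.
Let LB m v w : L m v -> L m w -> L m (v - w).
Proof. exact: (submoduleB (chain_sub sdL m)). Qed.

Lemma hyperbolic_pair : exists e f,
  [/\ M e, L (- c) f, h f e = 1 & val_ge vD (1 - j) (h f f)].
Proof.
have [e Me He] := M_neq.
have [y hy hey] : exists2 y, L (- c) y & ~ val_ge vD 1 (h e y).
  apply: contrapT => /forall2NP no; apply: He; rewrite -(chain_dual sdL) => y.
  rewrite (_ : 1 - (c + 1) = - c); last by lia.
  by move=> hy; have [//|/contrapT] := no y.
have hye : ~ val_ge vD 1 (h y e) by move=> hye; apply: hey; apply: val_ge_hC.
have [c0 cv] := val_geNP hye.
have cval : vD (h y e) = 0.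
  suff : 0 <= vD (h y e) by lia.
  apply: val_ge_neq0 c0 _; apply: (chain_h sdL (m := - c) (n := c)) => //; first by lia.
  exact: ML.
have [f0 hf0 f0e] : exists2 f0, L (- c) f0 & h f0 e = 1.
  exists (rscale y (bar X (h y e)^-1)); last by rewrite hZl bar_invol mulVr // uD.
  apply: (@scaleL (- c) 0) => //; last by lia.
  by apply: val_ge_bar; rewrite -oppr0; apply: (val_geV uD nD); rewrite ?cval.
(* Subtracting [e] times half the norm of [f0] cancels this norm up to a term in [h e e], which is
   small because [e] lies in [M]. The pairing with [e] changes only to the unit [u], which is then
   scaled away. *)
pose k := h f0 f0; pose l := k * half D.
have hk : val_ge vD (- j) k by apply: (chain_h sdL _ hf0 hf0); lia.
have hl : val_ge vD (- j) l.
  by apply: (val_geMW nD (m := - j) (n := 0)) => //; try lia; apply: val_half.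
pose f1 := f0 - rscale e l.
have hf1 : L (- c) f1.
  by apply: LB => //; apply: (@scaleL c (- j)) => //; try lia; apply: ML.
pose u := h f1 e.
have hee := M_iso Me Me.
have uE : u = 1 - bar X l * h e e by rewrite /u hBl hZl f0e.
have ble : val_ge vD 1 (bar X l * h e e).
  by apply: (val_geMW nD (m := - j) (n := j + 1)) => //; try lia; apply: val_ge_bar.
have u1 : ~ val_ge vD 1 u.
  rewrite uE => h1; have := val_geD nD h1 ble.
  by rewrite subrK => /(val_ge_neq0 (oner_neq0 _)); rewrite (val_one nD).
have [u0 uv] := val_geNP u1.
have uV : val_ge vD 0 u^-1 by rewrite -oppr0; apply: (val_geV uD nD) => //; lia.
have f1f1 : val_ge vD (1 - j) (h f1 f1).
  have -> : h f1 f1 = bar X l * h e e * l.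
    rewrite /f1 !(hBl, hBr) !hZl !hformZr f0e mul1r -/k.
    have hef0 : h e f0 = eps by rewrite hform_sgn f0e bar1 mulr1.
    have bl : bar X l * eps = l.
      rewrite /l bar_mul bar_half // half_comm -mulrA half_comm mulrA.
      by congr (_ * _); rewrite /k [RHS]hform_sgn sgn_comm.
    rewrite hef0 bl -[k in k - l](half_double X) -/l addrK opprB addrC.
    by rewrite subrK mulrA.
  by apply: (val_geMW nD (m := 1) (n := - j)) => //; lia.
exists e, (rscale f1 (bar X u^-1)); split=> //.
- by apply: (@scaleL (- c) 0) => //; try lia; apply: val_ge_bar.
- by rewrite hZl bar_invol mulVr // uD.
- rewrite hZl hformZr bar_invol.
  apply: (val_geMW nD (m := 0) (n := 1 - j)) => //; first by lia.
  apply: (val_geMW nD (m := 1 - j) (n := 0)) => //; first by lia.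
  exact: val_ge_bar.
Qed.

Variables (e f : V).
Hypothesis Me : M e.
Hypothesis Lf : L (- c) f.
Hypothesis hfe : h f e = 1.
Hypothesis hff : val_ge vD (1 - j) (h f f).

Let Le : L c e := ML Me.
Let hef : h e f = eps. Proof. by rewrite hform_sgn hfe bar1 mulr1. Qed.

(** The infinitesimal Siegel (Eichler) transformation attached to [f] and [z]. *)
Definition siegel z : 'End(V) := rank1 X f z - rank1 X (rscale z eps) f.

Lemma siegelE z v : siegel z v = rscale f (h z v) - rscale z (eps * h f v).
Proof. by rewrite /siegel add_lfunE opp_lfunE !rank1E rscaleA. Qed.

Lemma siegel_skew z : adjoint X (siegel z) (- siegel z).
Proof.
rewrite /siegel opprB; apply: adjointB; first exact: adjoint_rank1.
apply: adjoint_sym; exact: adjoint_rank1.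
Qed.

Let L_eps m v : L m v -> L m (rscale v eps).
Proof. by move=> hv; apply: (@scaleL m 0) => //; lia. Qed.

Lemma siegel_filt z : L c z -> chain_filt L 0 (siegel z).
Proof.
move=> hz; apply: (chain_filtB sdL).
  by rewrite -(addNr c); apply: (chain_rank1 sdL).
by rewrite -(subrr c); apply: (chain_rank1 sdL) => //; apply: L_eps.
Qed.

(** For [f] isotropic and orthogonal to [z], the operator kills [f] and sends [z] to a multiple of
    [f], so its cube is 0. Here these relations hold one valuation deeper than needed for the order,
    hence the cube falls into the radical. *)
Lemma siegel_cube z : L c z -> val_ge vD 1 (h f z) ->
  chain_filt L 1 (siegel z \o siegel z \o siegel z)%VF.
Proof.
move=> hz hfz m v hv; pose x := siegel z.
have x0 n w : L n w -> L n (x w) by move=> /(siegel_filt hz); rewrite addr0.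
have xf : L (- c + 4) (x f).
  rewrite /x siegelE; apply: LB.
    by apply: (@scaleL (- c) 1) => //; try lia; apply: val_ge_hC.
  by apply: (@scaleL c (1 - j)) => //; try lia; apply: val_ge_sgn.
have xxz : L (c + 4) (x (x z)).
  rewrite {2}/x siegelE lfunB lfun_rscale; apply: LB.
    by apply: (@scaleL (- c + 4) j) => //; try lia; apply: (chain_h sdL _ hz hz); lia.
  by apply: x0; apply: (@scaleL c 1) => //; try lia; apply: val_ge_sgn.
rewrite !comp_lfunE -!/x {3}/x siegelE !lfunB !lfun_rscale; apply: LB.
  apply: (@scaleL (- c + 4) ((c + m + 3) %/ 4)%Z); last by lia.
    by apply: (chain_h sdL _ hz hv); lia.
  exact: x0.
apply: (@scaleL (c + 4) ((- c + m + 3) %/ 4)%Z) => //; last by lia.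
by apply: val_ge_sgn; apply: (chain_h sdL _ Lf hv); lia.
Qed.

Lemma siegel_stab z : L c z -> val_ge vD 1 (h f z) ->
  M (rscale f (h z e) - rscale z eps).
Proof.
move=> hz hfz; have := M_stab (siegel_skew z) (siegel_filt hz) (siegel_cube hz hfz) Me.
by rewrite siegelE hfe mulr1.
Qed.

Let proj v : V := v - rscale e (h f v).

Let h_proj v : h f (proj v) = 0.
Proof. by rewrite /proj hBr hformZr hfe mul1r subrr. Qed.

Let hfv v : L c v -> val_ge vD 0 (h f v).
Proof. by move=> hv; apply: (chain_h sdL _ Lf hv); lia. Qed.

Let L_proj v : L c v -> L c (proj v).
Proof. by move=> hv; apply: LB => //; apply: (@scaleL c 0) => //; try lia; apply: hfv. Qed.

Let proj_stab v : L c v -> M (rscale f (h (proj v) e) - rscale (proj v) eps).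
Proof. by move=> hv; apply: siegel_stab; [apply: L_proj|rewrite h_proj; left]. Qed.

Let epsK v : rscale (rscale v eps) eps = v.
Proof. by rewrite rscaleA sgnK rscale1. Qed.

(** Apply [siegel_stab] to the part [z] of [v] orthogonal to [f]: as [h z e] is small, the term in
    [f] lies in $L_{c+1}$, so [z] itself lies in [M]. Thus [M] is its own orthogonal. *)
Lemma lagrangian_max v : L c v -> (forall w, M w -> val_ge vD (j + 1) (h v w)) -> M v.
Proof.
move=> hv hM; have := proj_stab hv => hMz.
have hze : val_ge vD (j + 1) (h (proj v) e).
  rewrite /proj hBl hZl; apply: (val_geB nD); first exact: hM.
  apply: (val_geMW nD (m := 0) (n := j + 1)) => //; first by lia.
    by apply: val_ge_bar; apply: hfv.
  exact: M_iso.
have Mf : M (rscale f (h (proj v) e)).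
  by apply: LM; apply: (@scaleL (- c) (j + 1)) => //; lia.
have := MZ (MB Mf hMz) val_eps; rewrite opprB addrC subrK epsK => Mz.
by rewrite -(subrK (rscale e (h f v)) v); apply: MD => //; apply: MZ => //; apply: hfv.
Qed.

(** Without the orthogonality to [M], the same element of [M] shows that [f] generates $L_c$ modulo
    [M]. *)
Lemma lagrangian_cotype v : L c v -> exists2 y, val_ge vD j y & M (v - rscale f y).
Proof.
move=> hv; exists (h (proj v) e * eps).
  rewrite -sgn_comm; apply: val_ge_sgn.
  by apply: (chain_h sdL _ (L_proj hv) Le); lia.
have := MZ (proj_stab hv) val_eps; rewrite rscaleBl epsK rscaleA => hM.
have -> : v - rscale f (h (proj v) e * eps) =
    rscale e (h f v) - (rscale f (h (proj v) e * eps) - proj v).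
  by rewrite opprB addrA; congr (_ - _); rewrite /proj addrC subrK.
by apply: MB => //; apply: MZ => //; apply: hfv.
Qed.

(** Dual to [lagrangian_cotype]: [proj m] is orthogonal to [f] exactly and to [M] modulo $\mathfrak
    p_D^{j+1}$, hence to all of $L_c$. So [e] generates $M/L_{c+1}$. *)
Lemma lagrangian_type m : M m -> L (c + 1) (m - rscale e (h f m)).
Proof.
move=> hm; rewrite -(chain_dual sdL) (_ : 1 - (c + 1) = - c); last by lia.
move=> y hy; have Mm : M (proj m) by apply: MB => //; apply: MZ => //; apply: hfv; apply: ML.
have [t ht] : exists2 t, val_ge vD j t & M (rscale y (pi ^ j) - rscale f t).
  by apply: lagrangian_cotype; apply: (@scaleL (- c) j) => //; try lia; apply: val_ge_unifz.
move=> /(M_iso Mm); rewrite hBr !hformZr.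
have -> : h (proj m) f = 0 by rewrite hform_sgn h_proj bar0 mulr0.
rewrite mul0r subr0 => hj; rewrite -/(proj m) -[h _ _]mulr1 -(unifzK X j) mulrA.
by apply: (val_geMW nD (m := j + 1) (n := - j)) => //; try lia; apply: val_ge_unifz.
Qed.

(** Taking $z=fy$ puts $f(\bar y-y\epsilon)$ into [M], where it must be orthogonal to [e]. This
    makes the residual form symmetric and excludes residually symplectic and unitary planes. *)
Lemma lagrangian_sym y : val_ge vD j y -> val_ge vD (j + 1) (y - eps * bar X y).
Proof.
move=> hy; have hz : L c (rscale f y) by apply: (@scaleL (- c) j) => //; lia.
have hfz : val_ge vD 1 (h f (rscale f y)).
  by rewrite hformZr; apply: (val_geMW nD (m := 1 - j) (n := j)) => //; lia.
have := siegel_stab hz hfz; rewrite hZl hfe mulr1 rscaleA -rscaleBr => hM.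
have := M_iso hM Me; rewrite hZl hfe mulr1 barB bar_invol bar_mul bar_sgn.
exact.
Qed.

(** Reduction to [lagrangian_sym] by replacing [y] with [s * y * s], where $s=\varpi^j$: bar changes
    [s] by a sign [t] only, and this sign occurs twice. *)
Lemma lagrangian_sym_neg y : val_ge vD (- j) y -> j = 0 \/ j = 1 ->
  val_ge vD (1 - j) (y - eps * bar X y).
Proof.
move=> hy j01; pose s : D := if j == 0 then 1 else unif X.
have sE : s = pi ^ j by rewrite /s; case: j01 => ->; rewrite ?expr0z ?expr1z.
have bs : exists2 t : D, bar X s = t * s & t * t = 1 /\ forall x, t * x = x * t.
  rewrite /s; case: ifP => _; first by exists 1; rewrite ?bar1 ?mulr1 //; split=> // x; rewrite mul1r mulr1.
  case: (bar_uniformizer X) => ->; first by exists 1; rewrite ?mul1r //; split=> [|x]; rewrite ?mulr1 ?mul1r.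
  by exists (-1); rewrite ?mulN1r //; split=> [|x]; rewrite ?mulN1r ?mulrN1 ?opprK.
have [t bst [tt tc]] := bs.
have : val_ge vD j (s * y * s).
  apply: (val_geMW nD (m := 0) (n := j)); first by lia.
    by apply: (val_geMW nD (m := j) (n := - j)) => //; try lia; rewrite sE; apply: val_ge_unifz.
  by rewrite sE; apply: val_ge_unifz.
move=> /lagrangian_sym.
have -> : s * y * s - eps * bar X (s * y * s) = s * (y - eps * bar X y) * s.
  have e1 b : t * s * (b * (t * s)) = s * (b * s).
    by rewrite (tc s) -!mulrA (mulrA t b) (tc b) -(mulrA b t) (mulrA t s) (tc s) -(mulrA s t t) tt mulr1.
  rewrite !bar_mul bst e1 mulrBr mulrBl; congr (_ - _).
  by rewrite mulrA sgn_comm -!mulrA.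
move=> hs; have -> : y - eps * bar X y = pi ^ (- j) * (s * (y - eps * bar X y) * s) * pi ^ (- j).
  by rewrite sE !mulrA unifzNK mul1r -mulrA unifzK mulr1.
apply: (val_geMW nD (m := 1) (n := - j)); [lia| |exact: val_ge_unifz].
by apply: (val_geMW nD (m := - j) (n := j + 1)); [lia|exact: val_ge_unifz|].
Qed.

End Hyperbolic.

(** * Connectedness in the Zariski topology *)

Section Regular.
Variable K : fieldType.

Definition regular n (f : 'M[K]_n -> K) : Prop :=
  exists p : mpoly (n * n) K, forall x, f x = meval (fun i => mxvec x 0 i) p.

Section OneSize.
Variable n : nat.
Implicit Types f g : 'M[K]_n -> K.

Lemma regular_ext f g : f =1 g -> regular f -> regular g.
Proof. by move=> fg [p hp]; exists p => x; rewrite -fg. Qed.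

Lemma regular_const c : regular (fun _ : 'M[K]_n => c).
Proof. by exists (mpolyC _ c) => x; rewrite mevalC. Qed.

Lemma regularD f g : regular f -> regular g -> regular (fun x => f x + g x).
Proof. by move=> [p hp] [q hq]; exists (p + q) => x; rewrite rmorphD /= hp hq. Qed.

Lemma regularM f g : regular f -> regular g -> regular (fun x => f x * g x).
Proof. by move=> [p hp] [q hq]; exists (p * q) => x; rewrite rmorphM /= hp hq. Qed.

Lemma regular_entry i j : regular (fun x : 'M[K]_n => x i j).
Proof. by exists (mpolyX K (mnm1 (mxvec_index i j))) => x; rewrite mevalXU mxvecE. Qed.

Lemma regular_sum I (r : seq I) (P : pred I) (E : I -> 'M[K]_n -> K) :
  (forall i, regular (E i)) -> regular (fun x => \sum_(i <- r | P i) E i x).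
Proof.
move=> hE; elim: r => [|i r IH].
  by apply: regular_ext (regular_const 0) => x; rewrite big_nil.
case Pi : (P i); last by apply: regular_ext IH => x; rewrite big_cons Pi.
by apply: regular_ext (regularD (hE i) IH) => x; rewrite big_cons Pi.
Qed.

Lemma regular_prod I (r : seq I) (P : pred I) (E : I -> 'M[K]_n -> K) :
  (forall i, regular (E i)) -> regular (fun x => \prod_(i <- r | P i) E i x).
Proof.
move=> hE; elim: r => [|i r IH].
  by apply: regular_ext (regular_const 1) => x; rewrite big_nil.
case Pi : (P i); last by apply: regular_ext IH => x; rewrite big_cons Pi.
by apply: regular_ext (regularM (hE i) IH) => x; rewrite big_cons Pi.
Qed.

Lemma regularX f k : regular f -> regular (fun x => f x ^+ k).
Proof.
move=> hf; elim: k => [|k IH]; first by apply: regular_ext (regular_const 1).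
by apply: regular_ext (regularM hf IH) => x; rewrite exprS.
Qed.

Definition mregular p q (f : 'M[K]_n -> 'M[K]_(p, q)) : Prop :=
  forall i j, regular (fun x => f x i j).

Lemma mregular_const p q (A : 'M[K]_(p, q)) : mregular (fun _ => A).
Proof. by move=> i j; apply: regular_const. Qed.

Lemma mregular_id : mregular (fun x => x).
Proof. by move=> i j; apply: regular_entry. Qed.

Lemma mregularB p q (f g : 'M[K]_n -> 'M[K]_(p, q)) :
  mregular f -> mregular g -> mregular (fun x => f x - g x).
Proof.
move=> hf hg i j; apply: regular_ext (regularD (hf i j) (regularM (regular_const (-1)) (hg i j))).
by move=> x; rewrite !mxE mulN1r.
Qed.

Lemma mregularM p q r (f : 'M[K]_n -> 'M[K]_(p, q)) (g : 'M[K]_n -> 'M[K]_(q, r)) :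
  mregular f -> mregular g -> mregular (fun x => f x *m g x).
Proof.
move=> hf hg i j; have := regular_sum (index_enum 'I_q) xpredT (fun k => regularM (hf i k) (hg k j)).
by apply: regular_ext => x; rewrite mxE.
Qed.

Lemma regular_det p (f : 'M[K]_n -> 'M[K]_p) : mregular f -> regular (fun x => \det (f x)).
Proof.
move=> hf; apply: regular_sum => s; apply: regularM; first exact: regular_const.
by apply: regular_prod => i; apply: hf.
Qed.

Lemma regular_comp m (p : mpoly (m * m) K) (f : 'M[K]_n -> 'M[K]_m) : mregular f ->
  regular (fun x => meval (fun i => mxvec (f x) 0 i) p).
Proof.
move=> hf; under boolp.eq_fun => x do rewrite mevalE.
apply: regular_sum => mn; apply: regularM; first exact: regular_const.
apply: regular_prod => k; apply: regularX.
case/mxvec_indexP: k => i j; apply: regular_ext (hf i j) => x; by rewrite mxvecE.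
Qed.

Lemma zariski_openP (U : set (zariski K n)) : open U <-> zariski_open U.
Proof. by []. Qed.

Lemma open_regular f : regular f -> open [set x : zariski K n | f x != 0].
Proof.
move=> [p hp]; apply/zariski_openP => x /= fx; exists p; first by rewrite /principal_open /= -hp.
by move=> y; rewrite /principal_open /= -hp.
Qed.

End OneSize.

Lemma connected_mregular n m (f : 'M[K]_n -> 'M[K]_m) (S : set (zariski K n)) :
  mregular f -> connected S -> connected ((f : zariski K n -> zariski K m) @` S).
Proof.
move=> hf cS; apply: connected_continuous_connected => //.
apply: continuous_subspaceT; apply/continuousP => U /zariski_openP oU; apply/zariski_openP => x /= Ux.
have [p px pU] := oU _ Ux; have [q hq] := regular_comp p hf.
exists q; first by rewrite /principal_open /= -hq.
by move=> y; rewrite /principal_open /= -hq => /pU.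
Qed.

(* The zero locus of f in S is both closed and, being the locus g <> 0, open. *)
Lemma connected_zero_locus n (S : set (zariski K n)) (f : 'M[K]_n -> 'M[K]_n)
    (g : 'M[K]_n -> K) x0 :
  mregular f -> regular g -> connected S -> S x0 -> f x0 = 0 ->
  (forall x, S x -> (f x = 0 <-> g x != 0)) -> forall x, S x -> f x = 0.
Proof.
move=> hf hg cS Sx0 f0 fg.
suff e : S `&` [set x : zariski K n | f x = 0] = S.
  by move=> x; rewrite -[S x]/(S x) -{1}e => -[].
apply: cS.
- by exists x0.
- exists [set x : zariski K n | g x != 0]; first exact: open_regular.
  by apply/seteqP; split=> x [Sx /=]; have := fg x Sx; tauto.
- exists [set x : zariski K n | f x = 0] => //.
  have -> : [set x : zariski K n | f x = 0] =
      ~` \bigcup_(ij in [set: 'I_n * 'I_n]) [set x : zariski K n | f x ij.1 ij.2 != 0].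
    apply/seteqP; split=> x /=.
      by move=> fx [ij _ /=]; rewrite fx mxE eqxx.
    move=> no; apply/matrixP => i j; rewrite mxE; apply/eqP; apply: contraT => fij.
    by case: no; exists (i, j).
  apply: open_closedC; apply: bigcup_open => ij _.
  by apply: open_regular; apply: hf.
Qed.

End Regular.

Section Curve.
Variable K : closedFieldType.

Definition polyfun (f : K -> K) : Prop := exists p : {poly K}, forall s, f s = p.[s].

Lemma polyfun_ext f g : f =1 g -> polyfun f -> polyfun g.
Proof. by move=> fg [p hp]; exists p => x; rewrite -fg. Qed.

Lemma polyfun_const c : polyfun (fun=> c).
Proof. by exists c%:P => s; rewrite hornerC. Qed.

Lemma polyfunM f g : polyfun f -> polyfun g -> polyfun (fun x => f x * g x).
Proof. by move=> [p hp] [q hq]; exists (p * q) => s; rewrite hornerM hp hq. Qed.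

Lemma polyfun_sum I (r : seq I) (E : I -> K -> K) :
  (forall i, polyfun (E i)) -> polyfun (fun x => \sum_(i <- r) E i x).
Proof.
move=> /choice[p hp]; exists (\sum_(i <- r) p i) => s.
by rewrite horner_sum; apply: eq_bigr => i _.
Qed.

Lemma polyfun_prod I (r : seq I) (E : I -> K -> K) :
  (forall i, polyfun (E i)) -> polyfun (fun x => \prod_(i <- r) E i x).
Proof.
move=> /choice[p hp]; exists (\prod_(i <- r) p i) => s.
by rewrite horner_prod; apply: eq_bigr => i _.
Qed.

Lemma polyfunX f k : polyfun f -> polyfun (fun x => f x ^+ k).
Proof. by move=> [p hp]; exists (p ^+ k) => s; rewrite horner_exp hp. Qed.

(** Two nonempty open subsets of the curve pull back to the non-vanishing loci of two nonzero
    polynomials in one variable, and over an algebraically closed field these loci meet. *)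
Lemma connected_curve n (f : K -> 'M[K]_n) :
  (forall i j, polyfun (fun s => f s i j)) ->
  connected [set (f s : zariski K n) | s in [set: K]].
Proof.
move=> hf; have comp (p : mpoly (n * n) K) : polyfun (fun s => meval (fun i => mxvec (f s) 0 i) p).
  under boolp.eq_fun => x do rewrite mevalE.
  apply: polyfun_sum => mn; apply: polyfunM; first exact: polyfun_const.
  apply: polyfun_prod => k; apply: polyfunX.
  by case/mxvec_indexP: k => i j; apply: polyfun_ext (hf i j) => x; rewrite mxvecE.
move=> B [b Bb] [U oU BU] [C cC BC].
apply/seteqP; split=> [x|x [t _ ftx]]; first by rewrite BU => -[].
apply: contrapT => nBx.
have fB s : U (f s) -> B (f s) by move=> h; rewrite BU; split=> //; exists s.
have fC s : B (f s) -> C (f s) by rewrite {1}BC => -[].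
have nCx : (~` C) (f t).
  by move=> Cx; apply: nBx; rewrite -ftx BC; split=> //; exists t.
move: Bb; rewrite {1}BU => -[[s _ fsb] Ub].
rewrite -fsb in Ub.
have [p ps pU] := (zariski_openP U).1 oU _ Ub.
have oC : open (~` C) by apply: closed_openC.
have [q qt qC] := (zariski_openP _).1 oC _ nCx.
have [P hP] := comp p; have [Q hQ] := comp q.
have P0 : P != 0.
  by apply/eqP => P0; move: ps; rewrite /principal_open /= hP P0 horner0 eqxx.
have Q0 : Q != 0.
  by apply/eqP => Q0; move: qt; rewrite /principal_open /= hQ Q0 horner0 eqxx.
have /closed_nonrootP[r] : P * Q != 0 by rewrite mulf_neq0.
rewrite rootE hornerM mulf_eq0 negb_or => /andP[Pr Qr].
have : (~` C) (f r) by apply: qC; rewrite /principal_open /= hQ.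
by apply; apply: fC; apply: fB; apply: pU; rewrite /principal_open /= hP.
Qed.

End Curve.

(** * The Cayley transform of a nilpotent matrix *)

Section Cayley.

Lemma cayley_mulmx (R : comNzRingType) n (N : 'M[R]_n) (a b : R) :
  N *m N *m N = 0 -> a * a = b + b ->
  (1%:M - a *: N + b *: (N *m N)) *m (1%:M + a *: N + b *: (N *m N)) = 1%:M.
Proof.
move=> N3 ab; have N3' : N *m (N *m N) = 0 by rewrite mulmxA.
have N4 : N *m N *m (N *m N) = 0 by rewrite mulmxA N3 mul0mx.
rewrite !(mulmxDl, mulmxDr, mulNmx, mulmxN, mul1mx, mulmx1) -!scalemxAl -!scalemxAr.
rewrite N3 N3' N4 !scaler0 !scalerA ab scalerDl !addr0 ?oppr0 ?addr0.
set A := a *: N; set B := b *: (N *m N).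
by rewrite addrAC -(addrA _ B B) addrACA subrr addr0 addrK.
Qed.

(** For $N^3=0$ this is $(1-sN)(1+sN)^{-1}$, written as a polynomial in $s$ so that it is defined
    for every $s$. *)
Definition cayley_curve (R : comNzRingType) n (N : 'M[R]_n) (s : R) : 'M[R]_n :=
  1%:M - (s + s) *: N + (s * s + s * s) *: (N *m N).

Lemma cayley_curve0 (R : comNzRingType) n (N : 'M[R]_n) : cayley_curve N 0 = 1%:M.
Proof. by rewrite /cayley_curve !mul0r !addr0 !scale0r subr0 addr0. Qed.

Lemma cayley_curveM (R : comNzRingType) n (N : 'M[R]_n) s : N *m N *m N = 0 ->
  cayley_curve N s *m (1%:M + (s + s) *: N + (s * s + s * s) *: (N *m N)) = 1%:M.
Proof. by move=> N3; apply: cayley_mulmx => //; ring. Qed.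

(* Over K[s] the determinant is a unit, hence constant. *)
Lemma det_cayley_curve (K : fieldType) n (N : 'M[K]_n) s : N *m N *m N = 0 ->
  \det (cayley_curve N s) = 1.
Proof.
move=> N3; pose NP : 'M[{poly K}]_n := map_mx polyC N.
have NP3 : NP *m NP *m NP = 0 by rewrite /NP -!map_mxM N3 map_mx0.
have ev t : \det (cayley_curve N t) = (\det (cayley_curve NP 'X)).[t].
  rewrite -[RHS]/(horner_eval t _) -det_map_mx; congr (\det _).
  rewrite /cayley_curve !(map_mxD, map_mxN, map_mxZ, map_mx1, map_mxM) /=.
  have -> : map_mx (horner_eval t) NP = N by apply/matrixP => i j; rewrite !mxE /horner_eval hornerC.
  by rewrite /horner_eval !hornerE.
have /(congr1 determinant) := cayley_curveM 'X NP3; rewrite det_mulmx det1.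
set p := \det _; set q := \det _ => pq.
have : size (p * q) = 1%N by rewrite pq size_poly1.
have p0 : p != 0 by apply/eqP => p0; move: pq; rewrite p0 mul0r => /eqP; rewrite eq_sym oner_eq0.
have q0 : q != 0 by apply/eqP => q0; move: pq; rewrite q0 mulr0 => /eqP; rewrite eq_sym oner_eq0.
rewrite size_mul // => sz; have := size_poly_gt0 p; have := size_poly_gt0 q.
rewrite p0 q0 => sq sp; have /eqP/size_poly1P[c c0 pc] : size p = 1%N.
  by move: sz sq sp; move: (size p) (size q) => a b; lia.
by rewrite ev -/p pc hornerC -(hornerC c 0) -pc -ev cayley_curve0 det1.
Qed.

End Cayley.

(** * Orthogonal groups of split planes, in block form *)

Section BlockDiagonal.
Variables (K : fieldType) (n : nat).
(** [P] and [Q] stand for the projections onto the two isotropic lines, exchanged by the involution;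
    its triviality on the corners expresses that the form is symmetric. In O(2) the product of the
    two off-diagonal entries is 0 or 1, and the section establishes the analogue for blocks. *)
Variables (A : set 'M[K]_n) (sig : 'M[K]_n -> 'M[K]_n) (P Q : 'M[K]_n).
Hypothesis two_neq0 : (2%:R : K) != 0.
Hypothesis AM : forall x y, A x -> A y -> A (x *m y).
Hypothesis AP : A P.
Hypothesis AQ : A Q.
Hypothesis sigA : forall x, A x -> A (sig x).
Hypothesis sigM : forall x y, A x -> A y -> sig (x *m y) = sig y *m sig x.
Hypothesis sigP : sig P = Q.
Hypothesis sigQ : sig Q = P.
Hypothesis sigPQ : forall x, A x -> sig (P *m x *m Q) = P *m x *m Q.
Hypothesis sigQP : forall x, A x -> sig (Q *m x *m P) = Q *m x *m P.
Hypothesis PP : P *m P = P.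
Hypothesis QQ : Q *m Q = Q.
Hypothesis PQ : P *m Q = 0.
Hypothesis QP : Q *m P = 0.
Hypothesis comm_rest : forall x, A x -> (1%:M - P - Q) *m x = x *m (1%:M - P - Q).

(** Insert $1=P+Q+(1-P-Q)$ between [x] and [y]: the last summand commutes with [x] and is killed by
    [U]. *)
Let insertPQ (U W x y : 'M[K]_n) : A x -> U *m P + U *m Q = U ->
  U *m (x *m y) *m W = U *m x *m P *m y *m W + U *m x *m Q *m y *m W.
Proof.
move=> Ax UPQ; have UR : U *m (1%:M - P - Q) = 0.
  by rewrite !mulmxBr mulmx1 -{1}UPQ addrAC addrK subrr.
have : U *m ((1%:M - P - Q) *m x) *m y *m W = 0 by rewrite !mulmxA UR !mul0mx.
rewrite comm_rest // !mulmxA !mulmxBr mulmx1 !mulmxBl => /eqP.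
rewrite -addrA -opprD subr_eq0 => /eqP ->; by rewrite -!mulmxA.
Qed.

Let double0 (x : 'M[K]_n) : x + x = 0 -> x = 0.
Proof.
move=> /eqP; rewrite -mulr2n -scaler_nat scaler_eq0 (negPf two_neq0) => /orP[//|/eqP //].
Qed.

Section Element.
Variable x : 'M[K]_n.
Hypothesis Ax : A x.
Hypothesis xy : x *m sig x = 1%:M.
Let yx : sig x *m x = 1%:M. Proof. exact: mulmx1C. Qed.
Local Notation y := (sig x).
Local Notation a := (P *m x *m P).
Local Notation b := (P *m x *m Q).
Local Notation c := (Q *m x *m P).
Let Ay : A y := sigA Ax.

Let PyQ : P *m y *m Q = b.
Proof. by rewrite -[RHS]sigPQ // !sigM ?sigP ?sigQ ?mulmxA //; apply: AM. Qed.
Let QyP : Q *m y *m P = c.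
Proof. by rewrite -[RHS]sigQP // !sigM ?sigP ?sigQ ?mulmxA //; apply: AM. Qed.
Let sa : sig a = Q *m y *m Q.
Proof. by rewrite !sigM ?sigP ?mulmxA //; apply: AM. Qed.

Let PU : P *m P + P *m Q = P. Proof. by rewrite PP PQ addr0. Qed.
Let QU : Q *m P + Q *m Q = Q. Proof. by rewrite QP QQ add0r. Qed.
Let Aa : A a. Proof. by do ?apply: AM. Qed.
Let Ab : A b. Proof. by do ?apply: AM. Qed.
Let Ac : A c. Proof. by do ?apply: AM. Qed.

Let abE : a *m b = P *m (x *m P *m x) *m Q.
Proof. by rewrite !mulmxA -(mulmxA _ P P) PP. Qed.
Let caE : c *m a = Q *m (x *m P *m x) *m P.
Proof. by rewrite !mulmxA -(mulmxA _ P P) PP. Qed.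
Let AxPx : A (x *m P *m x). Proof. by do ?apply: AM. Qed.

(** Expanding $P\,x\sigma(x)\,Q=0$ gives $ab+b\sigma(a)=0$. The second term is $\sigma(ab)$, which
    equals $ab$ because $ab$ lies in a corner fixed by $\sigma$, and 2 is invertible. *)
Let ab0 : a *m b = 0.
Proof.
apply: double0; have := insertPQ Q y Ax PU; rewrite xy mulmx1 PQ => ->.
have e1 : P *m x *m P *m y *m Q = a *m b.
  by rewrite -PyQ !mulmxA -(mulmxA _ P P) PP.
rewrite e1; congr (_ + _).
have : sig (a *m b) = a *m b by rewrite abE sigPQ.
rewrite sigM // sa sigPQ // => <-.
by rewrite !mulmxA -(mulmxA _ Q Q) QQ.
Qed.

Let ca0 : c *m a = 0.
Proof.
apply: double0; have := insertPQ P x Ay QU; rewrite yx mulmx1 QP => ->.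
have e1 : Q *m y *m P *m x *m P = c *m a.
  by rewrite -QyP !mulmxA -(mulmxA _ P P) PP.
rewrite e1; congr (_ + _).
have : sig (c *m a) = c *m a by rewrite caE sigQP.
rewrite sigM // sa sigQP // => <-.
by rewrite !mulmxA -(mulmxA _ Q Q) QQ.
Qed.

Let a_yP : a *m (P *m y *m P) + b *m c = P.
Proof.
have := insertPQ P y Ax PU; rewrite xy mulmx1 PP => e; rewrite [RHS]e.
by rewrite -QyP !mulmxA -(mulmxA _ P P) PP -(mulmxA _ Q Q) QQ.
Qed.

Let yP_a : P *m y *m P *m a + b *m c = P.
Proof.
have := insertPQ P x Ay PU; rewrite yx mulmx1 PP => e; rewrite [RHS]e.
by rewrite -PyQ !mulmxA -(mulmxA _ P P) PP -(mulmxA _ Q Q) QQ.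
Qed.

(** [b *m c] is [P] minus a left multiple by [a], and [c *m a = 0]. *)
Lemma block_idempotent : b *m c *m (b *m c) = b *m c.
Proof.
have e : b *m c = P - a *m (P *m y *m P) by apply/eqP; rewrite eq_sym subr_eq addrC a_yP.
rewrite {2}e mulmxBr [X in _ - X]mulmxA -(mulmxA b c a) ca0 mulmx0 mul0mx subr0.
by rewrite -!mulmxA PP.
Qed.

(** If $bc=0$, then [a] is invertible in the corner of [P], so $ab=0$ and $ca=0$ kill [b] and
    [c]. *)
Lemma block_zero : b *m c = 0 -> b = 0 /\ c = 0.
Proof.
move=> bc0; have e1 : a *m (P *m y *m P) = P by rewrite -[LHS]addr0 -bc0 a_yP.
have e2 : P *m y *m P *m a = P by rewrite -[LHS]addr0 -bc0 yP_a.
split.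
  have -> : b = P *m y *m P *m a *m b by rewrite e2 !mulmxA PP.
  by rewrite -mulmxA ab0 mulmx0.
have -> : c = c *m (a *m (P *m y *m P)) by rewrite e1 -!mulmxA PP.
by rewrite mulmxA ca0 mul0mx.
Qed.

End Element.

(* b c is an idempotent, so b c = 0 is equivalent to det (1 - b c) <> 0: on a
   connected subset containing 1 it vanishes identically. *)
Lemma connected_block_diagonal (S : set (zariski K n)) :
  connected S -> S (1%:M : 'M[K]_n) ->
  (forall x, S x -> A x /\ x *m sig x = 1%:M) ->
  forall x, S x -> P *m x *m Q = 0 /\ Q *m x *m P = 0.
Proof.
move=> cS S1 SA x Sx; have [Ax xy] := SA x Sx; apply: (block_zero Ax xy).
have reg : mregular (fun x => P *m x *m Q *m (Q *m x *m P)).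
  do !apply: mregularM; try exact: mregular_const; exact: mregular_id.
apply: (connected_zero_locus (f := fun x => P *m x *m Q *m (Q *m x *m P))
  (g := fun x => \det (1%:M - P *m x *m Q *m (Q *m x *m P))) reg _ cS S1 _ _ Sx).
- by apply: regular_det; apply: mregularB => //; apply: mregular_const.
- by rewrite mulmx1 PQ mul0mx.
move=> z Sz; have [Az zy] := SA z Sz; split=> [->|].
  by rewrite subr0 det1 oner_neq0.
rewrite -unitfE -unitmxE => u.
apply: (row_free_inj (A := 1%:M - P *m z *m Q *m (Q *m z *m P))).
  by rewrite row_free_unit.
by rewrite mul0mx mulmxBr mulmx1 block_idempotent // subrr.
Qed.

End BlockDiagonal.

(** * The geometric reductive quotient of a chain *)

Section FixedRing.
Variables (F : fieldType) (D : falgType F) (V : vectType D^c).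
Variable X : hermitian_datum V.
Local Notation O0 := (fixed_val_ring X).
Local Notation I0 := (fixed_max_ideal X).
Let nF := valF_val X.

Lemma fixed_ring0 : O0 0. Proof. by split; [left|rewrite scale0r bar0]. Qed.
Lemma fixed_ring1 : O0 1. Proof. by split; [exact: (val_ge1 nF)|rewrite scale1r bar1]. Qed.

Lemma fixed_ringD c c' : O0 c -> O0 c' -> O0 (c + c').
Proof.
by move=> [h e] [h' e']; split; [exact: (val_geD nF)|rewrite scalerDl bar_add e e'].
Qed.

Lemma fixed_ringN c : O0 c -> O0 (- c).
Proof. by move=> [h e]; split; [exact: (val_geN nF)|rewrite scaleNr barN e]. Qed.

Lemma fixed_ringM c c' : O0 c -> O0 c' -> O0 (c * c').
Proof.
move=> [h e] [h' e']; split; first exact: (val_geMW nF (m := 0) (n := 0)).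
by rewrite {1}mulrC !algM bar_mul e e'.
Qed.

Lemma fixed_ring_int c : O0 c -> val_ge (valD X) 0 c%:A.
Proof. by case=> h _; apply: val_ge_alg. Qed.

Lemma fixed_ideal_val c : I0 c -> val_ge (valD X) 1 c%:A.
Proof. by case=> h _; apply: val_ge_alg. Qed.

(** The part of a [residual_model] that does not depend on the lattice function, separated so that
    models of two chains can share one residue field and one closure. *)
Record residue_base := ResidueBase {
  bk : finFieldType;
  bF : F -> bk;
  bF_quotient : embeds_quotient 1 *%R 1 *%R O0 I0 bF;
  bF_onto : forall x, exists2 c, O0 c & bF c = x;
  bK : closedFieldType;
  bemb : {rmorphism bk -> bK};
  bK_algebraic : forall z : bK, algebraicOver bemb z
}.

Variable b : residue_base.

Lemma bF1 : bF b 1 = 1. Proof. by case: (bF_quotient b). Qed.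
Lemma bFD c c' : O0 c -> O0 c' -> bF b (c + c') = bF b c + bF b c'.
Proof. by case: (bF_quotient b) => _ + _ _; apply. Qed.
Lemma bFM c c' : O0 c -> O0 c' -> bF b (c * c') = bF b c * bF b c'.
Proof. by case: (bF_quotient b) => _ _ + _; apply. Qed.
Lemma bF_eq0 c : O0 c -> (bF b c = 0 <-> I0 c).
Proof. by case: (bF_quotient b) => _ _ _; apply. Qed.
Lemma bF0 : bF b 0 = 0.
Proof. by apply/(bF_eq0 fixed_ring0); split; [left|rewrite scale0r bar0]. Qed.
Lemma bFN c : O0 c -> bF b (- c) = - bF b c.
Proof.
by move=> h; apply/eqP; rewrite -addr_eq0 -bFD ?addNr ?bF0 //; apply: fixed_ringN.
Qed.
Lemma bFB c c' : O0 c -> O0 c' -> bF b (c - c') = bF b c - bF b c'.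
Proof. by move=> h h'; rewrite bFD ?bFN //; apply: fixed_ringN. Qed.

Lemma bk_two : (2%:R : bk b) != 0.
Proof.
have e2 : bF b 2%:R = 2%:R.
  by rewrite (natrD _ 1 1) bFD ?bF1 ?(natrD _ 1 1) //; exact: fixed_ring1.
rewrite -e2; apply/eqP => /(bF_eq0 (fixed_ringD fixed_ring1 fixed_ring1)).1 [h _].
by apply: (@valF_odd _ _ _ X); exact: h.
Qed.

Lemma bK_two : (2%:R : bK b) != 0.
Proof. by rewrite -(rmorph_nat (bemb b)) fmorph_eq0 bk_two. Qed.

End FixedRing.

(** * Matrix models of the graded pieces of a chain *)

Section ChainModels.
Variables (F : fieldType) (D : falgType F) (V : vectType D^c).
Variable X : hermitian_datum V.
Local Notation O0 := (fixed_val_ring X).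
Variable b : residue_base X.
Local Notation k := (bk b).
Variable L : int -> set V.

(* Coordinates on the graded pieces L(m)/L(m+1): a period 0 <= m < 4 gives a
   decomposition of k^cn, the other ones need not be related to it. *)
Record chain_model := ChainModel {
  cn : nat;
  cV : int -> V -> 'cV[k]_cn;
  cV_add : forall m v w, L m v -> L m w -> cV m (v + w) = cV m v + cV m w;
  cV_scale : forall m v c, L m v -> O0 c -> cV m (rscale v c%:A) = bF b c *: cV m v;
  cV_ker : forall m v, L m v -> (cV m v = 0 <-> L (m + 1) v);
  cV_span : forall w, exists2 v : 'I_4 -> V, forall i : 'I_4, L i%:Z (v i) &
    w = \sum_(i < 4) cV i%:Z (v i);
  cV_direct : forall v : 'I_4 -> V, (forall i : 'I_4, L i%:Z (v i)) ->
    \sum_(i < 4) cV i%:Z (v i) = 0 -> forall i : 'I_4, cV i%:Z (v i) = 0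
}.

Hypothesis sdL : sd_chain X L.
Variable cm : chain_model.
Arguments cV_span : clear implicits.
Local Notation n := (cn cm).

Let L0 m : L m 0. Proof. by case: (chain_sub sdL m). Qed.
Let LDh m v w : L m v -> L m w -> L m (v + w).
Proof. by case: (chain_sub sdL m) => _ + _; apply. Qed.
Let LZ m v c : L m v -> O0 c -> L m (rscale v c%:A).
Proof.
move=> hv hc; case: (chain_sub sdL m) => _ _ sZ; apply: sZ => //.
exact: fixed_ring_int.
Qed.
Let LN m v : L m v -> L m (- v). Proof. exact: (submoduleN (chain_sub sdL m)). Qed.

Lemma cV0 m : cV cm m 0 = 0.
Proof. by apply/(cV_ker cm (L0 m)). Qed.

Lemma cV_opp m v : L m v -> cV cm m (- v) = - cV cm m v.
Proof.
by move=> hv; apply/eqP; rewrite -addr_eq0 -cV_add ?addNr ?cV0 //; apply: LN.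
Qed.

Lemma cV_sub m v w : L m v -> L m w -> cV cm m (v - w) = cV cm m v - cV cm m w.
Proof. by move=> hv hw; rewrite cV_add ?cV_opp //; apply: LN. Qed.

Lemma cV_congr m v w : L m v -> L m w -> L (m + 1) (v - w) -> cV cm m v = cV cm m w.
Proof.
move=> hv hw hvw; apply/eqP; rewrite -subr_eq0 -cV_sub //; apply/eqP.
by apply/(cV_ker cm) => //; apply: LDh => //; apply: LN.
Qed.

Lemma chain_model_ext l (E E' : 'M[k]_(l, n)) :
  (forall m v, 0 <= m < 4 -> L m v -> E *m cV cm m v = E' *m cV cm m v) -> E = E'.
Proof.
move=> h; have hw (w : 'cV_n) : E *m w = E' *m w.
  have [v hv ->] := cV_span cm w; rewrite !mulmx_sumr; apply: eq_bigr => i _.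
  by apply: h => //; have := ltn_ord i; lia.
by apply/matrixP => i j; have := hw (delta_mx j 0); rewrite -!colE => /matrixP/(_ i 0); rewrite !mxE.
Qed.

(** Maps given on the graded pieces of one period assemble into one matrix: the lifts [rep] are
    arbitrary, and [cV_direct] makes the outcome independent of them. *)
Lemma chain_model_map l (phi : int -> V -> 'cV[k]_l) :
  (forall m v w, L m v -> L m w -> phi m (v + w) = phi m v + phi m w) ->
  (forall m v c, L m v -> O0 c -> phi m (rscale v c%:A) = bF b c *: phi m v) ->
  (forall m v, L (m + 1) v -> phi m v = 0) ->
  exists C : 'M[k]_(l, n), forall m v, 0 <= m < 4 -> L m v -> C *m cV cm m v = phi m v.
Proof.
move=> phiD phiZ phi0.
have phiN m v : L m v -> phi m (- v) = - phi m v.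
  by move=> hv; apply/eqP; rewrite -addr_eq0 -phiD ?addNr ?phi0 //; apply: LN.
have /choice[rep hrep] w : exists v : 'I_4 -> V, (forall i : 'I_4, L i%:Z (v i)) /\
    w = \sum_(i < 4) cV cm i%:Z (v i) by have [v h1 h2] := cV_span cm w; exists v.
pose Phi w := \sum_(i < 4) phi i%:Z (rep w i).
have PhiE w v : (forall i : 'I_4, L i%:Z (v i)) -> w = \sum_(i < 4) cV cm i%:Z (v i) ->
    Phi w = \sum_(i < 4) phi i%:Z (v i).
  move=> hv wE; have [hr rE] := hrep w; apply: eq_bigr => i _.
  have hsub (j : 'I_4) : L j%:Z (rep w j - v j) by apply: LDh => //; apply: LN.
  have s0 : \sum_(j < 4) cV cm j%:Z (rep w j - v j) = 0.
    under eq_bigr => j _ do rewrite cV_sub //.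
    by rewrite sumrB -rE -wE subrr.
  have := cV_direct hsub s0 i => /(cV_ker cm (hsub i)).1 /phi0.
  rewrite phiD ?phiN //; last exact: LN.
  by move/eqP; rewrite subr_eq0 => /eqP.
have PhiD w w' : Phi (w + w') = Phi w + Phi w'.
  have [h e] := hrep w; have [h' e'] := hrep w'.
  rewrite (PhiE (w + w') (fun i => rep w i + rep w' i)).
  - by rewrite -big_split; apply: eq_bigr => i _; rewrite phiD.
  - by move=> i; apply: LDh.
  - by rewrite {1}e {1}e' -big_split; apply: eq_bigr => i _; rewrite cV_add.
have PhiZ x w : Phi (x *: w) = x *: Phi w.
  have [h e] := hrep w; have [c hc <-] := @bF_onto _ _ _ X b x.
  rewrite (PhiE _ (fun i => rscale (rep w i) c%:A)).
  - by rewrite scaler_sumr; apply: eq_bigr => i _; rewrite phiZ.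
  - by move=> i; apply: LZ.
  - by rewrite {1}e scaler_sumr; apply: eq_bigr => i _; rewrite cV_scale.
have Phi00 : Phi 0 = 0 by rewrite -(scale0r 0) PhiZ scale0r.
exists (\matrix_(i < l, j < n) Phi (delta_mx j 0) i 0) => m v hm hv.
have mulE (w : 'cV_n) : (\matrix_(i < l, j < n) Phi (delta_mx j 0) i 0) *m w = Phi w.
  apply/matrixP => i j; rewrite ord1 mxE {2}(matrix_sum_delta w) (big_morph Phi PhiD Phi00) summxE.
  apply: eq_bigr => t _; rewrite big_ord1 PhiZ !mxE mulrC.
  by [].
rewrite mulE; pose i0 : 'I_4 := inord `|m|%N.
have i0E : i0%:Z = m by rewrite /i0 inordK; lia.
have hv' (i : 'I_4) : L i%:Z (if i == i0 then v else 0) by case: eqP => [->|_] //; rewrite i0E.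
rewrite (PhiE _ _ hv').
  rewrite (bigD1 i0) //= eqxx i0E big1 ?addr0 // => i /negPf ->.
  by apply: phi0.
rewrite (bigD1 i0) //= eqxx i0E big1 ?addr0 // => i /negPf ->.
exact: cV0.
Qed.

Lemma cE_ex : exists E : 'End(V) -> 'M[k]_n, forall a, chain_filt L 0 a ->
  forall m v, 0 <= m < 4 -> L m v -> E a *m cV cm m v = cV cm m (a v).
Proof.
suff /choice[E hE] (a : 'End(V)) : exists E : 'M[k]_n, chain_filt L 0 a ->
    forall m v, 0 <= m < 4 -> L m v -> E *m cV cm m v = cV cm m (a v) by exists E.
have [ha|na] := pselect (chain_filt L 0 a); last by exists 0.
have a0 m v : L m v -> L m (a v) by move=> /ha; rewrite addr0.
have [m v w hv hw|m v c hv hc|m v hv|C hC] := chain_model_map (phi := fun m v => cV cm m (a v)).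
- by rewrite lfunD cV_add; do ?apply: a0.
- by rewrite lfun_rscale cV_scale //; apply: a0.
- apply/(cV_ker cm); last exact: a0.
  by apply: a0; apply: (chain_le sdL _ hv); lia.
- by exists C.
Qed.

Definition cE := sval (cid cE_ex).

Lemma cE_action a m v : chain_filt L 0 a -> 0 <= m < 4 -> L m v ->
  cE a *m cV cm m v = cV cm m (a v).
Proof. by move=> ha hm hv; apply: (svalP (cid cE_ex)). Qed.

Let filt_L a m v : chain_filt L 0 a -> L m v -> L m (a v).
Proof. by move=> ha /ha; rewrite addr0. Qed.

Lemma cE_uniq a (E : 'M[k]_n) : chain_filt L 0 a ->
  (forall m v, 0 <= m < 4 -> L m v -> E *m cV cm m v = cV cm m (a v)) -> cE a = E.
Proof. by move=> ha hE; apply: chain_model_ext => m v hm hv; rewrite cE_action // hE. Qed.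

Lemma cE_id : cE \1%VF = 1%:M.
Proof. by apply: cE_uniq => [|m v _ _]; [exact: (@chain_filt_id _ _ _ L)|rewrite mul1mx id_lfunE]. Qed.

Lemma cED a a' : chain_filt L 0 a -> chain_filt L 0 a' -> cE (a + a') = cE a + cE a'.
Proof.
move=> ha ha'; apply: cE_uniq => [|m v hm hv]; first exact: (chain_filtD sdL).
by rewrite mulmxDl !cE_action // add_lfunE cV_add //; apply: filt_L.
Qed.

Lemma cEM a a' : chain_filt L 0 a -> chain_filt L 0 a' -> cE (a \o a')%VF = cE a *m cE a'.
Proof.
move=> ha ha'; apply: cE_uniq => [|m v hm hv].
  by have := chain_filt_comp ha ha'; rewrite addr0.
by rewrite -mulmxA !cE_action // ?comp_lfunE //; apply: filt_L.
Qed.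

(** The matrix sees one period only; scaling by powers of the uniformizer transports the conclusion
    to every index. *)
Lemma cE_eq0 a : chain_filt L 0 a -> (cE a = 0 <-> chain_filt L 1 a).
Proof.
move=> ha; split=> [a0 m v hv|a1].
  have [r [q [hr mE]]] := periodic_decomp m.
  have hw : L r (rscale v (unif X ^ (- q))).
    have := (chain_shift sdL _ _ (- q)).1 hv.
    by rewrite (_ : m + 4 * - q = r) // mE; lia.
  have /(cV_ker cm (filt_L ha hw)).1 : cV cm r (a (rscale v (unif X ^ (- q)))) = 0.
    by rewrite -cE_action // a0 mul0mx.
  move/(chain_shift sdL _ _ q).1; rewrite lfun_rscale rscaleA unifzNK rscale1.
  by rewrite (_ : r + 1 + 4 * q = m + 1) // mE; lia.
apply: cE_uniq => // m v hm hv; rewrite mul0mx; symmetry.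
by apply/(cV_ker cm (filt_L ha hv)); apply: a1.
Qed.

Lemma cEN a : chain_filt L 0 a -> cE (- a) = - cE a.
Proof.
move=> ha; apply/eqP; rewrite -addr_eq0 -cED ?addNr //; last exact: (chain_filtN sdL).
by apply/eqP/cE_eq0; apply: (chain_filt_zero sdL).
Qed.

Lemma cEB a a' : chain_filt L 0 a -> chain_filt L 0 a' -> cE (a - a') = cE a - cE a'.
Proof. by move=> ha ha'; rewrite cED ?cEN //; apply: (chain_filtN sdL). Qed.

Lemma cE_congr a a' : chain_filt L 0 a -> chain_filt L 0 a' ->
  chain_filt L 1 (a - a') -> cE a = cE a'.
Proof.
move=> ha ha' haa; apply/eqP; rewrite -subr_eq0 -cEB //; apply/eqP/cE_eq0 => //.
exact: (chain_filtB sdL).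
Qed.

Lemma chain_filt_homothety a c : chain_filt L 0 a -> O0 c ->
  chain_filt L 0 (homothety V c \o a)%VF.
Proof.
move=> ha hc m v hv; rewrite comp_lfunE homothetyE addr0; apply: LZ => //.
exact: filt_L.
Qed.

Lemma cE_homothety a c : chain_filt L 0 a -> O0 c ->
  cE (homothety V c \o a)%VF = bF b c *: cE a.
Proof.
move=> ha hc; apply: cE_uniq => [|m v hm hv]; first exact: chain_filt_homothety.
by rewrite -scalemxAl cE_action // comp_lfunE homothetyE cV_scale //; apply: filt_L.
Qed.

(** On reductions, adjunction is a relation [rel], single-valued because adjoints preserve the
    radical. It becomes a linear map through coordinates on a basis of its domain, and is then
    extended linearly to the closure. *)
Lemma cS_ex : exists S : {linear 'M[bK b]_n -> 'M[bK b]_n},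
  forall a a', chain_filt L 0 a -> adjoint X a a' ->
    S (map_mx (bemb b) (cE a)) = map_mx (bemb b) (cE a').
Proof.
pose rel x y := exists a a', [/\ chain_filt L 0 a, adjoint X a a', cE a = x & cE a' = y].
have filtA a a' : chain_filt L 0 a -> adjoint X a a' -> chain_filt L 0 a'.
  exact: (chain_filt_adjoint sdL).
have relD x y x' y' : rel x y -> rel x' y' -> rel (x + x') (y + y').
  move=> [a [a' [ha aa' <- <-]]] [e [e' [he ee' <- <-]]].
  exists (a + e), (a' + e'); split; [exact: (chain_filtD sdL)|exact: adjointD|exact: cED|].
  by apply: cED; [apply: filtA aa'|apply: filtA ee'].
have relZ c x y : rel x y -> rel (c *: x) (c *: y).
  move=> [a [a' [ha aa' <- <-]]]; have [d hd <-] := @bF_onto _ _ _ X b c.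
  exists (homothety V d \o a)%VF, (homothety V d \o a')%VF; split.
  - exact: chain_filt_homothety.
  - have hh := adjoint_comp (adjoint_homothety (X := X) hd.2) aa'.
    have -> // : (homothety V d \o a')%VF = (a' \o homothety V d)%VF.
    by apply/lfunP => v; rewrite !comp_lfunE !homothetyE lfun_rscale.
  - exact: cE_homothety.
  - by apply: cE_homothety => //; apply: filtA aa'.
have rel_fun y : rel 0 y -> y = 0.
  move=> [a [a' [ha aa' /(cE_eq0 ha).1 a0 <-]]]; apply/cE_eq0; first exact: filtA aa'.
  exact: (chain_filt_adjoint sdL a0 aa').
have rel0 : rel 0 0.
  exists 0, 0; split; [exact: (chain_filt_zero sdL)| |by apply/cE_eq0; apply: (chain_filt_zero sdL)..].
  by move=> v w; rewrite !zero_lfunE h0l h0r.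
(* The residue field is finite, so the domain of [rel] can be listed. *)
pose dom := [seq x <- enum {: 'M[k]_n} | `[< exists y, rel x y >]].
pose U := <<dom>>%VS.
have /choice[part hpart] x : exists y, x \in dom -> rel x y.
  have [xd|_] := boolP (x \in dom); last by exists 0.
  by move: xd; rewrite mem_filter => /andP[/asboolP[y hy] _]; exists y.
have Udom x : x \in U -> exists y, rel x y.
  move=> xU; rewrite (@coord_span _ _ _ (in_tuple dom) x xU).
  exists (\sum_i coord (in_tuple dom) i x *: part dom`_i).
  elim/big_ind2: _ => [//|x1 y1 x2 y2|i _]; first exact: relD.
  by apply: relZ; apply: hpart; apply: mem_nth.
have /choice[f hf] (i : 'I_(\dim U)) : exists y, rel (vbasis U)`_i y.
  by apply: Udom; apply: vbasis_mem; apply: mem_nth; rewrite size_tuple.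
pose s x := \sum_i coord (vbasis U) i x *: f i.
have sP x y : rel x y -> s x = y.
  move=> hxy; have xU : x \in U.
    by apply: memv_span; rewrite mem_filter mem_enum andbT; apply/asboolP; exists y.
  have : rel x (s x).
    rewrite {1}(coord_vbasis xU); apply: (big_ind2 rel) => // i _.
    exact: relZ.
  move=> hs; have : rel (x + (-1) *: x) (s x + (-1) *: y) by apply: relD => //; apply: relZ.
  by rewrite !scaleN1r subrr => /rel_fun/eqP; rewrite subr_eq0 => /eqP.
have s_lin : linear s.
  move=> c x y; rewrite /s scaler_sumr -big_split; apply: eq_bigr => i _ /=.
  by rewrite linearP /= scalerDl scalerA.
pose S0 (z : 'M[bK b]_n) := \sum_i \sum_j z i j *: map_mx (bemb b) (s (delta_mx i j)).
have S_lin : linear S0.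
  move=> c x y; rewrite /S0 scaler_sumr -big_split; apply: eq_bigr => i _ /=.
  rewrite scaler_sumr -big_split; apply: eq_bigr => j _ /=.
  by rewrite !mxE scalerDl scalerA.
pose S : {linear 'M[bK b]_n -> 'M[bK b]_n} := HB.pack S0 (GRing.isLinear.Build _ _ _ _ _ S_lin).
exists S => a a' ha aa'; rewrite -(sP (cE a) (cE a')); last by exists a, a'.
rewrite -[LHS]/(S0 _) /S0.
pose sL : {linear 'M[k]_n -> 'M[k]_n} := HB.pack s (GRing.isLinear.Build _ _ _ _ _ s_lin).
rewrite [in RHS](matrix_sum_delta (cE a)) -[s _]/(sL _) linear_sum map_mx_sum.
apply: eq_bigr => i _; rewrite linear_sum map_mx_sum; apply: eq_bigr => j _.
by rewrite linearZ map_mxZ /= mxE.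
Qed.

Definition cS := sval (cid cS_ex).

Lemma cS_adjoint a a' : chain_filt L 0 a -> adjoint X a a' ->
  cS (map_mx (bemb b) (cE a)) = map_mx (bemb b) (cE a').
Proof. exact: (svalP (cid cS_ex)). Qed.

Definition chain_algebra : set 'M[bK b]_n :=
  [set x | exists l (c : 'I_l -> bK b) (a : 'I_l -> 'End(V)),
     (forall i, chain_filt L 0 (a i)) /\ x = \sum_i c i *: map_mx (bemb b) (cE (a i))].

Definition chain_group : set (zariski (bK b) n) :=
  [set x : 'M[bK b]_n | [/\ chain_algebra x, x *m cS x = 1%:M & Defs.orthogonal X -> \det x = 1]].

Definition chain_group0 : set (zariski (bK b) n) :=
  connected_component chain_group (1%:M : 'M[bK b]_n).

End ChainModels.
Arguments chain_algebra {F D V X b L} sdL cm.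
Arguments chain_group {F D V X b L} sdL cm.
Arguments chain_group0 {F D V X b L} sdL cm.

(** * Coordinates on finite quotients over the residue field *)

Section FiniteQuotient.
Variables (F : fieldType) (D : falgType F) (V : vectType D^c).
Variable X : hermitian_datum V.
Local Notation O0 := (fixed_val_ring X).
Local Notation I0 := (fixed_max_ideal X).
Variable b : residue_base X.
Variables (U : zmodType) (sc : U -> F -> U) (A B : set U).
Hypothesis sc1 : forall u, sc u 1 = u.
Hypothesis scDl : forall u w x, sc (u + w) x = sc u x + sc w x.
Hypothesis scDr : forall u x y, sc u (x + y) = sc u x + sc u y.
Hypothesis scA : forall u x y, sc (sc u x) y = sc u (x * y).
Hypothesis A0 : A 0.
Hypothesis AD : forall u w, A u -> A w -> A (u + w).
Hypothesis AZ : forall u c, A u -> O0 c -> A (sc u c).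
Hypothesis B0 : B 0.
Hypothesis BA : B `<=` A.
Hypothesis BD : forall u w, B u -> B w -> B (u + w).
Hypothesis BZ : forall u c, B u -> O0 c -> B (sc u c).
Hypothesis AI : forall u c, A u -> I0 c -> B (sc u c).
Hypothesis fin : exists s : seq U, forall u, A u -> exists2 y, y \in s & B (u - y).

Let sc0 u : sc u 0 = 0.
Proof. by have := scDr u 0 0; rewrite addr0 -{1}[sc u 0]addr0 => /addrI <-. Qed.
Let scN u x : sc u (- x) = - sc u x.
Proof. by apply/eqP; rewrite -addr_eq0 -scDr addNr sc0. Qed.
Let sc0l x : sc 0 x = 0.
Proof. by have := scDl 0 0 x; rewrite addr0 -{1}[sc 0 x]addr0 => /addrI <-. Qed.
Let scNl u x : sc (- u) x = - sc u x.
Proof. by apply/eqP; rewrite -addr_eq0 -scDl addNr sc0l. Qed.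
Let sc_sum I (r : seq I) (P : pred I) (E : I -> U) x :
  sc (\sum_(i <- r | P i) E i) x = \sum_(i <- r | P i) sc (E i) x.
Proof. by elim/big_rec2: _ => [|i u w _ <-]. Qed.
Let ON1 : O0 (-1). Proof. by apply: fixed_ringN; apply: fixed_ring1. Qed.
Let AN u : A u -> A (- u).
Proof. by move=> hu; rewrite -[u]sc1 -scN; apply: AZ. Qed.
Let BN u : B u -> B (- u).
Proof. by move=> hu; rewrite -[u]sc1 -scN; apply: BZ. Qed.
Let BB u w : B u -> B w -> B (u - w).
Proof. by move=> hu hw; apply: BD => //; apply: BN. Qed.

(* A minimal spanning family of A modulo B is a basis over the residue field. *)
Lemma finite_quotient_coordinates : exists n (rho : U -> 'cV[bk b]_n),
  [/\ forall u w, A u -> A w -> rho (u + w) = rho u + rho w,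
      forall u c, A u -> O0 c -> rho (sc u c) = bF b c *: rho u,
      forall u, A u -> (rho u = 0 <-> B u) &
      forall w, exists2 u, A u & rho u = w].
Proof.
pose spans N (g : 'I_N -> U) := (forall i, A (g i)) /\ forall u, A u ->
  exists2 c : 'I_N -> F, forall i, O0 (c i) & B (u - \sum_i sc (g i) (c i)).
have exP : exists N, `[< exists g, @spans N g >].
  have [s hs] := fin; exists (size s); apply/asboolP.
  exists (fun i => if pselect (A s`_i) then s`_i else 0); split=> [i|u Au].
    by case: pselect.
  have [y ys By] := hs u Au; have iy : (index y s < size s)%N by rewrite index_mem.
  exists (fun i => if i == Ordinal iy then 1 else 0).
    by move=> i; case: ifP => _; [exact: fixed_ring1|exact: fixed_ring0].
  rewrite (bigD1 (Ordinal iy)) //= eqxx sc1 big1 => [|i /negPf ->]; last by rewrite sc0.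
  rewrite addr0 nth_index //; case: pselect => // nAy; case: nAy.
  have -> : y = u - (u - y) by rewrite opprB addrC subrK.
  by apply: AD => //; apply: AN; apply: BA.
have [N /asboolP[g [gA gspan]] Nmin] := ex_minnP exP.
have indep c : (forall i, O0 (c i)) -> B (\sum_i sc (g i) (c i)) -> forall i, bF b (c i) = 0.
  move=> hc hB i0; apply/eqP; apply: contraT => ci0.
  (* With this lift of $-1/c_{i_0}$, adding a suitable multiple of the relation removes the
     generator [i0] up to a coefficient in the maximal ideal, against minimality of [N]. *)
  have [c' hc' c'E] := @bF_onto _ _ _ X b (- (bF b (c i0))^-1).
  case: N g gA gspan Nmin c hc hB i0 ci0 c'E => [|N] g gA gspan Nmin c hc hB i0 ci0 c'E.
    by case: i0 ci0 c'E.
  suff /Nmin : `[< exists g, @spans N g >] by rewrite ltnn.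
  apply/asboolP; exists (fun i => g (lift i0 i)); split=> [i|u Au]; first exact: gA.
  have [e he hu] := gspan _ Au.
  exists (fun i => e (lift i0 i) + c (lift i0 i) * (c' * e i0)).
    by move=> i; apply: fixed_ringD => //; apply: fixed_ringM => //; apply: fixed_ringM.
  have hB' : B (sc (\sum_i sc (g i) (c i)) (c' * e i0)).
    by apply: BZ => //; apply: fixed_ringM.
  have hI : I0 (c i0 * c' + 1).
    have h1 := fixed_ringM (hc i0) hc'.
    apply: (bF_eq0 b (fixed_ringD h1 (fixed_ring1 X))).1.
    by rewrite bFD ?bFM ?bF1 ?c'E ?mulrN ?divff ?addNr //; exact: fixed_ring1.
  have hg : B (sc (g i0) ((c i0 * c' + 1) * e i0)) by rewrite -scA; apply: BZ => //; apply: AI.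
  have := BD (BB hu hB') hg; congr B; rewrite sc_sum.
  rewrite !(bigD1_ord i0) //=; under [in RHS]eq_bigr => i _ do rewrite scDr.
  rewrite big_split /=; under [X in _ - (_ + X) + _]eq_bigr => i _ do rewrite scA.
  rewrite mulrDl mul1r scDr scA -mulrA.
  set G := sc (g i0) (e i0); set H := sc (g i0) (c i0 * _).
  set S1 := \sum_i sc _ (e _); set S2 := \sum_i sc _ _.
  have e1 : - (H + S2) + (H + G) = G - S2 by rewrite addrC (addrC H G) opprD addrA addrK.
  by rewrite -!addrA; congr (u + _); rewrite e1 opprD addrACA addNr add0r -opprD.
have /choice[cf hcf] u : exists c : 'I_N -> F, A u ->
    (forall i, O0 (c i)) /\ B (u - \sum_i sc (g i) (c i)).
  have [Au|nA] := pselect (A u); last by exists (fun=> 0).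
  by have [c hc hB] := gspan u Au; exists c.
pose rho u : 'cV[bk b]_N := \col_i bF b (cf u i).
have rhoE u c : A u -> (forall i, O0 (c i)) -> B (u - \sum_i sc (g i) (c i)) ->
    rho u = \col_i bF b (c i).
  move=> Au hc hB; have [hcu hBu] := hcf u Au; apply/matrixP => i j; rewrite !mxE.
  apply/eqP; rewrite -subr_eq0 -bFB //; apply/eqP.
  apply: (indep (fun i => cf u i - c i)) => [t|].
    by apply: fixed_ringD => //; apply: fixed_ringN.
  have := BB hB hBu; congr B; rewrite opprB addrC addrA subrK -sumrB.
  by apply: eq_bigr => t _; rewrite scDr scN.
exists N, rho; split.
- move=> u w Au Aw; have [hu hBu] := hcf u Au; have [hw hBw] := hcf w Aw.
  rewrite (rhoE (u + w) (fun i => cf u i + cf w i)).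
  + by apply/matrixP => i j; rewrite !mxE bFD.
  + exact: AD.
  + by move=> i; apply: fixed_ringD.
  + have := BD hBu hBw; congr B; rewrite addrACA -opprD -big_split; congr (_ - _).
    by apply: eq_bigr => i _; rewrite scDr.
- move=> u c Au hc; have [hu hBu] := hcf u Au.
  rewrite (rhoE (sc u c) (fun i => cf u i * c)).
  + by apply/matrixP => i j; rewrite !mxE bFM // mulrC.
  + exact: AZ.
  + by move=> i; apply: fixed_ringM.
  + have := BZ hBu hc; congr B; rewrite scDl scNl sc_sum.
    by congr (_ - _); apply: eq_bigr => i _; rewrite scA.
- move=> u Au; have [hu hBu] := hcf u Au; split=> [r0|Bu].
    rewrite -(subrK (\sum_i sc (g i) (cf u i)) u); apply: BD => //.
    elim/big_ind: _ => // i _; apply: AI; first exact: gA.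
    by apply: (bF_eq0 b (hu i)).1; move/matrixP/(_ i 0): r0; rewrite !mxE.
  rewrite (rhoE u (fun=> 0)) //.
  + by apply/matrixP => i j; rewrite !mxE bF0.
  + by move=> i; apply: fixed_ring0.
  + by rewrite big1 ?subr0.
- move=> w; have /choice[c hc] i : exists c, O0 c /\ bF b c = w i 0.
    by have [c h1 h2] := @bF_onto _ _ _ X b (w i 0); exists c.
  have Au : A (\sum_i sc (g i) (c i)).
    by elim/big_ind: _ => // i _; apply: AZ => //; case: (hc i).
  exists (\sum_i sc (g i) (c i)) => //.
  rewrite (rhoE _ c) //.
  + by apply/matrixP => i j; rewrite !mxE ord1; case: (hc i).
  + by move=> i; case: (hc i).
  + by rewrite subrr.
Qed.
End FiniteQuotient.

(** * Existence of models *)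

Section ChainModelExistence.
Variables (F : fieldType) (D : falgType F) (V : vectType D^c).
Variable X : hermitian_datum V.
Local Notation O0 := (fixed_val_ring X).
Local Notation vF := (valF X).
Local Notation vD := (valD X).
Let nD := valD_valuation X.
Variable b : residue_base X.
Variable L : int -> set V.
Hypothesis sdL : sd_chain X L.

(** Write the coordinates of [v] over $o_F$ through generators of $o_D$, and replace each by one of
    finitely many representatives modulo $\mathfrak p_F$. *)
Lemma chain_finite_quotient m : exists s : seq V, forall v, L m v ->
  exists2 y, y \in s & L (m + 1) (v - y).
Proof.
have [_ _ [sF hsF]] := valF_local X.
have [n [e [LE _]]] := chain_full sdL m.
have [t [om [hom homP]]] := val_ring_fg X.
have he i : L m (e i).
  rewrite LE; exists (fun j => (j == i)%:R) => [j|].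
    by case: (j == i); [apply: (val_ge1 nD)|left].
  by rewrite (bigD1 i) //= eqxx rscale1 big1 ?addr0 // => j /negPf ->; rewrite rscale0r.
pose y (f : {ffun 'I_n * 'I_t -> 'I_(size sF)}) :=
  \sum_l rscale (e l) (\sum_k sF`_(f (l, k)) *: om k).
exists [seq y f | f <- enum {: {ffun 'I_n * 'I_t -> 'I_(size sF)}}] => v.
rewrite {1}LE => -[c hc vE].
have /choice[cl hcl] l : exists c' : 'I_t -> F, (forall k, val_ge vF 0 (c' k)) /\
    c l = \sum_k c' k *: om k by have [c' h1 h2] := homP _ (hc l); exists c'.
have /choice[fi hfi] (lk : 'I_n * 'I_t) : exists i : 'I_(size sF),
    val_ge vF 1 (cl lk.1 lk.2 - sF`_i).
  have [z zs hz] := hsF _ ((hcl lk.1).1 lk.2).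
  have iz : (index z sF < size sF)%N by rewrite index_mem.
  by exists (Ordinal iz); rewrite nth_index.
exists (y [ffun lk => fi lk]); first by apply: map_f; rewrite mem_enum.
rewrite vE /y -sumrB; apply: (submodule_sum _ (chain_sub sdL _)) => l _.
rewrite -rscaleBr (hcl l).2 -sumrB.
apply: (@chain_scale_le _ _ _ _ _ sdL m 1) => //; last by lia.
apply: (val_ge_sum nD) => k _; rewrite -scalerBl -mulr_algl ffunE.
apply: (val_geMW nD (m := 1) (n := 0)) => //.
by apply: val_ge_alg => //; apply: (hfi (l, k)).
Qed.

Let L0 m : L m 0. Proof. by case: (chain_sub sdL m). Qed.
Let LDh m v w : L m v -> L m w -> L m (v + w).
Proof. by case: (chain_sub sdL m) => _ + _; apply. Qed.
Let LZ m v c : L m v -> O0 c -> L m (rscale v c%:A).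
Proof.
move=> hv hc; case: (chain_sub sdL m) => _ _ sZ; apply: sZ => //.
exact: fixed_ring_int.
Qed.

Lemma chain_model_ex : exists cm : chain_model b L, True.
Proof.
(* The four graded pieces are treated at once, as the quotient of the product [A] of the $L_i$ by
   the product [B] of the $L_{i+1}$. *)
pose U := {ffun 'I_4 -> V}.
pose sc (u : U) (c : F) : U := [ffun i => rscale (u i) c%:A].
pose A : set U := [set u | forall i : 'I_4, L i%:Z (u i)].
pose B : set U := [set u | forall i : 'I_4, L (i%:Z + 1) (u i)].
have BA : B `<=` A by move=> u hu i; apply: (chain_le sdL _ (hu i)); lia.
have fin : exists s : seq U, forall u, A u -> exists2 y, y \in s & B (u - y).
  have /choice[s hs] (i : 'I_4) := chain_finite_quotient i%:Z.
  pose M := (\max_i size (s i)).+1.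
  pose y (f : {ffun 'I_4 -> 'I_M}) : U := [ffun i => (s i)`_(f i)].
  exists [seq y f | f <- enum {: {ffun 'I_4 -> 'I_M}}] => u Au.
  have /choice[f hf] (i : 'I_4) : exists j : 'I_M, L (i%:Z + 1) (u i - (s i)`_j).
    have [z zs hz] := hs i _ (Au i).
    have iy : (index z (s i) < M)%N.
      by rewrite /M ltnS (leq_trans (index_size _ _)) // (@leq_bigmax _ (fun i => size (s i))).
    by exists (Ordinal iy); rewrite nth_index.
  exists (y [ffun i => f i]); first by apply: map_f; rewrite mem_enum.
  by move=> i; rewrite !ffunE; apply: hf.
have [|||||||||||n [rho [rhoD rhoZ rho0 rho_onto]]] :=
  @finite_quotient_coordinates _ _ _ X b U sc A B _ _ _ _ _ _ _ _ BA _ _ _ fin.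
- by move=> u; apply/ffunP => i; rewrite ffunE scale1r rscale1.
- by move=> u w x; apply/ffunP => i; rewrite !ffunE rscaleDl.
- by move=> u x y; apply/ffunP => i; rewrite !ffunE scalerDl rscaleDr.
- by move=> u x y; apply/ffunP => i; rewrite !ffunE rscaleA algM.
- by move=> i; rewrite ffunE.
- by move=> u w hu hw i; rewrite ffunE; apply: LDh.
- by move=> u c hu hc i; rewrite ffunE; apply: LZ.
- by move=> i; rewrite ffunE.
- by move=> u w hu hw i; rewrite ffunE; apply: LDh.
- by move=> u c hu hc i; rewrite ffunE; apply: LZ.
- move=> u c hu hc i; rewrite ffunE; apply: (@chain_scale_le _ _ _ _ _ sdL i%:Z 1) => //; last by lia.
  exact: fixed_ideal_val.
pose single (r : int) (v : V) : U := [ffun i : 'I_4 => if i%:Z == r then v else 0].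
(* Indices outside the period $0\le m<4$ are brought back to it by a power of the uniformizer. *)
pose red (m : int) (v : V) := rscale v (unif X ^ (- (m %/ 4)%Z)).
pose cV (m : int) v := rho (single (m %% 4)%Z (red m v)).
have redL m n' v : L (m + n') v -> L ((m %% 4)%Z + n') (red m v).
  move=> /(chain_shift sdL _ _ (- (m %/ 4)%Z)).1.
  by rewrite (_ : m + n' + 4 * - (m %/ 4)%Z = (m %% 4)%Z + n') //; lia.
have redL0 m v : L m v -> L (m %% 4)%Z (red m v).
  by have := redL m 0 v; rewrite !addr0.
have redLV m n' v : L ((m %% 4)%Z + n') (red m v) -> L (m + n') v.
  move=> /(chain_shift sdL _ _ (m %/ 4)%Z).1; rewrite rscaleA unifzNK rscale1.
  by rewrite (_ : (m %% 4)%Z + n' + 4 * (m %/ 4)%Z = m + n') //; lia.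
have singleA r v : L r v -> A (single r v).
  by move=> hv i; rewrite ffunE; case: eqP => [->|].
have singleB r v : 0 <= r < 4 -> (B (single r v) <-> L (r + 1) v).
  move=> hr; split=> [h|hv i].
    have ir : (`|r| < 4)%N by lia.
    have := h (Ordinal ir); rewrite ffunE /=.
    by have -> : (`|r|%N : int) = r by [lia]; rewrite eqxx.
  by rewrite ffunE; case: eqP => [->|].
have base (i : 'I_4) v : cV i%:Z v = rho (single i%:Z v).
  have := ltn_ord i => hi; rewrite /cV /red.
  have -> : (i%:Z %% 4)%Z = i%:Z by lia.
  by have -> : (i%:Z %/ 4)%Z = 0 by [lia]; rewrite oppr0 expr0z rscale1.
have sum_single (v : 'I_4 -> V) : \sum_(i < 4) single i%:Z (v i) = [ffun i => v i].
  apply/ffunP => i; rewrite sum_ffunE ffunE (bigD1 i) //= ffunE eqxx big1 ?addr0 // => j ji.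
  by rewrite ffunE; case: eqP => // e; move: ji; rewrite -val_eqE /=; lia.
have AD u w : A u -> A w -> A (u + w).
  by move=> hu hw i; rewrite ffunE; apply: LDh.
have A0 : A 0 by move=> i; rewrite ffunE.
have rho00 : rho 0 = 0 by apply/(rho0 0 A0) => i; rewrite ffunE.
have rho_sum (v : 'I_4 -> V) : (forall i : 'I_4, L i%:Z (v i)) ->
    \sum_(i < 4) cV i%:Z (v i) = rho [ffun i => v i].
  move=> hv; rewrite -sum_single.
  suff : A (\sum_(i < 4) single i%:Z (v i)) /\ \sum_(i < 4) cV i%:Z (v i) = rho (\sum_(i < 4) single i%:Z (v i)).
    by case.
  elim/big_rec2: _ => [|i y1 y2 _ [h1 h2]]; first by rewrite rho00.
  have hs : A (single i%:Z (v i)) by apply: singleA.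
  by split; [apply: AD|rewrite rhoD // h2 base].
have cVadd m v w : L m v -> L m w -> cV m (v + w) = cV m v + cV m w.
  move=> hv hw; rewrite /cV -rhoD; try by apply: singleA; apply: redL0.
  congr rho; apply/ffunP => i; rewrite !ffunE /red rscaleDl; case: ifP => //.
  by rewrite addr0.
have cVscale m v c : L m v -> O0 c -> cV m (rscale v c%:A) = bF b c *: cV m v.
  move=> hv hc; rewrite /cV -rhoZ //; last by apply: singleA; apply: redL0.
  congr rho; apply/ffunP => i; rewrite !ffunE /red; case: ifP => _; last by rewrite rscale0l.
  by rewrite !rscaleA mulr_algl mulr_algr.
have cVker m v : L m v -> (cV m v = 0 <-> L (m + 1) v).
  move=> hv; rewrite /cV rho0; last by apply: singleA; apply: redL0.
  rewrite singleB; last by lia.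
  by split; [apply: redLV|apply: redL].
have cVspan w : exists2 v : 'I_4 -> V, forall i : 'I_4, L i%:Z (v i) &
    w = \sum_(i < 4) cV i%:Z (v i).
  have [u Au <-] := rho_onto w; exists u => //; rewrite rho_sum //; congr rho.
  by apply/ffunP => i; rewrite ffunE.
have cVdirect (v : 'I_4 -> V) : (forall i : 'I_4, L i%:Z (v i)) ->
    \sum_(i < 4) cV i%:Z (v i) = 0 -> forall i : 'I_4, cV i%:Z (v i) = 0.
  move=> hv; rewrite rho_sum // => /(rho0 _ _).1 h i.
  apply/cVker => //; have := h _ i; rewrite ffunE; apply.
  by move=> j; rewrite ffunE.
by exists (ChainModel cVadd cVscale cVker cVspan cVdirect).
Qed.

End ChainModelExistence.

(** * Independence of the chosen model *)

Section Transport.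

(** The change of basis between two models is rectangular in its type; mutual inverses force the two
    sizes to agree. *)
Lemma det_conj (K : fieldType) n m (C : 'M[K]_(m, n)) (C' : 'M[K]_(n, m)) (x : 'M[K]_n) :
  C *m C' = 1%:M -> C' *m C = 1%:M -> \det (C *m x *m C') = \det x.
Proof.
move=> h1 h2; have nm : n = m.
  apply/eqP; rewrite eqn_leq; apply/andP; split.
    have := mxrankM_maxr C' C; rewrite h2 mxrank1 => /leq_trans; apply.
    exact: rank_leq_row.
  have := mxrankM_maxr C C'; rewrite h1 mxrank1 => /leq_trans; apply.
  exact: rank_leq_row.
move: C C' h1 h2; rewrite -nm => C C' h1 h2.
by rewrite !det_mulmx mulrAC -det_mulmx h1 det1 mul1r.
Qed.

Lemma component_map (K : fieldType) n m (G1 : set (zariski K n)) (G2 : set (zariski K m))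
    (f : 'M[K]_n -> 'M[K]_m) :
  mregular f -> f 1%:M = 1%:M -> G1 (1%:M : 'M[K]_n) -> (forall x, G1 x -> G2 (f x)) ->
  forall x, connected_component G1 (1%:M : 'M[K]_n) x ->
    connected_component G2 (1%:M : 'M[K]_m) (f x).
Proof.
move=> hf f1 G11 G12 x hx.
have := @connected_component_max _ G2
  ((f : zariski K n -> zariski K m) @` connected_component G1 (1%:M : 'M[K]_n)) (1%:M : 'M[K]_m).
apply; last by exists x.
- by exists (1%:M : 'M[K]_n) => //; apply: connected_component_refl.
- by move=> _ [y hy <-]; apply: G12; apply: connected_component_sub hy.
- by apply: connected_mregular => //; apply: component_connected.
Qed.

Variables (F : fieldType) (D : falgType F) (V : vectType D^c).
Variable X : hermitian_datum V.
Variable b : residue_base X.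
Variable L : int -> set V.
Hypothesis sdL : sd_chain X L.

Section Group.
Variable cm : chain_model b L.
Local Notation emb A := (map_mx (bemb b) A).
Local Notation E := (cE sdL cm).
Local Notation S := (cS sdL cm).

Lemma chain_algebra_E a : chain_filt L 0 a -> chain_algebra sdL cm (emb (E a)).
Proof.
by move=> ha; exists 1%N, (fun=> 1), (fun=> a); rewrite big_ord1 scale1r.
Qed.

Lemma chain_algebra1 : chain_algebra sdL cm 1%:M.
Proof.
by rewrite -(map_mx1 (bemb b)) -(cE_id sdL cm); apply: chain_algebra_E; apply: (@chain_filt_id _ _ _ L).
Qed.

Lemma cS1 : S 1%:M = 1%:M.
Proof.
rewrite -(map_mx1 (bemb b)) -(cE_id sdL cm) (cS_adjoint sdL cm _ (@adjoint_id _ _ _ X)) //.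
exact: (@chain_filt_id _ _ _ L).
Qed.

Lemma chain_group1 : chain_group sdL cm (1%:M : 'M_(cn cm)).
Proof. by split; [exact: chain_algebra1|rewrite cS1 mulmx1|rewrite det1]. Qed.

(* Elements of A (x) K come with their image under sigma_h (x) K. *)
Lemma chain_algebraP x : chain_algebra sdL cm x ->
  exists l (c : 'I_l -> bK b) (a a' : 'I_l -> 'End(V)),
  [/\ forall i, chain_filt L 0 (a i), forall i, chain_filt L 0 (a' i),
      forall i, adjoint X (a i) (a' i), x = \sum_i c i *: emb (E (a i)) &
      S x = \sum_i c i *: emb (E (a' i))].
Proof.
move=> [l [c [a [ha ->]]]]; have /choice[a' ha'] i := adjoint_ex X (a i).
exists l, c, a, a'; split=> // [i|]; first exact: (chain_filt_adjoint sdL (ha i)).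
by rewrite linear_sum; apply: eq_bigr => i _; rewrite linearZ /= (cS_adjoint sdL cm (ha i) (ha' i)).
Qed.

Lemma chain_algebra_sum l (c : 'I_l -> bK b) (x : 'I_l -> 'M_(cn cm)) :
  (forall i, chain_algebra sdL cm (x i)) -> chain_algebra sdL cm (\sum_i c i *: x i).
Proof.
have alg0 : chain_algebra sdL cm 0.
  by exists 0%N, (fun=> 0), (fun=> 0); rewrite big_ord0; split=> // -[].
have algD y z : chain_algebra sdL cm y -> chain_algebra sdL cm z -> chain_algebra sdL cm (y + z).
  move=> [n1 [c1 [a1 [h1 ->]]]] [n2 [c2 [a2 [h2 ->]]]].
  exists (n1 + n2)%N, (fun i => match split i with inl j => c1 j | inr j => c2 j end),
    (fun i => match split i with inl j => a1 j | inr j => a2 j end); split.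
    by move=> i; case: (split i).
  rewrite big_split_ord /=; congr (_ + _); apply: eq_bigr => i _.
    by rewrite (unsplitK (inl i)).
  by rewrite (unsplitK (inr i)).
have algZ t y : chain_algebra sdL cm y -> chain_algebra sdL cm (t *: y).
  move=> [n1 [c1 [a1 [h1 ->]]]]; exists n1, (fun i => t * c1 i), a1; split=> //.
  by rewrite scaler_sumr; apply: eq_bigr => i _; rewrite scalerA.
by move=> hx; elim/big_ind: _ => // i _; apply: algZ.
Qed.

Lemma chain_algebraM x y : chain_algebra sdL cm x -> chain_algebra sdL cm y ->
  chain_algebra sdL cm (x *m y) /\ S (x *m y) = S y *m S x.
Proof.
move=> /chain_algebraP[l [c [a [a' [ha ha' aa' -> ->]]]]].
move=> /chain_algebraP[l1 [c1 [e [e' [he he' ee' -> ->]]]]].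
have fc s t : chain_filt L 0 s -> chain_filt L 0 t -> chain_filt L 0 (s \o t)%VF.
  by move=> hs ht; have := chain_filt_comp hs ht; rewrite addr0.
split.
  rewrite mulmx_suml; under eq_bigr => i _ do rewrite -scalemxAl.
  apply: chain_algebra_sum => i; rewrite mulmx_sumr.
  under eq_bigr => j _ do rewrite -scalemxAr.
  apply: chain_algebra_sum => j; rewrite -map_mxM -cEM //.
  by apply: chain_algebra_E; apply: fc.
rewrite !mulmx_suml linear_sum /=.
under [RHS]eq_bigr => j _ do rewrite mulmx_sumr.
rewrite exchange_big /=; apply: eq_bigr => i _.
rewrite mulmx_sumr linear_sum /=; apply: eq_bigr => j _.
rewrite -!scalemxAl -!scalemxAr -!map_mxM -!cEM // !linearZ /= scalerA.
rewrite (cS_adjoint sdL cm (fc _ _ (ha i) (he j)) (adjoint_comp (aa' i) (ee' j))).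
by rewrite scalerA mulrC.
Qed.

Lemma chain_algebra_S x : chain_algebra sdL cm x -> chain_algebra sdL cm (S x).
Proof.
move=> /chain_algebraP[l [c [a [a' [ha ha' aa' _ ->]]]]].
by apply: chain_algebra_sum => i; apply: chain_algebra_E.
Qed.

End Group.

(** Two models differ by a change of basis [C] over the residue field, and conjugation by [C] is a
    regular map carrying one group into the other and fixing 1. *)
Lemma chain_group0_transport (cm1 cm2 : chain_model b L) g : chain_filt L 0 g ->
  chain_group0 sdL cm1 (map_mx (bemb b) (cE sdL cm1 g)) ->
  chain_group0 sdL cm2 (map_mx (bemb b) (cE sdL cm2 g)).
Proof.
have mapC (cm cm' : chain_model b L) : exists C : 'M[bk b]_(cn cm', cn cm),
    forall m v, 0 <= m < 4 -> L m v -> C *m cV cm m v = cV cm' m v.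
  apply: (chain_model_map sdL) => [m v w|m v c|m v] *.
  - exact: cV_add.
  - exact: cV_scale.
  - apply/cV_ker => //; apply: (chain_le sdL (n := m + 1)) => //; lia.
have [C hC] := mapC cm1 cm2; have [C' hC'] := mapC cm2 cm1.
have CC' : C *m C' = 1%:M.
  by apply: (chain_model_ext (cm := cm2)) => m v hm hv; rewrite -mulmxA hC' // hC // mul1mx.
have C'C : C' *m C = 1%:M.
  by apply: (chain_model_ext (cm := cm1)) => m v hm hv; rewrite -mulmxA hC // hC' // mul1mx.
have EC a : chain_filt L 0 a -> cE sdL cm2 a = C *m cE sdL cm1 a *m C'.
  move=> ha; apply: cE_uniq => // m v hm hv.
  have av : L m (a v) by have := ha _ _ hv; rewrite addr0.
  by rewrite -!mulmxA hC' // cE_action // hC.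
pose CK := map_mx (bemb b) C; pose CK' := map_mx (bemb b) C'.
have CKK' : CK *m CK' = 1%:M by rewrite -map_mxM CC' map_mx1.
have CK'K : CK' *m CK = 1%:M by rewrite -map_mxM C'C map_mx1.
move=> hg; rewrite EC // !map_mxM -/CK -/CK'.
apply: (component_map (f := fun x => CK *m x *m CK')).
- by do !apply: mregularM; try exact: mregular_const; exact: mregular_id.
- by rewrite mulmx1.
- exact: chain_group1.
move=> x [Ax xS dx].
have [l [c [a [a' [ha ha' aa' xE SxE]]]]] := chain_algebraP Ax.
have fE (y : 'I_l -> 'End(V)) : (forall i, chain_filt L 0 (y i)) ->
    CK *m (\sum_i c i *: map_mx (bemb b) (cE sdL cm1 (y i))) *m CK' =
    \sum_i c i *: map_mx (bemb b) (cE sdL cm2 (y i)).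
  move=> hy; rewrite mulmx_sumr mulmx_suml; apply: eq_bigr => i _.
  by rewrite -scalemxAr -scalemxAl EC // !map_mxM.
have SE : cS sdL cm2 (CK *m x *m CK') = CK *m cS sdL cm1 x *m CK'.
  rewrite SxE xE !fE // linear_sum; apply: eq_bigr => i _.
  by rewrite linearZ /= (cS_adjoint sdL cm2 (ha i) (aa' i)).
split.
- by exists l, c, a; split=> //; rewrite xE fE.
- rewrite SE -!mulmxA (mulmxA CK') CK'K mul1mx (mulmxA x) xS mul1mx.
  exact: CKK'.
- by move=> o; rewrite det_conj // dx.
Qed.

End Transport.

(** * Comparison of residual models with chain models *)

Local Notation idc M := (@identity_component _ _ _ _ _ _ M).
Local Notation geomg M := (@geometric_group _ _ _ _ _ _ M).

Section ResidualModels.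
Variables (R : realType) (F : fieldType) (D : falgType F) (V : vectType D^c).
Variable X : hermitian_datum V.
Local Notation O0 := (fixed_val_ring X).
Local Notation d := ((degD X)%:R : R).
Variable L : int -> set V.
Hypothesis sdL : sd_chain X L.
Local Notation G := (chain_fun X L : R -> set V).

Let d4_gt0 : 0 < 4 * d.
Proof. by rewrite mulr_gt0 // degDR_gt0. Qed.
Let d4_neq0 : 4 * d != 0. Proof. by rewrite gt_eqF. Qed.
Let d4_divK (y : R) : 4 * d * (y / (4 * d)) = y.
Proof. by rewrite mulrC divfK. Qed.
Let tau (r : int) : R := r%:~R / (4 * d).

Let tau_inj : injective tau.
Proof.
move=> r s /(congr1 (fun x => x * (4 * d))); rewrite /tau !divfK //.
by move/eqP; rewrite eqr_int => /eqP.
Qed.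

Let tau_range (r : int) : 0 <= r < 4 -> 0 <= tau r /\ tau r < d^-1.
Proof.
move=> /andP[r0 r4]; split; first by rewrite /tau divr_ge0 ?ler0z // ltW.
rewrite /tau ltr_pdivrMr // mulrA mulrC.
have -> : d * (d^-1 * 4) = 4 by rewrite mulrA divff ?mul1r // gt_eqF // degDR_gt0.
by rewrite -[4]/(4%:~R) ltr_int.
Qed.

Let range_tau (t : R) : 0 <= t -> t < d^-1 -> 4 * d * t \is a Num.int ->
  exists2 r : int, 0 <= r < 4 & t = tau r.
Proof.
move=> t0 t1 /intrP[r rE]; have tE : t = tau r by rewrite /tau -rE [RHS]mulrC mulKf.
exists r => //; rewrite -(ler_int R) -(ltr_int R) -rE mulr_ge0 //=; last exact: ltW.
rewrite -(ltr_pM2l d4_gt0) in t1; apply: lt_le_trans t1 _.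
by rewrite -mulrA divff ?mulr1 // gt_eqF // degDR_gt0.
Qed.

Let nonint_right t : 4 * d * t \isn't a Num.int -> right_part G t = G t.
Proof.
by move=> ht; rewrite (chain_fun_right sdL) /chain_fun ceil_floor ht.
Qed.

Let L0 m : L m 0. Proof. by case: (chain_sub sdL m). Qed.
Let LDh m v w : L m v -> L m w -> L m (v + w).
Proof. by case: (chain_sub sdL m) => _ + _; apply. Qed.

Section ToResidual.
Variables (b : residue_base X) (cm : chain_model b L).

(** When $4dt$ is not an integer, [t] is not a jump and the graded piece vanishes, hence the value
    0. *)
Let redV (t : R) (v : V) : 'cV[bk b]_(cn cm) :=
  if 4 * d * t \is a Num.int then cV cm (Num.ceil (4 * d * t)) v else 0.

Let redV_tau r v : redV (tau r) v = cV cm r v.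
Proof. by rewrite /redV /tau d4_divK intr_int intrKceil. Qed.

Let redV_sum n (t : 'I_n -> R) (v : 'I_n -> V) :
  (forall i, [/\ 0 <= t i, t i < d^-1 & G (t i) (v i)]) ->
  (forall r : 'I_4, L r%:Z (\sum_i if t i == tau r%:Z then v i else 0)) /\
  \sum_i redV (t i) (v i) =
    \sum_(r < 4) cV cm r%:Z (\sum_i if t i == tau r%:Z then v i else 0).
Proof.
move=> ht.
have hL (r : 'I_4) i : L r%:Z (if t i == tau r%:Z then v i else 0).
  case: eqP => // e; have [_ _] := ht i.
  by rewrite e /tau chain_fun_int.
split; first by move=> r; apply: (submodule_sum _ (chain_sub sdL _)).
have -> : \sum_(r < 4) cV cm r%:Z (\sum_i if t i == tau r%:Z then v i else 0) =
    \sum_(r < 4) \sum_i cV cm r%:Z (if t i == tau r%:Z then v i else 0).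
  apply: eq_bigr => r _.
  suff : L r%:Z (\sum_i (if t i == tau r%:Z then v i else 0)) /\
    cV cm r%:Z (\sum_i (if t i == tau r%:Z then v i else 0)) =
    \sum_i cV cm r%:Z (if t i == tau r%:Z then v i else 0) by case.
  elim/big_rec2: _ => [|i y1 y2 _ [h1 h2]]; first by rewrite (cV0 sdL).
  by split; [apply: LDh|rewrite cV_add // -h2].
rewrite exchange_big /=; apply: eq_bigr => i _; have [t0 t1 tv] := ht i.
case ti : (4 * d * t i \is a Num.int); last first.
  rewrite /redV ti big1 // => r _; case: eqP => [e|_]; last exact: cV0.
  by move: ti; rewrite e /tau d4_divK intr_int.
have [r hr e] := range_tau t0 t1 ti.
have ir : (`|r| < 4)%N by lia.
have irE : (`|r|%N : int) = r by lia.
rewrite (bigD1 (Ordinal ir)) //= irE e eqxx redV_tau big1 ?addr0 // => s sr.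
case: eqP => [/tau_inj es|_]; last exact: cV0.
by move: sr; rewrite -val_eqE /= -es; case/eqP; lia.
Qed.

Lemma chain_model_residual g : chain_group0 sdL cm (map_mx (bemb b) (cE sdL cm g)) ->
  exists M : residual_model X G, idc M (map_mx (resemb M) (redE M g)).
Proof.
move=> hg.
have hadd t v w : G t v -> G t w -> redV t (v + w) = redV t v + redV t w.
  by rewrite /redV => hv hw; case: ifP => _; rewrite ?addr0 // cV_add.
have hscale t v c : G t v -> O0 c -> redV t (rscale v c%:A) = bF b c *: redV t v.
  by rewrite /redV => hv hc; case: ifP => _; rewrite ?scaler0 // cV_scale.
have hker t v : G t v -> (redV t v = 0 <-> right_part G t v).
  move=> hv; rewrite /redV; case: ifP => ht; last first.
    by rewrite nonint_right ?ht.
  rewrite cV_ker //; have /intrP[r rE] := ht.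
  by rewrite (chain_fun_right sdL) rE intrKceil intrKfloor.
have hspan w : exists n (t : 'I_n -> R) (v : 'I_n -> V),
    (forall i, [/\ 0 <= t i, t i < d^-1 & G (t i) (v i)]) /\ w = \sum_i redV (t i) (v i).
  have [v hv ->] := @cV_span _ _ _ _ _ _ cm w.
  exists 4%N, (fun i => tau i%:Z), v; split.
    move=> i; have [|h1 h2] := tau_range (r := i%:Z); first by have := ltn_ord i; lia.
    by split=> //; rewrite /tau chain_fun_int.
  by apply: eq_bigr => i _; rewrite redV_tau.
have hdirect n (t : 'I_n -> R) (v : 'I_n -> V) : injective t ->
    (forall i, [/\ 0 <= t i, t i < d^-1 & G (t i) (v i)]) ->
    \sum_i redV (t i) (v i) = 0 -> forall i, redV (t i) (v i) = 0.
  move=> t_inj ht; have [hL ->] := redV_sum ht => /(cV_direct hL) h0 i.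
  have [t0 t1 tv] := ht i.
  case ti : (4 * d * t i \is a Num.int); last by rewrite /redV ti.
  have [r hr e] := range_tau t0 t1 ti.
  have ir : (`|r| < 4)%N by lia.
  have irE : (`|r|%N : int) = r by lia.
  have := h0 (Ordinal ir); rewrite /= irE (bigD1 i) //= e eqxx redV_tau big1 ?addr0 // => j ji.
  by case: eqP => // ej; move: ji; rewrite (t_inj j i) ?eqxx // e.
have haction a t v : filt0 G a -> 0 <= t -> t < d^-1 -> G t v ->
    cE sdL cm a *m redV t v = redV t (a v).
  rewrite filt0_chain_fun => ha t0 t1 tv; rewrite /redV; case: ifP => ti; last by rewrite mulmx0.
  have [r hr e] := range_tau t0 t1 ti.
  have xE : 4 * d * t = r%:~R by rewrite e /tau d4_divK.
  rewrite xE intrKceil cE_action //.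
  by move: tv; rewrite e /tau chain_fun_int.
have hquot : embeds_quotient \1%VF (fun a a' : 'End(V) => (a \o a')%VF) 1%:M mulmx
    (filt0 G) (filt0plus G) (cE sdL cm).
  rewrite filt0_chain_fun (filt0plus_chain_fun _ sdL); split.
  - exact: cE_id.
  - by move=> a a' ha ha'; apply: cED.
  - by move=> a a' ha ha'; apply: cEM.
  - by move=> a ha; apply: cE_eq0.
have hsig a a' : filt0 G a -> adjoint X a a' ->
    cS sdL cm (map_mx (bemb b) (cE sdL cm a)) = map_mx (bemb b) (cE sdL cm a').
  by rewrite filt0_chain_fun; apply: cS_adjoint.
exists (ResidualModel (bF_quotient b) (@bF_onto _ _ _ _ b) (@bK_algebraic _ _ _ _ b)
  hadd hscale hker hspan hdirect haction hquot hsig).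
have -> : idc (ResidualModel (bF_quotient b) (@bF_onto _ _ _ _ b) (@bK_algebraic _ _ _ _ b)
  hadd hscale hker hspan hdirect haction hquot hsig) = chain_group0 sdL cm; last exact: hg.
rewrite /identity_component /chain_group0; congr connected_component.
by rewrite /geometric_group /geometric_algebra /= filt0_chain_fun.
Qed.

End ToResidual.

(** Sampling [redV] at the multiples of $1/4d$ loses nothing, because all other graded pieces are
    0. *)
Lemma residual_chain_model (M : residual_model X G) :
  exists (b : residue_base X) (cm : chain_model b L),
  forall g, chain_filt L 0 g -> idc M (map_mx (resemb M) (redE M g)) ->
    chain_group0 sdL cm (map_mx (bemb b) (cE sdL cm g)).
Proof.
pose b := ResidueBase (redF_quotient M) (@redF_onto _ _ _ _ _ _ M) (@resK_algebraic _ _ _ _ _ _ M).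
pose cV (m : int) (v : V) : 'cV[bk b]_(W_dim M) := redV M (tau m) v.
have GL m : G (tau m) = L m by rewrite /tau chain_fun_int.
have hadd m v w : L m v -> L m w -> cV m (v + w) = cV m v + cV m w.
  by rewrite -GL; apply: redV_add.
have hscale m v c : L m v -> O0 c -> cV m (rscale v c%:A) = bF b c *: cV m v.
  by rewrite -GL; apply: redV_scale.
have hker m v : L m v -> (cV m v = 0 <-> L (m + 1) v).
  rewrite -GL => hv; rewrite /cV redV_ker //.
  by rewrite /tau (chain_fun_right_int _ sdL).
have cV00 m : cV m 0 = 0 by apply/hker.
have hspan w : exists2 v : 'I_4 -> V, forall i : 'I_4, L i%:Z (v i) &
    w = \sum_(i < 4) cV i%:Z (v i).
  have [n [t [v [ht ->]]]] := @redV_span _ _ _ _ _ _ M w.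
  have hL (r : 'I_4) i : L r%:Z (if t i == tau r%:Z then v i else 0).
    case: eqP => // e; have [_ _] := ht i.
    by rewrite e GL.
  exists (fun r => \sum_i if t i == tau r%:Z then v i else 0).
    by move=> r; apply: (submodule_sum _ (chain_sub sdL _)).
  have -> : \sum_(r < 4) cV r%:Z (\sum_i if t i == tau r%:Z then v i else 0) =
      \sum_(r < 4) \sum_i cV r%:Z (if t i == tau r%:Z then v i else 0).
    apply: eq_bigr => r _.
    suff : L r%:Z (\sum_i (if t i == tau r%:Z then v i else 0)) /\
      cV r%:Z (\sum_i (if t i == tau r%:Z then v i else 0)) =
      \sum_i cV r%:Z (if t i == tau r%:Z then v i else 0) by case.
    elim/big_rec2: _ => [|i y1 y2 _ [h1 h2]]; first by rewrite cV00.
    by split; [apply: LDh|rewrite hadd // -h2].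
  rewrite exchange_big /=; apply: eq_bigr => i _; have [t0 t1 tv] := ht i.
  case ti : (4 * d * t i \is a Num.int); last first.
    rewrite big1 => [|r _].
      by apply/redV_ker => //; rewrite nonint_right ?ti.
    case: eqP => [e|_] //.
    by move: ti; rewrite e /tau d4_divK intr_int.
  have [r hr e] := range_tau t0 t1 ti.
  have ir : (`|r| < 4)%N by lia.
  have irE : (`|r|%N : int) = r by lia.
  rewrite (bigD1 (Ordinal ir)) //= irE e eqxx big1 ?addr0 // => s sr.
  case: eqP => [/tau_inj es|_] //.
  by move: sr; rewrite -val_eqE /= -es; case/eqP; lia.
have hdirect (v : 'I_4 -> V) : (forall i : 'I_4, L i%:Z (v i)) ->
    \sum_(i < 4) cV i%:Z (v i) = 0 -> forall i : 'I_4, cV i%:Z (v i) = 0.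
  move=> hv; apply: (@redV_direct _ _ _ _ _ _ M 4%N (fun i => tau i%:Z) v).
    by move=> i j /tau_inj e; apply: val_inj => /=; lia.
  move=> i; have [|h1 h2] := tau_range (r := i%:Z); first by have := ltn_ord i; lia.
  by split=> //; rewrite GL.
pose cm := @ChainModel _ _ _ X b L (W_dim M) cV hadd hscale hker hspan hdirect.
have EM a : chain_filt L 0 a -> cE sdL cm a = redE M a.
  move=> ha; apply: cE_uniq => // m v hm hv.
  have [h1 h2] := tau_range hm.
  by rewrite /= /cV redE_action ?GL // filt0_chain_fun.
exists b, cm => g hg; rewrite -EM //.
have sub : geomg M `<=` chain_group sdL cm.
  move=> x [Ax xS dx].
  have hA : chain_algebra sdL cm x.
    move: Ax => [n [c [a [ha ->]]]]; exists n, c, a; rewrite filt0_chain_fun in ha.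
    by split=> //; apply: eq_bigr => i _; rewrite EM.
  split=> //; have [l [c [a [a' [ha ha' aa' xE SxE]]]]] := chain_algebraP hA.
  rewrite -[RHS]xS SxE; congr (_ *m _); rewrite [in RHS]xE linear_sum; apply: eq_bigr => i _.
  rewrite linearZ /= EM // EM // (sigmaK_adjoint M _ (aa' i)) //.
  by rewrite filt0_chain_fun.
move=> hid; apply: (@connected_component_max _ (chain_group sdL cm) (idc M)
  (1%:M : 'M[bK b]_(cn cm)) _ _ _ _ hid).
- apply: connected_component_refl; apply: contrapT => n1.
  (* The component of a point outside the set is empty, so having an element in it forces 1 to lie
     in the group. *)
  have out := @connected_component_out _ (geomg M) (1%:M : 'M_(W_dim M)) n1.
  by move: hid; rewrite /identity_component out.
- by move=> x /connected_component_sub /sub.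
- exact: component_connected.
Qed.

End ResidualModels.

(** * Unipotent elements of the connected stabilizer *)

Section Unipotents.
Variables (F : fieldType) (D : falgType F) (V : vectType D^c).
Variable X : hermitian_datum V.
Local Notation h := (hform X).
Variable L : int -> set V.
Hypothesis sdL : sd_chain X L.

Section Cayley.
Variable x : 'End(V).
Hypothesis x_skew : adjoint X x (- x).
Hypothesis x0 : chain_filt L 0 x.
Hypothesis x3 : chain_filt L 1 (x \o x \o x)%VF.

Let LD m v w : L m v -> L m w -> L m (v + w).
Proof. by case: (chain_sub sdL m) => _ + _; apply. Qed.
Let LB m v w : L m v -> L m w -> L m (v - w).
Proof. exact: (submoduleB (chain_sub sdL m)). Qed.
Let LN m v : L m v -> L m (- v).
Proof. exact: (submoduleN (chain_sub sdL m)). Qed.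
Let xL m v : L m v -> L m (x v). Proof. by move=> /x0; rewrite addr0. Qed.

(** If $v+xv=w$ then $v=w-xw+x^2w-x^3v$, and the last term lies one step deeper in the chain than
    [v]. Iteration gives injectivity of $1+x$ by separatedness, and integrality of its inverse. *)
Lemma one_add_nilpotent_inv : exists u : 'End(V),
  [/\ ((\1 + x) \o u)%VF = \1%VF, (u \o (\1 + x))%VF = \1%VF & chain_filt L 0 u].
Proof.
have expand v w : v + x v = w -> v = w - x w + x (x w) - x (x (x v)).
  by move=> <-; rewrite !lfunD opprD !addrA addrK addrNK addrK.
have step m v w : v + x v = w -> L (m + 1) w -> L m v -> L (m + 1) v.
  move=> /expand e hw hv; rewrite e; apply: LB; last by have := x3 hv; rewrite !comp_lfunE.
  by apply: LD; [apply: LB|]; do ?apply: xL.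
have [u [u1 u2]] : exists u : 'End(V), ((\1 + x) \o u)%VF = \1%VF /\ (u \o (\1 + x))%VF = \1%VF.
  apply: lfun_inv => v; rewrite add_lfunE id_lfunE => v0.
  apply/eqP; apply: contraT => vn; have [n0 hn0] := chain_exhaust sdL 0 v.
  have [n1 hn1] := chain_separated sdL (0 - n0%:Z) vn; case: hn1.
  elim: n1 => [|n IH]; first by rewrite addr0.
  rewrite (_ : 0 - n0%:Z + n.+1%:Z = 0 - n0%:Z + n%:Z + 1); last by lia.
  by apply: (step _ _ _ v0) => //; case: (chain_sub sdL (0 - n0%:Z + n%:Z + 1)).
exists u; split=> // m w hw; rewrite addr0.
have uE : u w + x (u w) = w.
  by have := congr1 (fun f : 'End(V) => f w) u1; rewrite comp_lfunE add_lfunE !id_lfunE.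
have [n0 hn0] := chain_exhaust sdL m (u w).
elim: n0 hn0 => [|n IH] hn; first by rewrite subr0 in hn.
apply: IH; rewrite (_ : m - n%:Z = m - n.+1%:Z + 1); last by lia.
apply: (step _ _ _ uE) => //; apply: (chain_le sdL _ hw); lia.
Qed.

End Cayley.

(** $g=(1-x)(1+x)^{-1}$ is an isometry because the adjoint of $1+x$ is $1-x$. Modulo the radical it
    is the point $s=1$ of the curve $1-2sx+2s^2x^2$, which lies in the geometric group for all
    $s$. *)
Lemma cayley_unipotent (R : realType) (b : residue_base X) (cm : chain_model b L) x :
  adjoint X x (- x) -> chain_filt L 0 x -> chain_filt L 1 (x \o x \o x)%VF ->
  exists g, connected_stabilizer X (chain_fun X L : R -> set V) g /\
    chain_filt L 1 (g - (\1 - (x + x) + ((x \o x) + (x \o x)))%VF).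
Proof.
move=> x_skew x0 x3.
have [u [u1 u2 u0]] := one_add_nilpotent_inv x0 x3.
have y0 : chain_filt L 0 (- x) by apply: (chain_filtN sdL).
have y3 : chain_filt L 1 ((- x) \o (- x) \o (- x))%VF.
  rewrite !(comp_lfunNl, comp_lfunNr) opprK; exact: (chain_filtN sdL).
have [w [w1 w2 w0]] := one_add_nilpotent_inv y0 y3.
have id0 : chain_filt L 0 (\1%VF : 'End(V)) by apply: (@chain_filt_id _ _ _ L).
have fc s t : chain_filt L 0 s -> chain_filt L 0 t -> chain_filt L 0 (s \o t)%VF.
  by move=> hs ht; have := chain_filt_comp hs ht; rewrite addr0.
have px0 : chain_filt L 0 (\1 + x)%VF by apply: (chain_filtD sdL).
have mx0 : chain_filt L 0 (\1 - x)%VF by apply: (chain_filtD sdL).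
pose g := ((\1 - x) \o u)%VF; pose g' := ((\1 + x) \o w)%VF.
have gx : (g \o (\1 + x))%VF = (\1 - x)%VF by rewrite /g -comp_lfunA u2 comp_lfun1r.
have gg' : (g \o g')%VF = \1%VF by rewrite /g' comp_lfunA gx w1.
have g'g : (g' \o g)%VF = \1%VF.
  by rewrite /g' /g -comp_lfunA (comp_lfunA w) w2 comp_lfun1l u1.
have adj : adjoint X (\1 + x)%VF (\1 - x)%VF.
  by apply: adjointD => //; apply: adjoint_id.
have x2_adj : adjoint X (x \o x)%VF (x \o x)%VF.
  by have := adjoint_comp x_skew x_skew; rewrite comp_lfunNl comp_lfunNr opprK.
have iso : Defs.isometry X g.
  move=> v v'; pose a := u v; pose a' := u v'.
  have e z : z = (\1 + x)%VF (u z) by rewrite -comp_lfunE u1 id_lfunE.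
  rewrite {2}(e v) {2}(e v') /g !comp_lfunE -/a -/a'.
  rewrite !add_lfunE !opp_lfunE !id_lfunE !(hDl, hformDr, hNl, hNr).
  by rewrite (x_skew a a') opp_lfunE hNr opprD !opprK !addrA subrK addrK.
have red : Defs.orthogonal X -> reduced_norm_is X g 1.
  move=> [K [i [phi [B [sp Bu _ hB]]]]]; exists K, i, phi; split=> //.
  have [phiD phiM phiH] := sp; rewrite rmorph1.
  have phi1 : phi \1%VF = 1%:M.
    have -> : \1%VF = homothety V 1.
      by apply/lfunP => v; rewrite id_lfunE homothetyE scale1r rscale1.
    by rewrite phiH rmorph1.
  (* Over the splitting field, $1-x$ is conjugate to the transpose of $1+x$, so both have the same
     determinant and [g] has reduced norm 1. *)
  have dB : \det (phi (\1 - x)%VF) = \det (phi (\1 + x)%VF).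
    rewrite (hB _ _ adj) !det_mulmx det_tr det_inv mulrAC mulVf ?mul1r //.
    by rewrite -unitfE -unitmxE.
  have d0 : \det (phi (\1 + x)%VF) != 0.
    have := congr1 (fun f => \det (phi f)) u1; rewrite phiM det_mulmx phi1 det1.
    by move=> e; apply/eqP => e0; move: e; rewrite e0 mul0r => /esym/eqP; rewrite oner_eq0.
  apply: (mulIf d0); rewrite mul1r -det_mulmx -phiM gx; exact: dB.
have g0 : chain_filt L 0 g by apply: fc.
pose N := cE sdL cm x.
have xx0 : chain_filt L 0 (x \o x)%VF by apply: fc.
have N2 : cE sdL cm (x \o x)%VF = N *m N by rewrite cEM.
have N3 : N *m N *m N = 0.
  rewrite -N2 -cEM //; apply/cE_eq0 => //; exact: fc.
have Eg : cE sdL cm g = cayley_curve N 1.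
  have e1 : cE sdL cm g *m (1%:M + N) = 1%:M - N.
    by rewrite -(cE_id sdL cm) -cED // -cEM // gx cEB.
  have e2 : (1%:M + N) *m cE sdL cm u = 1%:M.
    by rewrite -{1}(cE_id sdL cm) -cED // -cEM // u1 cE_id.
  have e3 : cayley_curve N 1 *m (1%:M + N) = 1%:M - N.
    rewrite /cayley_curve !mul1r mulmxDr mulmx1 !mulmxDl mul1mx mulNmx -!scalemxAl N3 scaler0 addr0.
    rewrite -!mulr2n !scaler_nat -addrA [_ *+ 2 + _]addrCA addrN addr0.
    by rewrite -addrA mulr2n opprD subrK.
  by rewrite -[LHS]mulmx1 -e2 mulmxA e1 -e3 -mulmxA e2 mulmx1.
exists g; split; last first.
  have c0 : chain_filt L 0 (\1 - (x + x) + ((x \o x) + (x \o x)))%VF.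
    by apply: (chain_filtD sdL); [apply: (chain_filtB sdL)|]; do ?apply: (chain_filtD sdL).
  apply/(cE_eq0 sdL cm); first exact: (chain_filtB sdL).
  rewrite cEB // Eg cED ?cEB ?(cED _ _ x0) ?(cED _ _ xx0) ?cE_id ?N2 //;
    do ?[apply: (chain_filtB sdL)|apply: (chain_filtD sdL)] => //.
  rewrite /cayley_curve !mul1r -!mulr2n !scaler_nat -/N.
  by rewrite !mulr2n subrr.
split.
  split; first by split.
  rewrite filt0_chain_fun; split=> //; exists g'; split=> //.
  exact: fc.
apply: (@chain_model_residual R _ _ _ _ L sdL b cm); rewrite Eg.
pose NK := map_mx (bemb b) N.
have NK3 : NK *m NK *m NK = 0 by rewrite -!map_mxM N3 map_mx0.
have -> : map_mx (bemb b) (cayley_curve N 1) = cayley_curve NK 1.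
  by rewrite /cayley_curve !(map_mxD, map_mxN, map_mxZ, map_mx1, map_mxM) !mul1r (rmorphD (bemb b)) (rmorph1 (bemb b)).
have EK s : cayley_curve NK s = 1%:M - (s + s) *: NK + (s * s + s * s) *: map_mx (bemb b) (cE sdL cm (x \o x)%VF).
  by rewrite N2 map_mxM.
have alg s : chain_algebra sdL cm (cayley_curve NK s).
  rewrite EK.
  have := @chain_algebra_sum _ _ _ _ _ _ sdL cm 3 (fun i => [:: 1; - (s + s); s * s + s * s]`_i)
    (fun i => [:: 1%:M; NK; map_mx (bemb b) (cE sdL cm (x \o x)%VF)]`_i).
  rewrite !big_ord_recl big_ord0 /= addr0 scale1r scaleNr addrA; apply.
  case=> -[|[|[|//]]] _ /=; [exact: chain_algebra1|exact: chain_algebra_E|exact: chain_algebra_E].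
have curve_group s : chain_group sdL cm (cayley_curve NK s).
  split=> //; last by move=> _; apply: det_cayley_curve.
  rewrite -[RHS](cayley_curveM s NK3); congr (_ *m _).
  rewrite EK linearD linearB !linearZ /= cS1 (cS_adjoint sdL cm x0 x_skew).
  rewrite (cS_adjoint sdL cm xx0 x2_adj) N2 cEN // map_mxN map_mxM !scalerN opprK.
  by [].
(* The curve joins 1, at $s=0$, to the reduction of [g], at $s=1$. *)
apply: (@connected_component_max _ (chain_group sdL cm)
  [set (cayley_curve NK s : zariski (bK b) (cn cm)) | s in [set: bK b]] (1%:M : 'M_(cn cm))).
- by exists 0 => //; apply: cayley_curve0.
- by move=> _ [s _ <-]; apply: curve_group.
- apply: connected_curve => i j.
  exists ((1%:M i j : bK b)%:P - ('X + 'X) * (NK i j)%:P + ('X * 'X + 'X * 'X) * ((NK *m NK) i j)%:P).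
  by move=> s; rewrite !hornerE /cayley_curve !mxE.
- by exists 1.
Qed.

Lemma connected_stabilizer_chain (R : realType) g :
  connected_stabilizer X (chain_fun X L : R -> set V) g <->
  stabilizer X (chain_fun X L : R -> set V) g /\ exists (b : residue_base X) (cm : chain_model b L),
    chain_group0 sdL cm (map_mx (bemb b) (cE sdL cm g)).
Proof.
split=> -[st]; last by move=> [b [cm hg]]; split=> //; apply: chain_model_residual hg.
move=> [M hM]; split=> //; have [b [cm h]] := residual_chain_model sdL M.
exists b, cm; apply: h => //.
by case: st => _ [+ _]; rewrite filt0_chain_fun.
Qed.

End Unipotents.

Section TwoStep.
Variables (F : fieldType) (D : falgType F) (V : vectType D^c).
Variable X : hermitian_datum V.
Variable L : int -> set V.
Hypothesis sdL : sd_chain X L.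
Hypothesis two_step0 : L (-1) = L 0.
Hypothesis two_step1 : L 1 = L 2.

(** All jumps are at even indices; this leaves the odd indices free to receive the jumps of the
    refinement. *)
Lemma chain_even_step k : L (2 * k - 1) = L (2 * k).
Proof.
have base n n' q : n <= n' -> L n = L n' -> L (n + 4 * q) = L (n' + 4 * q).
  move=> nn' e0; apply/seteqP; split=> v hv.
    have := (chain_shift sdL _ _ (- q)).1 hv.
    rewrite (_ : n + 4 * q + 4 * - q = n) ?e0; last by lia.
    by move/(chain_shift sdL _ _ q).1; rewrite rscaleA unifzNK rscale1.
  by apply: (chain_le sdL _ hv); lia.
have [q kE] : exists q, k = 2 * q \/ k = 1 + 2 * q by exists (k %/ 2)%Z; lia.
case: kE => kE.
  have e1 : 2 * k - 1 = -1 + 4 * q by lia.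
  have e2 : 2 * k = 0 + 4 * q by lia.
  by rewrite e1 e2; apply: base.
have e1 : 2 * k - 1 = 1 + 4 * q by lia.
have e2 : 2 * k = 2 + 4 * q by lia.
by rewrite e1 e2; apply: base.
Qed.

End TwoStep.

(** * Inserting a Lagrangian lattice *)

Section Refinement.
Variables (F : fieldType) (D : falgType F) (V : vectType D^c).
Variable X : hermitian_datum V.
Local Notation h := (hform X).
Local Notation vD := (valD X).
Local Notation pi := (unif X).
Local Notation eps := (sgn X).
Let uD := D_skew_field X.
Let nD := valD_valuation X.
Variable L : int -> set V.
Hypothesis sdL : sd_chain X L.
Hypothesis two_step0 : L (-1) = L 0.
Hypothesis two_step1 : L 1 = L 2.
Variables (j c : int) (M : set V).
Hypothesis j01 : j = 0 \/ j = 1.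
Hypothesis cE2 : c = 2 * j.
Hypothesis M_sub : submodule X M.
Hypothesis LM : L (c + 1) `<=` M.
Hypothesis ML : M `<=` L c.
Hypothesis M_iso : forall v w, M v -> M w -> val_ge vD (j + 1) (h v w).
Hypothesis M_max : forall v, L c v -> (forall w, M w -> val_ge vD (j + 1) (h v w)) -> M v.
Variables (e f : V).
Hypothesis Me : M e.
Hypothesis Lf : L (- c) f.
Hypothesis hfe : h f e = 1.
Hypothesis hff : val_ge vD (1 - j) (h f f).
Hypothesis M_cotype : forall v, L c v -> exists2 y, val_ge vD j y & M (v - rscale f y).
Hypothesis M_type : forall m, M m -> L (c + 1) (m - rscale e (h f m)).
Hypothesis sym_pos : forall y, val_ge vD j y -> val_ge vD (j + 1) (y - eps * bar X y).
Hypothesis sym_neg : forall y, val_ge vD (- j) y -> val_ge vD (1 - j) (y - eps * bar X y).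
Implicit Types (v w z : V) (x y : D) (a : 'End(V)).

Let LD m v w : L m v -> L m w -> L m (v + w).
Proof. by case: (chain_sub sdL m) => _ + _; apply. Qed.
Let LB m v w : L m v -> L m w -> L m (v - w).
Proof. exact: (submoduleB (chain_sub sdL m)). Qed.
Let MD v w : M v -> M w -> M (v + w). Proof. by case: M_sub => _ + _; apply. Qed.
Let MB v w : M v -> M w -> M (v - w). Proof. exact: (submoduleB M_sub). Qed.
Let MZ v x : M v -> val_ge vD 0 x -> M (rscale v x).
Proof. by move=> hv hx; case: M_sub => _ _ sZ; apply: sZ. Qed.
Let scaleL m n k v x := @chain_scale_le _ _ _ X L sdL m n k v x.
Let filtL a m v : chain_filt L 0 a -> L m v -> L m (a v).
Proof. by move=> ha /ha; rewrite addr0. Qed.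
Let Le : L c e := ML Me.
Let hef : h e f = eps. Proof. by rewrite hform_sgn hfe bar1 mulr1. Qed.
Let pi_pi v n : rscale (rscale v (pi ^ n)) (pi ^ (- n)) = v.
Proof. by rewrite rscaleA unifzK rscale1. Qed.
Let pi_piN v n : rscale (rscale v (pi ^ (- n))) (pi ^ n) = v.
Proof. by rewrite rscaleA unifzNK rscale1. Qed.

Let even_step k : L (2 * k - 1) = L (2 * k) := chain_even_step sdL two_step0 two_step1 k.

Let step_c q : L (c + 1 + 4 * q) = L (c + 2 + 4 * q).
Proof.
have e1 : 2 * (j + 1 + 2 * q) - 1 = c + 1 + 4 * q by lia.
have e2 : 2 * (j + 1 + 2 * q) = c + 2 + 4 * q by lia.
by rewrite -e1 -e2 even_step.
Qed.

Let step_c' q : L (c - 1 + 4 * q) = L (c + 4 * q).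
Proof.
have e1 : 2 * (j + 2 * q) - 1 = c - 1 + 4 * q by lia.
have e2 : 2 * (j + 2 * q) = c + 4 * q by lia.
by rewrite -e1 -e2 even_step.
Qed.

(* M takes the places c and c + 1, so the jump of L at c is split in two. *)
Definition refined : int -> set V :=
  periodic X (fun i => if (i == c) || (i == c + 1) then M else L i).
Local Notation L' := refined.

Lemma refined_M q v : L' (c + 4 * q) v = M (rscale v (pi ^ (- q))).
Proof. by rewrite /refined periodicE ?eqxx //; lia. Qed.

Lemma refined_M1 q v : L' (c + 1 + 4 * q) v = M (rscale v (pi ^ (- q))).
Proof. by rewrite /refined periodicE ?eqxx ?orbT //; lia. Qed.

Let refined_other m q v : 0 <= m < 4 -> m <> c -> m <> c + 1 -> L' (m + 4 * q) v = L (m + 4 * q) v.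
Proof.
move=> hm mc mc1; rewrite /refined periodicE //.
have -> : (m == c) || (m == c + 1) = false by lia.
apply/propext; split=> [/(chain_shift sdL _ _ q).1|/(chain_shift sdL _ _ (- q)).1].
  by rewrite pi_piN.
by rewrite (_ : m + 4 * q + 4 * - q = m) //; lia.
Qed.

Lemma refined_L2 q : L' (c + 2 + 4 * q) = L (c + 2 + 4 * q).
Proof.
apply/seteqP; split=> v; case: j01 => j0.
- by rewrite refined_other //; lia.
- by rewrite (_ : c + 2 + 4 * q = 0 + 4 * (q + 1)) ?refined_other //; lia.
- by rewrite refined_other //; lia.
- by rewrite (_ : c + 2 + 4 * q = 0 + 4 * (q + 1)) ?refined_other //; lia.
Qed.

Lemma refined_L3 q : L' (c - 1 + 4 * q) = L (c - 1 + 4 * q).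
Proof.
apply/seteqP; split=> v; case: j01 => j0.
- by rewrite (_ : c - 1 + 4 * q = 3 + 4 * (q - 1)) ?refined_other //; lia.
- by rewrite refined_other //; lia.
- by rewrite (_ : c - 1 + 4 * q = 3 + 4 * (q - 1)) ?refined_other //; lia.
- by rewrite refined_other //; lia.
Qed.

(** Since $1-c=c+1-4j$, the set is the member of index $1-c$ of the refined chain. The equality says
    that [M] is its own orthogonal modulo $\mathfrak p_D^{j+1}$. *)
Lemma dual_lagrangian : dual_lattice X [set v | M (rscale v (pi ^ j))] = M.
Proof.
apply/seteqP; split=> v hv.
  apply: M_max.
    rewrite -(chain_dual sdL) => w hw; apply: hv => /=; apply: LM.
    by apply: (@scaleL (1 - c) j) => //; [exact: val_ge_unifz|lia].
  move=> w Mw; have /= := hv (rscale w (pi ^ (- j))); rewrite pi_piN hformZr => /(_ Mw) h1.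
  rewrite -[h v w]mulr1 -(unifzNK X j) mulrA.
  by apply: (val_geMW nD (m := 1) (n := j)) => //; [lia|exact: val_ge_unifz].
move=> w /(M_iso hv); rewrite hformZr => h1.
rewrite -[h v w]mulr1 -(unifzK X j) mulrA.
by apply: (val_geMW nD (m := j + 1) (n := - j)) => //; [lia|exact: val_ge_unifz].
Qed.

Lemma refined_sd_chain : sd_chain X L'.
Proof.
have fullM : full_lattice X M.
  apply: (full_lattice_sub (chain_full sdL c)) => // v.
  by have [n hn] := full_lattice_absorbing (chain_full sdL (c + 1)) v; exists n; apply: LM.
have LS m : L (m + 1) `<=` L m by move=> v; apply: (chain_le sdL); lia.
have shiftL m : [set v | L (m + 4) (rscale v pi)] = L m.
  apply/seteqP; split=> v /= hv; have s := chain_shift sdL m v 1; rewrite mulr1 expr1z in s.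
    exact: s.2.
  exact: s.1.
apply: periodic_sd_chain.
- by move=> r hr; case: ifP => _ //; apply: (chain_full sdL).
- case: j01 => j0; move: cE2 ML LM; rewrite j0 => -> ML' LM'; split=> //=.
  + by rewrite -two_step1.
  + exact: (LS 2).
  + move=> v /ML' hv; have -> : L 3 = L 4 by have := even_step 2.
    by apply: (chain_scale sdL (n := 1) (m := 0)) => //; right; rewrite val_unif.
  + exact: (LS 0).
  + by rewrite two_step1.
  + move=> v hv; apply: LM'; rewrite (_ : 2 * 1 + 1 = 3 :> int) //; have -> : L 3 = L 4 by have := even_step 2.
    by apply: (chain_scale sdL (n := 1) (m := 0)) => //; right; rewrite val_unif.
- have dL := chain_dual sdL; have dM := dual_lagrangian.
  case: j01 => j0; move: cE2 dM; rewrite j0 => -> dM; split=> /=.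
  + by rewrite -[RHS]dM; congr dual_lattice; apply/seteqP; split=> v; rewrite /= expr0z rscale1.
  + by rewrite -[RHS]dM; congr dual_lattice; apply/seteqP; split=> v; rewrite /= expr0z rscale1.
  + by rewrite -[RHS](dL 2); congr dual_lattice; rewrite -(shiftL (1 - 2)).
  + by rewrite -[RHS](dL 3); congr dual_lattice; rewrite -(shiftL (1 - 3)).
  + by rewrite -[RHS](dL 1); congr dual_lattice.
  + by rewrite -[RHS](dL 0); congr dual_lattice.
  + by rewrite -[RHS]dM; congr dual_lattice; apply/seteqP; split=> v; rewrite /= expr1z.
  + by rewrite -[RHS]dM; congr dual_lattice; apply/seteqP; split=> v; rewrite /= expr1z.
Qed.

Let window m :
  exists q, [\/ m = c + 4 * q, m = c + 1 + 4 * q, m = c + 2 + 4 * q | m = c - 1 + 4 * q].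
Proof.
exists ((m - c + 1) %/ 4)%Z.
have [h0|[h0|[h0|h0]]] : ((m - c + 1) %% 4)%Z = 0 \/ ((m - c + 1) %% 4)%Z = 1 \/
  ((m - c + 1) %% 4)%Z = 2 \/ ((m - c + 1) %% 4)%Z = 3 by lia.
- by constructor 4; lia.
- by constructor 1; lia.
- by constructor 2; lia.
- by constructor 3; lia.
Qed.

(** Every lattice of [L] still occurs in the refined chain, since [L] does not jump at odd indices.
    With [filt_refined], the refined order is the stabilizer of [M] in the order of [L]. *)
Lemma refined_filt a : chain_filt L' 0 a -> chain_filt L 0 a /\ forall v, M v -> M (a v).
Proof.
move=> ha; have ha' m v : L' m v -> L' m (a v) by move=> /ha; rewrite addr0.
split=> [m v|v Mv]; last first.
  have := ha' c v; rewrite -[c]addr0 -(mulr0 4) !refined_M oppr0 expr0z !rscale1.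
  exact.
rewrite addr0; have [q hq] := window m.
case: hq => ->; rewrite -?step_c' ?step_c -?refined_L2 -?refined_L3; exact: ha'.
Qed.

Lemma filt_refined a : chain_filt L 0 a -> (forall v, M v -> M (a v)) -> chain_filt L' 0 a.
Proof.
move=> ha aM m v; rewrite addr0; have [q hq] := window m.
case: hq => ->; rewrite ?refined_M ?refined_M1 ?refined_L2 ?refined_L3; try exact: filtL.
  by rewrite -lfun_rscale; apply: aM.
by rewrite -lfun_rscale; apply: aM.
Qed.

(** [p] and [q] are exact idempotents, adjoint to each other, but their products vanish only modulo
    the radical, as [e] and [f] are isotropic only residually. *)
Let p := rank1 X e f.
Let q := rank1 X (rscale f eps) e.
Let r : 'End(V) := (\1 - p - q)%VF.

Let pE v : p v = rscale e (h f v). Proof. exact: rank1E. Qed.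
Let qE v : q v = rscale f (eps * h e v). Proof. by rewrite /q rank1E rscaleA. Qed.
Let rE v : r v = v - p v - q v.
Proof. by rewrite /r !(add_lfunE, opp_lfunE) id_lfunE. Qed.

Let val_eps : val_ge vD 0 eps.
Proof. by rewrite -[eps]mulr1; apply: val_ge_sgn; apply: val_ge1. Qed.

Let p0 : chain_filt L 0 p.
Proof. by rewrite -(subrr c); apply: (chain_rank1 sdL). Qed.
Let q0 : chain_filt L 0 q.
Proof.
by rewrite -(addNr c); apply: (chain_rank1 sdL) => //; apply: (@scaleL (- c) 0) => //; lia.
Qed.
Let r0 : chain_filt L 0 r.
Proof.
by do !apply: (chain_filtB sdL) => //; apply: (@chain_filt_id _ _ _ L).
Qed.
Let fc s t : chain_filt L 0 s -> chain_filt L 0 t -> chain_filt L 0 (s \o t)%VF.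
Proof. by move=> hs ht; have := chain_filt_comp hs ht; rewrite addr0. Qed.

Let adj_pq : adjoint X p q. Proof. exact: adjoint_rank1. Qed.
Let adj_qp : adjoint X q p. Proof. exact: adjoint_sym. Qed.
Let adj_r : adjoint X r r.
Proof.
rewrite {2}/r -addrA (addrC (- p)) addrA.
by apply: adjointB => //; apply: adjointB => //; apply: adjoint_id.
Qed.

Let pp : (p \o p)%VF = p.
Proof. by apply/lfunP => v; rewrite comp_lfunE !pE hformZr hfe mul1r. Qed.
Let qq : (q \o q)%VF = q.
Proof.
apply/lfunP => v; rewrite comp_lfunE !qE hformZr hef; congr rscale.
by rewrite !mulrA sgnK mul1r.
Qed.

Let pq1 : chain_filt L 1 (p \o q)%VF.
Proof.
move=> m v hv; rewrite comp_lfunE pE qE hformZr.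
apply: (@scaleL c (1 - j + ((c + m + 3) %/ 4)%Z)) => //; last by lia.
apply: (val_geM nD) => //; apply: val_ge_sgn.
by apply: (chain_h sdL _ Le hv); lia.
Qed.

Let qp1 : chain_filt L 1 (q \o p)%VF.
Proof.
move=> m v hv; rewrite comp_lfunE qE pE hformZr mulrA.
apply: (@scaleL (- c) (j + 1 + ((- c + m + 3) %/ 4)%Z)) => //; last by lia.
apply: (val_geM nD); first by apply: val_ge_sgn; apply: M_iso.
by apply: (chain_h sdL _ Lf hv); lia.
Qed.

(** Away from the residue [c], rounding the valuation of [h f v] up to an integer gains at least one
    step of the chain. So [p] acts only on the pieces of index congruent to [c]. *)
Let p_other m v : ((m - c) %% 4)%Z != 0 -> L m v -> L (m + 1) (p v).
Proof.
move=> mc hv; rewrite pE; apply: (@scaleL c ((m - c + 3) %/ 4)%Z) => //; last by lia.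
by apply: (chain_h sdL _ Lf hv); lia.
Qed.

Let q_other m v : ((m - c) %% 4)%Z != 0 -> L m v -> L (m + 1) (q v).
Proof.
move=> mc hv; rewrite qE; apply: (@scaleL (- c) ((m + c + 3) %/ 4)%Z) => //; last by lia.
by apply: val_ge_sgn; apply: (chain_h sdL _ Le hv); lia.
Qed.

Let q_M v : M v -> L (c + 4) (q v).
Proof.
move=> hv; rewrite qE; apply: (@scaleL (- c) (j + 1)) => //; last by lia.
by apply: val_ge_sgn; apply: M_iso.
Qed.

Let fy y : val_ge vD j y -> L c (rscale f y).
Proof. by move=> hy; apply: (@scaleL (- c) j) => //; lia. Qed.

Let q_f y : val_ge vD j y -> q (rscale f y) = rscale f y.
Proof. by move=> hy; rewrite qE hformZr hef !mulrA sgnK mul1r. Qed.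

Let p_f y : val_ge vD j y -> L (c + 4) (p (rscale f y)).
Proof.
move=> hy; rewrite pE hformZr; apply: (@scaleL c 1) => //; try lia.
by apply: (val_geMW nD (m := 1 - j) (n := j)) => //; lia.
Qed.

Let p_L v : L c v -> M (p v).
Proof.
move=> hv; rewrite pE; apply: MZ => //; apply: (chain_h sdL _ Lf hv); lia.
Qed.

(** $L_c$ is generated by $L_{c+1}$, [e] and [f], and modulo $L_{c+1}$ the operators [p] and [q] are
    the projections onto the two lines: nothing of the plane is left for [r]. *)
Let r_c v : L c v -> L (c + 1) (r v).
Proof.
move=> hv; have [y hy hm] := M_cotype hv.
have -> : r v = r (v - rscale f y) + r (rscale f y) by rewrite -lfunD subrK.
have L4 w : L (c + 4) w -> L (c + 1) w by apply: (chain_le sdL); lia.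
apply: LD.
  rewrite rE; apply: LB; last by apply: L4; apply: q_M.
  by rewrite pE; apply: M_type.
rewrite rE q_f // addrAC subrr sub0r; apply: (submoduleN (chain_sub sdL _)).
by apply: L4; apply: p_f.
Qed.

Let r_c4 k v : L (c + 4 * k) v -> L (c + 4 * k + 1) (r v).
Proof.
move=> hv; have h1 : L c (rscale v (pi ^ (- k))).
  have := (chain_shift sdL _ _ (- k)).1 hv.
  by rewrite (_ : c + 4 * k + 4 * - k = c) //; lia.
have := (chain_shift sdL _ _ k).1 (r_c h1).
by rewrite lfun_rscale pi_piN (_ : c + 1 + 4 * k = c + 4 * k + 1) //; lia.
Qed.

(** Residually, [r] is 0 on the pieces of index congruent to [c] and the identity on the others, and
    [a] preserves the pieces. *)
Let r_comm a : chain_filt L 0 a -> chain_filt L 1 ((r \o a) - (a \o r))%VF.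
Proof.
move=> ha m v hv; rewrite add_lfunE opp_lfunE !comp_lfunE.
have [mc|mc] := eqVneq ((m - c) %% 4)%Z 0.
  have mE : m = c + 4 * ((m - c) %/ 4)%Z by lia.
  have rL w : L m w -> L (m + 1) (r w) by rewrite mE; apply: r_c4.
  by apply: LB; [apply: rL; apply: filtL|apply: filtL => //; apply: rL].
rewrite !rE !lfunB.
have e4 (A x1 x2 y1 y2 : V) : A - x1 - x2 - (A - y1 - y2) = (y1 + y2) - (x1 + x2).
  have e5 (x y : V) : A - x - y = A - (x + y) by rewrite opprD addrA.
  by rewrite (e5 x1 x2) (e5 y1 y2) opprB addrC; move: (y1 + y2) (x1 + x2) => y x; rewrite addrA subrK.
rewrite e4; apply: LB; apply: LD.
- by apply: filtL => //; apply: p_other.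
- by apply: filtL => //; apply: q_other.
- by apply: p_other => //; apply: filtL.
- by apply: q_other => //; apply: filtL.
Qed.

(** This corner depends on [a] only through [h f (a f)]. Passing to the adjoint replaces it by
    $\epsilon$ times its conjugate, which is the same residually by [sym_neg]. *)
Let paq_sym a a' : chain_filt L 0 a -> adjoint X a a' ->
  chain_filt L 1 ((p \o a \o q) - (p \o a' \o q))%VF.
Proof.
move=> ha aa' m v hv; rewrite add_lfunE opp_lfunE !comp_lfunE !pE !qE.
rewrite !lfun_rscale !hformZr -aa' -rscaleBr -mulrBl.
have hz : val_ge vD (- j) (h f (a f)).
  by apply: (chain_h sdL (m := - c) (n := - c)) => //; [lia|apply: filtL].
have hd : val_ge vD (1 - j) (h f (a f) - h (a f) f).
  by rewrite [h (a f) f]hform_sgn; apply: sym_neg.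
rewrite mulrA; apply: (@scaleL c (1 - j + ((c + m + 3) %/ 4)%Z)) => //; last by lia.
apply: (val_geM nD).
  by apply: (val_geMW nD (m := 1 - j) (n := 0)) => //; lia.
by apply: (chain_h sdL _ Le hv); lia.
Qed.

Let qap_sym a a' : chain_filt L 0 a -> adjoint X a a' ->
  chain_filt L 1 ((q \o a \o p) - (q \o a' \o p))%VF.
Proof.
move=> ha aa' m v hv; rewrite add_lfunE opp_lfunE !comp_lfunE !qE !pE.
rewrite !lfun_rscale !hformZr -aa' -rscaleBr -mulrBr -mulrBl.
have hz : val_ge vD j (h e (a e)).
  by apply: (chain_h sdL (m := c) (n := c)) => //; [lia|apply: filtL].
have hd : val_ge vD (j + 1) (h e (a e) - h (a e) e).
  by rewrite [h (a e) e]hform_sgn; apply: sym_pos.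
rewrite mulrA; apply: (@scaleL (- c) (j + 1 + ((- c + m + 3) %/ 4)%Z)) => //; last by lia.
apply: (val_geM nD); first exact: val_ge_sgn.
by apply: (chain_h sdL _ Lf hv); lia.
Qed.

(* On the reductive quotient of the refined chain, a acts through this block
   diagonal part: p and q project onto the two halves of the split jump. *)
Let blk a : 'End(V) := ((p \o a \o p) + (q \o a \o q) + (r \o a \o r))%VF.

Let blk0 a : chain_filt L 0 a -> chain_filt L 0 (blk a).
Proof. by move=> ha; do !apply: (chain_filtD sdL); do !apply: fc. Qed.

Let blk_adjoint a a' : adjoint X a a' -> adjoint X (blk a) (blk a').
Proof.
move=> aa'; rewrite {2}/blk (addrC (p \o a' \o p)%VF) -!comp_lfunA.
by do !apply: adjointD; do !apply: adjoint_comp.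
Qed.

Let blkM a : chain_filt L 0 a -> forall v, M v -> M (blk a v).
Proof.
move=> ha v hv; rewrite !add_lfunE !comp_lfunE.
have L4 w : L (c + 4) w -> M w by move=> hw; apply: LM; apply: (chain_le sdL _ hw); lia.
apply: MD; [apply: MD|].
- by apply: p_L; apply: filtL => //; apply: filtL => //; apply: ML.
- by apply: L4; do 2!apply: filtL => //; apply: q_M.
- by apply: LM; do 2!apply: filtL => //; apply: r_c; apply: ML.
Qed.

Section Model.
Variables (b : residue_base X) (cm : chain_model b L).
Local Notation E := (cE sdL cm).
Local Notation P := (E p).
Local Notation Q := (E q).

Let PP : P *m P = P. Proof. by rewrite -cEM // pp. Qed.
Let QQ : Q *m Q = Q. Proof. by rewrite -cEM // qq. Qed.
Let PQ : P *m Q = 0. Proof. by rewrite -cEM //; apply/cE_eq0 => //; apply: fc. Qed.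
Let QP : Q *m P = 0. Proof. by rewrite -cEM //; apply/cE_eq0 => //; apply: fc. Qed.
Let ER : E r = 1%:M - P - Q.
Proof.
have id0 : chain_filt L 0 (\1%VF : 'End(V)) by apply: (@chain_filt_id _ _ _ L).
by rewrite /r !cEB ?cE_id //; apply: (chain_filtB sdL).
Qed.
Let R := 1%:M - P - Q.
Let PR : P *m R = 0. Proof. by rewrite /R !mulmxBr mulmx1 PP PQ subrr subr0. Qed.
Let QR : Q *m R = 0. Proof. by rewrite /R !mulmxBr mulmx1 QP QQ subr0 subrr. Qed.
Let RP : R *m P = 0. Proof. by rewrite /R !mulmxBl mul1mx PP QP subrr subr0. Qed.
Let RQ : R *m Q = 0. Proof. by rewrite /R !mulmxBl mul1mx PQ QQ subr0 subrr. Qed.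
Let RR : R *m R = R. Proof. by rewrite {1}/R !mulmxBl mul1mx PR QR !subr0. Qed.
Let R_comm a : chain_filt L 0 a -> R *m E a = E a *m R.
Proof.
move=> ha; rewrite /R -ER -!cEM //; apply: (cE_congr sdL); try exact: fc.
exact: r_comm.
Qed.

Let Eblk a : chain_filt L 0 a -> E (blk a) = P *m E a *m P + Q *m E a *m Q + R *m E a *m R.
Proof.
move=> ha; have hp := fc (fc p0 ha) p0; have hq := fc (fc q0 ha) q0.
rewrite /blk (cED sdL cm (chain_filtD sdL hp hq) (fc (fc r0 ha) r0)) (cED sdL cm hp hq).
rewrite (cEM sdL cm (fc p0 ha) p0) (cEM sdL cm p0 ha).
rewrite (cEM sdL cm (fc q0 ha) q0) (cEM sdL cm q0 ha).
by rewrite (cEM sdL cm (fc r0 ha) r0) (cEM sdL cm r0 ha) ER.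
Qed.

Let cVp m v : ((m - c) %% 4)%Z != 0 -> 0 <= m < 4 -> L m v -> P *m cV cm m v = 0.
Proof.
move=> mc hm hv; rewrite cE_action //; apply/cV_ker; first exact: filtL.
exact: p_other.
Qed.

Let cVq m v : ((m - c) %% 4)%Z != 0 -> 0 <= m < 4 -> L m v -> Q *m cV cm m v = 0.
Proof.
move=> mc hm hv; rewrite cE_action //; apply/cV_ker; first exact: filtL.
exact: q_other.
Qed.

Let c_range : 0 <= c < 4. Proof. by lia. Qed.

(** So [P] embeds $M/L_{c+1}$ into the model of [L], and, by [ker_Q] below, [Q] embeds $L_c/M$. *)
Let ker_P w : M w -> (P *m cV cm c w = 0 <-> L (c + 1) w).
Proof.
move=> hw; have Lw := ML hw; rewrite cE_action // cV_ker; last exact: filtL.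
have h1 : L (c + 1) (w - p w) by rewrite pE; apply: M_type.
split=> hp; first by rewrite -(subrK (p w) w); apply: LD.
by have := LB hp h1; rewrite opprB (addrC w) subrK.
Qed.

Let ker_Q w : L c w -> (Q *m cV cm c w = 0 <-> M w).
Proof.
move=> hw; rewrite cE_action // cV_ker; last exact: filtL.
have L4 z : L (c + 4) z -> L (c + 1) z by apply: (chain_le sdL); lia.
split=> [hq|hM]; last by apply: L4; apply: q_M.
have [y hy hm] := M_cotype hw.
have : L (c + 1) (rscale f y).
  rewrite -(q_f hy) -(subKr w (rscale f y)) lfunB; apply: LB => //.
  by apply: L4; apply: q_M.
by move=> /LM hfy; rewrite -(subrK (rscale f y) w); apply: MD.
Qed.

(** Position of [m] relative to [c]. The refined chain jumps only at [s m = 1], with piece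
    $M/L_{c+1}$, at [s m = 3], with piece $L_c/M$, and at [s m = 2], the other jump of [L], which
    [k2] brings to the index $2-c$. *)
Let s m := ((m - c) %% 4)%Z.
Let qt m := ((m - c) %/ 4)%Z.
Let k2 m := ((m - (2 - c)) %/ 4)%Z.

Let shiftLE m n v : L (m + 4 * n) v <-> L m (rscale v (pi ^ (- n))).
Proof.
split=> [/(chain_shift sdL _ _ (- n)).1|/(chain_shift sdL _ _ n).1].
  by rewrite (_ : m + 4 * n + 4 * - n = m) //; lia.
by rewrite pi_piN.
Qed.

Let refined1 m v : s m = 1 -> (L' m v <-> M (rscale v (pi ^ (- qt m)))).
Proof.
move=> sm; have e1 : m = c + 1 + 4 * qt m by move: sm; rewrite /s /qt; lia.
by rewrite {1}e1 refined_M1.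
Qed.

Let refined1S m v : s m = 1 -> (L' (m + 1) v <-> L (c + 1) (rscale v (pi ^ (- qt m)))).
Proof.
move=> sm; have e1 : m + 1 = c + 2 + 4 * qt m by move: sm; rewrite /s /qt; lia.
by rewrite {1}e1 refined_L2 -step_c shiftLE.
Qed.

Let refined3 m v : s m = 3 -> (L' m v <-> L c (rscale v (pi ^ (- (qt m + 1))))).
Proof.
move=> sm; have e1 : m = c - 1 + 4 * (qt m + 1) by move: sm; rewrite /s /qt; lia.
by rewrite {1}e1 refined_L3 step_c' shiftLE.
Qed.

Let refined3S m v : s m = 3 -> (L' (m + 1) v <-> M (rscale v (pi ^ (- (qt m + 1))))).
Proof.
move=> sm; have e1 : m + 1 = c + 4 * (qt m + 1) by move: sm; rewrite /s /qt; lia.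
by rewrite {1}e1 refined_M.
Qed.

Let refined2 m v : s m = 2 -> (L' m v <-> L (2 - c) (rscale v (pi ^ (- k2 m)))).
Proof.
move=> sm; have e1 : m = c + 2 + 4 * qt m by move: sm; rewrite /s /qt; lia.
have e2 : c + 2 + 4 * qt m = 2 - c + 4 * k2 m by move: sm; rewrite /s /qt /k2; lia.
by rewrite {1}e1 refined_L2 e2 shiftLE.
Qed.

Let refined2S m v : s m = 2 -> (L' (m + 1) v <-> L (2 - c + 1) (rscale v (pi ^ (- k2 m)))).
Proof.
move=> sm; have e1 : m + 1 = c - 1 + 4 * (qt m + 1) by move: sm; rewrite /s /qt; lia.
have e2 : c - 1 + 4 * (qt m + 1) = 2 - c + 1 + 4 * k2 m by move: sm; rewrite /s /qt /k2; lia.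
by rewrite {1}e1 refined_L3 e2 shiftLE.
Qed.

Let refined0S m v : s m = 0 -> L' m v -> L' (m + 1) v.
Proof.
move=> sm; have e0 : m = c + 4 * qt m by move: sm; rewrite /s /qt; lia.
have e1 : m + 1 = c + 1 + 4 * qt m by move: sm; rewrite /s /qt; lia.
by rewrite e1 refined_M1 {1}e0 refined_M.
Qed.

Let s_cases m : s m = 0 \/ s m = 1 \/ s m = 2 \/ s m = 3.
Proof. by rewrite /s; lia. Qed.

(** The model of the refined chain on the space of the old one: the images of [P] and [Q] serve the
    two new pieces, and the other jump keeps its coordinates. Both geometric groups thus live in one
    matrix space. *)
Let cV' (m : int) (v : V) : 'cV[bk b]_(cn cm) :=
  if s m == 1 then P *m cV cm c (rscale v (pi ^ (- qt m)))
  else if s m == 3 then Q *m cV cm c (rscale v (pi ^ (- (qt m + 1))))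
  else if s m == 2 then cV cm (2 - c) (rscale v (pi ^ (- k2 m)))
  else 0.

Let cV'1 m v : s m = 1 -> cV' m v = P *m cV cm c (rscale v (pi ^ (- qt m))).
Proof. by rewrite /cV' => ->. Qed.
Let cV'2 m v : s m = 2 -> cV' m v = cV cm (2 - c) (rscale v (pi ^ (- k2 m))).
Proof. by rewrite /cV' => ->. Qed.
Let cV'3 m v : s m = 3 -> cV' m v = Q *m cV cm c (rscale v (pi ^ (- (qt m + 1)))).
Proof. by rewrite /cV' => ->. Qed.
Let cV'0 m v : s m = 0 -> cV' m v = 0.
Proof. by rewrite /cV' => ->. Qed.

Let cV'_add m v w : L' m v -> L' m w -> cV' m (v + w) = cV' m v + cV' m w.
Proof.
case: (s_cases m) => [sm|[sm|[sm|sm]]].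
- by rewrite !cV'0 ?addr0.
- move=> /(refined1 _ sm) hv /(refined1 _ sm) hw.
  by rewrite !cV'1 // rscaleDl cV_add ?mulmxDr //; apply: ML.
- move=> /(refined2 _ sm) hv /(refined2 _ sm) hw.
  by rewrite !cV'2 // rscaleDl cV_add.
- move=> /(refined3 _ sm) hv /(refined3 _ sm) hw.
  by rewrite !cV'3 // rscaleDl cV_add ?mulmxDr.
Qed.

Let rscale_alg v (x : D) (t : F) : rscale (rscale v t%:A) x = rscale (rscale v x) t%:A.
Proof. by rewrite !rscaleA mulr_algl mulr_algr. Qed.

Let cV'_scale m v t : L' m v -> fixed_val_ring X t -> cV' m (rscale v t%:A) = bF b t *: cV' m v.
Proof.
move=> hv ht; move: hv; case: (s_cases m) => [sm|[sm|[sm|sm]]].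
- by rewrite !cV'0 ?scaler0.
- move=> /(refined1 _ sm) hv.
  by rewrite !cV'1 // rscale_alg cV_scale ?scalemxAr //; apply: ML.
- by move=> /(refined2 _ sm) hv; rewrite !cV'2 // rscale_alg cV_scale.
- by move=> /(refined3 _ sm) hv; rewrite !cV'3 // rscale_alg cV_scale ?scalemxAr.
Qed.

Let cV'_ker m v : L' m v -> (cV' m v = 0 <-> L' (m + 1) v).
Proof.
case: (s_cases m) => [sm|[sm|[sm|sm]]] hv.
- by rewrite cV'0 //; split=> // _; apply: refined0S.
- by rewrite refined1S // cV'1 // ker_P //; apply/refined1.
- by rewrite refined2S // cV'2 // cV_ker //; apply/refined2.
- by rewrite refined3S // cV'3 // ker_Q //; apply/refined3.
Qed.

Let sum4 (G : int -> 'cV[bk b]_(cn cm)) :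
  \sum_(i < 4) G i%:Z = G c + G (c + 1) + G (2 - c) + G (3 - c).
Proof.
rewrite !big_ord_recl big_ord0 addr0 /=; case: j01 => j0.
  by rewrite (_ : c = 0) ?subr0 ?add0r ?addrA //; lia.
rewrite (_ : c = 2); last by lia.
by rewrite -[RHS]addrA [RHS]addrC -!addrA.
Qed.

Let s_c : s c = 0. Proof. by rewrite /s; lia. Qed.
Let s_c1 : s (c + 1) = 1. Proof. by rewrite /s; lia. Qed.
Let s_2c : s (2 - c) = 2. Proof. by rewrite /s; lia. Qed.
Let s_3c : s (3 - c) = 3. Proof. by rewrite /s; lia. Qed.
Let k2_2c : k2 (2 - c) = 0. Proof. by rewrite /k2; lia. Qed.
Let qt_c1 : qt (c + 1) = 0. Proof. by rewrite /qt; lia. Qed.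
Let expr0N v : rscale v (pi ^ (- 0)) = v. Proof. by rewrite oppr0 expr0z rscale1. Qed.

Let cVodd m v : 0 <= m < 4 -> m <> c -> m <> 2 - c -> L m v -> cV cm m v = 0.
Proof.
move=> hm mc m2c hv; apply/cV_ker => //.
have [q' [e1 e2]] : exists q', m = 2 * q' - 1 /\ m + 1 = 2 * q' by exists ((m + 1) %/ 2)%Z; lia.
by rewrite e2 -even_step -e1.
Qed.

Let PcV2 v : L (2 - c) v -> P *m cV cm (2 - c) v = 0.
Proof. by move=> hv; apply: cVp => //; lia. Qed.
Let QcV2 v : L (2 - c) v -> Q *m cV cm (2 - c) v = 0.
Proof. by move=> hv; apply: cVq => //; lia. Qed.

Let cV'_span (w : 'cV[bk b]_(cn cm)) : exists2 v : 'I_4 -> V, forall i : 'I_4, L' i%:Z (v i) &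
  w = \sum_(i < 4) cV' i%:Z (v i).
Proof.
have [v0 hv0 ->] := @cV_span _ _ _ _ _ _ cm w.
pose u0 (m : int) := v0 (inord `|m|%N).
have u0E (i : 'I_4) : v0 i = u0 i%:Z by rewrite /u0 /= inord_val.
have hu0 m : 0 <= m < 4 -> L m (u0 m).
  case: m => [k|k] hm; last by lia.
  by have := hv0 (inord k); rewrite inordK //; lia.
under eq_bigr => i _ do rewrite u0E.
rewrite (sum4 (fun m => cV cm m (u0 m))).
rewrite (cVodd (m := c + 1)) ?(cVodd (m := 3 - c)) ?addr0; try lia; last 2 first.
- by apply: hu0; lia.
- by apply: hu0; lia.
have hc : L c (u0 c) by apply: hu0.
have h2 : L (2 - c) (u0 (2 - c)) by apply: hu0; lia.
(* The component at [c] is the sum of its images under [P] and [Q]. The first is realized by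
   [p (u0 c)] at $c+1$; for the second, [u0 c] itself is placed at $3-c$, shifted by the power that
   [cV'] undoes. *)
pose u (m : int) : V := if m == c + 1 then p (u0 c) else if m == 3 - c then rscale (u0 c) (pi ^ (qt (3 - c) + 1))
  else if m == 2 - c then u0 (2 - c) else 0.
have uc : u c = 0 by rewrite /u; case: ifP => [|_]; [lia|case: ifP => [|_]; [lia|case: ifP => // ; lia]].
have u1 : u (c + 1) = p (u0 c) by rewrite /u eqxx.
have u3 : u (3 - c) = rscale (u0 c) (pi ^ (qt (3 - c) + 1)).
  by rewrite /u; case: ifP => [|_]; [lia|rewrite eqxx].
have u2 : u (2 - c) = u0 (2 - c).
  by rewrite /u; case: ifP => [|_]; [lia|case: ifP => [|_]; [lia|rewrite eqxx]].
exists (fun i => u i%:Z).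
  move=> i; have [iE|[iE|[iE|iE]]] : i%:Z = c \/ i%:Z = c + 1 \/ i%:Z = 2 - c \/ i%:Z = 3 - c.
    by have := ltn_ord i; lia.
  - by rewrite iE uc -[c]addr0 -(mulr0 4) refined_M rscale0l; case: M_sub.
  - by rewrite iE u1; apply/refined1 => //; rewrite qt_c1 expr0N; apply: p_L.
  - by rewrite iE u2; apply/refined2 => //; rewrite k2_2c expr0N.
  - by rewrite iE u3; apply/refined3 => //; rewrite pi_pi.
rewrite (sum4 (fun m => cV' m (u m))) (cV'0 _ s_c) add0r.
rewrite (cV'1 _ s_c1) (cV'2 _ s_2c) (cV'3 _ s_3c) u1 u2 u3 pi_pi qt_c1 k2_2c !expr0N.
rewrite -(cE_action sdL cm p0 c_range hc) mulmxA PP [RHS]addrAC; congr (_ + _).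
have : R *m cV cm c (u0 c) = 0.
  rewrite /R -ER cE_action //; apply/cV_ker; first exact: filtL.
  exact: r_c.
by rewrite /R !mulmxBl mul1mx -addrA -opprD => /eqP; rewrite subr_eq0 => /eqP.
Qed.

Let cV'_direct (v : 'I_4 -> V) : (forall i : 'I_4, L' i%:Z (v i)) ->
  \sum_(i < 4) cV' i%:Z (v i) = 0 -> forall i : 'I_4, cV' i%:Z (v i) = 0.
Proof.
move=> hv; pose u (m : int) := v (inord `|m|%N).
have uE (i : 'I_4) : v i = u i%:Z by rewrite /u /= inord_val.
have hu m : 0 <= m < 4 -> L' m (u m).
  case: m => [k|k] hm; last by lia.
  by have := hv (inord k); rewrite inordK //; lia.
under eq_bigr => i _ do rewrite uE.
rewrite (sum4 (fun m => cV' m (u m))) (cV'0 _ s_c) add0r (cV'1 _ s_c1) (cV'2 _ s_2c) (cV'3 _ s_3c).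
have h2 : L (2 - c) (rscale (u (2 - c)) (pi ^ (- k2 (2 - c)))).
  by apply/refined2 => //; apply: hu; lia.
move: (PcV2 h2) (QcV2 h2); set x := cV cm c _; set y := cV cm c _; set z := cV cm (2 - c) _ => Pz Qz e0.
have Px : P *m x = 0.
  have := congr1 (mulmx P) e0; rewrite !mulmxDr Pz !mulmxA PP PQ mul0mx !addr0 mulmx0.
  exact.
have Qy : Q *m y = 0.
  have := congr1 (mulmx Q) e0; rewrite !mulmxDr Qz !mulmxA QP QQ mul0mx !add0r mulmx0.
  exact.
have z0 : z = 0 by move: e0; rewrite Px Qy addr0 add0r.
move=> i; rewrite uE.
have [iE|[iE|[iE|iE]]] : i%:Z = c \/ i%:Z = c + 1 \/ i%:Z = 2 - c \/ i%:Z = 3 - c.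
  by have := ltn_ord i; lia.
- by rewrite iE cV'0.
- by rewrite iE cV'1.
- by rewrite iE cV'2.
- by rewrite iE cV'3.
Qed.

Definition refined_model : chain_model b L' :=
  ChainModel cV'_add cV'_scale cV'_ker cV'_span cV'_direct.

Let E' := cE refined_sd_chain refined_model.

Let M_q w : L c w -> M (w - q w).
Proof.
move=> hw; have [y hy hm] := M_cotype hw.
have L4 z : L (c + 4) z -> M z by move=> hz; apply: LM; apply: (chain_le sdL _ hz); lia.
rewrite -(subrK (rscale f y) w) lfunD q_f // opprD addrACA subrr addr0.
by apply: MB => //; apply: L4; apply: q_M.
Qed.

Let Rx2 v : L (2 - c) v -> R *m cV cm (2 - c) v = cV cm (2 - c) v.
Proof. by move=> hv; rewrite /R !mulmxBl mul1mx PcV2 // QcV2 // !subr0. Qed.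

(** The refined chain sees [a] only on $M/L_{c+1}$, on $L_c/M$ and on the other jump, that is
    through its three diagonal blocks. *)
Lemma refined_E a : chain_filt L' 0 a -> E' a = E (blk a).
Proof.
move=> ha; have [ha0 haM] := refined_filt ha; rewrite Eblk //.
apply: cE_uniq => // m v hm hv; change (cV refined_model) with cV'.
case: (s_cases m) => [sm|[sm|[sm|sm]]].
- by rewrite !cV'0 // mulmx0.
- have hw := (refined1 _ sm).1 hv; rewrite !cV'1 // -lfun_rscale.
  move: (rscale v _) hw => w hw; have Lw := ML hw; have Lpw := filtL p0 Lw.
  rewrite !mulmxDl -!mulmxA (mulmxA Q P) QP mul0mx !mulmx0 addr0 (mulmxA R P) RP mul0mx !mulmx0 addr0.
  rewrite (mulmxA P P) PP (cE_action sdL cm p0 c_range Lw) (cE_action sdL cm ha0 c_range Lpw).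
  rewrite !addr0; congr (_ *m _); apply: (cV_congr sdL) => //; [exact: filtL|exact: filtL|].
  rewrite -lfunB; apply: filtL => //.
  by rewrite -opprB; apply: (submoduleN (chain_sub sdL _)); rewrite pE; apply: M_type.
- have hw := (refined2 _ sm).1 hv; rewrite !cV'2 // -lfun_rscale.
  move: (rscale v _) hw => w hw.
  have Rw : R *m E a *m R *m cV cm (2 - c) w = E a *m cV cm (2 - c) w.
    by rewrite (R_comm ha0) -!mulmxA !Rx2.
  rewrite mulmxDl Rw mulmxDl -(mulmxA _ P) PcV2 // -(mulmxA _ Q) QcV2 // !mulmx0 !add0r cE_action //.
  by case: j01 => ?; lia.
- have hw := (refined3 _ sm).1 hv; rewrite !cV'3 // -lfun_rscale.
  move: (rscale v _) hw => w Lw; have Lqw := filtL q0 Lw.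
  rewrite !mulmxDl -!mulmxA (mulmxA P Q) PQ mul0mx !mulmx0 add0r (mulmxA R Q) RQ mul0mx !mulmx0 addr0.
  rewrite (mulmxA Q Q) QQ (cE_action sdL cm q0 c_range Lw) (cE_action sdL cm ha0 c_range Lqw).
  have d0 : Q *m cV cm c (a w - a (q w)) = 0.
    by apply/ker_Q; [apply: LB; apply: filtL|rewrite -lfunB; apply: haM; apply: M_q].
  rewrite ?addr0 ?add0r; move: d0; rewrite (cV_sub sdL) ?mulmxBr; try exact: filtL.
  by move=> /eqP; rewrite subr_eq0 => /eqP.
Qed.

Local Notation MK := 'M[bK b]_(cn cm).
Local Notation emb x := (map_mx (bemb b) x).
Local Notation PK := (emb P).
Local Notation QK := (emb Q).
Local Notation RK := (1%:M - PK - QK).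
Local Notation sd' := refined_sd_chain.
Local Notation cm' := refined_model.
Local Notation A := (chain_algebra sdL cm).
Local Notation A' := (chain_algebra sd' cm').
Local Notation S := (cS sdL cm).
Local Notation S' := (cS sd' cm').

Let RKE : emb R = RK. Proof. by rewrite /R !map_mxB map_mx1. Qed.
Let PPK : PK *m PK = PK. Proof. by rewrite -map_mxM PP. Qed.
Let QQK : QK *m QK = QK. Proof. by rewrite -map_mxM QQ. Qed.
Let PQK : PK *m QK = 0. Proof. by rewrite -map_mxM PQ map_mx0. Qed.
Let QPK : QK *m PK = 0. Proof. by rewrite -map_mxM QP map_mx0. Qed.
Let PRK : PK *m RK = 0. Proof. by rewrite -RKE -map_mxM PR map_mx0. Qed.
Let QRK : QK *m RK = 0. Proof. by rewrite -RKE -map_mxM QR map_mx0. Qed.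
Let RRK : RK *m RK = RK. Proof. by rewrite -RKE -map_mxM RR. Qed.

Let sum_comm l (d : 'I_l -> bK b) (y : 'I_l -> 'M[bK b]_(cn cm)) (Y Z : 'M[bK b]_(cn cm)) :
  Y *m (\sum_i d i *: y i) *m Z = \sum_i d i *: (Y *m y i *m Z).
Proof.
by rewrite mulmx_sumr mulmx_suml; apply: eq_bigr => i _; rewrite -scalemxAr -scalemxAl.
Qed.

Let RK_comm (x : MK) : A x -> RK *m x = x *m RK.
Proof.
move=> /chain_algebraP [l [d [a [a' [ha _ _ -> _]]]]].
have := sum_comm d (fun i => emb (E (a i))) RK 1%:M; rewrite mulmx1 => ->.
have := sum_comm d (fun i => emb (E (a i))) 1%:M RK; rewrite mul1mx => ->.
by apply: eq_bigr => i _; rewrite mulmx1 mul1mx -!RKE -!map_mxM -R_comm.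
Qed.

Let AMK (x y : MK) : A x -> A y -> A (x *m y).
Proof. by move=> hx hy; case: (chain_algebraM hx hy). Qed.
Let AP : A PK. Proof. exact: chain_algebra_E. Qed.
Let AQ : A QK. Proof. exact: chain_algebra_E. Qed.
Let SMK (x y : MK) : A x -> A y -> S (x *m y) = S y *m S x.
Proof. by move=> hx hy; case: (chain_algebraM hx hy). Qed.
Let SP : S PK = QK. Proof. exact: cS_adjoint. Qed.
Let SQ : S QK = PK. Proof. exact: cS_adjoint. Qed.

Let SPQ (x : MK) : A x -> S (PK *m x *m QK) = PK *m x *m QK.
Proof.
move=> Ax; rewrite !SMK //; last exact: AMK.
rewrite SP SQ mulmxA; move: Ax => /chain_algebraP [l [d [a [a' [ha ha' aa' -> ->]]]]].
rewrite !sum_comm; apply: eq_bigr => i _; congr (_ *: _); rewrite -!map_mxM; congr (emb _).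
rewrite -!cEM //; try exact: fc.
by apply/esym/(cE_congr sdL); [do !apply: fc|do !apply: fc|exact: paq_sym].
Qed.

Let SQP (x : MK) : A x -> S (QK *m x *m PK) = QK *m x *m PK.
Proof.
move=> Ax; rewrite !SMK //; last exact: AMK.
rewrite SP SQ mulmxA; move: Ax => /chain_algebraP [l [d [a [a' [ha ha' aa' -> ->]]]]].
rewrite !sum_comm; apply: eq_bigr => i _; congr (_ *: _); rewrite -!map_mxM; congr (emb _).
rewrite -!cEM //; try exact: fc.
by apply/esym/(cE_congr sdL); [do !apply: fc|do !apply: fc|exact: qap_sym].
Qed.

Let AS (x : MK) : A x -> A (S x). Proof. exact: chain_algebra_S. Qed.

Let block_zeroK (x : MK) : A x -> x *m S x = 1%:M -> PK *m x *m QK *m (QK *m x *m PK) = 0 ->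
  PK *m x *m QK = 0 /\ QK *m x *m PK = 0.
Proof.
exact: (block_zero (bK_two b) AMK AP AQ AS SMK SP SQ SPQ SQP PPK QQK PQK QPK RK_comm).
Qed.

(** Reductions in the refined model are reductions of block diagonal parts in the old one, and
    taking block diagonal parts commutes with adjoints. *)
Let algebra_refined (x : MK) : A' x -> A x /\ S' x = S x.
Proof.
move=> /chain_algebraP [l [d [a [a' [ha ha' aa' -> ->]]]]]; split.
  apply: chain_algebra_sum => i; rewrite -[cE _ _ _]/(E' (a i)) refined_E //.
  by apply: chain_algebra_E; apply: blk0; case: (refined_filt (ha i)).
rewrite linear_sum; apply: eq_bigr => i _; rewrite linearZ /=; congr (_ *: _).
rewrite -![cE _ cm' _]/(E' _) !refined_E //; apply/esym/cS_adjoint; last exact: blk_adjoint.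
by apply: blk0; case: (refined_filt (ha i)).
Qed.

Let group_refined (x : MK) : chain_group sd' cm' x -> chain_group sdL cm x.
Proof. by move=> [/algebra_refined [Ax Sx] xx dx]; split=> //; rewrite -Sx. Qed.

Let block_decomp (x : MK) : A x -> PK *m x *m QK = 0 -> QK *m x *m PK = 0 ->
  x = PK *m x *m PK + QK *m x *m QK + RK *m x *m RK.
Proof.
move=> Ax pq0 qp0.
have one : 1%:M = PK + QK + RK by rewrite -(addrA 1%:M) -opprD [RHS]addrC subrK.
have PxR : PK *m x *m RK = 0 by rewrite -mulmxA -RK_comm // mulmxA PRK mul0mx.
have QxR : QK *m x *m RK = 0 by rewrite -mulmxA -RK_comm // mulmxA QRK mul0mx.
have Px : PK *m x = PK *m x *m PK by rewrite -[LHS]mulmx1 one 2!mulmxDr pq0 PxR !addr0.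
have Qx : QK *m x = QK *m x *m QK by rewrite -[LHS]mulmx1 one 2!mulmxDr qp0 QxR addr0 add0r.
have Rx : RK *m x = RK *m x *m RK by rewrite -[RHS]mulmxA -RK_comm // mulmxA RRK.
by rewrite -Px -Qx -Rx -!mulmxDl -one mul1mx.
Qed.

Let compress_blocks (y x1 x2 x3 z1 z2 z3 : 'M[bk b]_(cn cm)) : y *m z1 = y -> z1 *m y = y ->
  y *m z2 = 0 -> y *m z3 = 0 ->
  y *m (z1 *m x1 *m z1 + z2 *m x2 *m z2 + z3 *m x3 *m z3) *m y = y *m x1 *m y.
Proof.
move=> e1 e1' e2 e3; rewrite !mulmxDr !mulmxA e1 e2 e3 !mul0mx !addr0.
by rewrite -(mulmxA (y *m x1)) e1'.
Qed.

Let Eblkblk a : chain_filt L 0 a -> E (blk (blk a)) = E (blk a).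
Proof.
move=> ha; rewrite (Eblk (blk0 ha)) (Eblk ha); congr (_ + _ + _).
- exact: compress_blocks.
- by rewrite (addrC (P *m E a *m P)); apply: compress_blocks.
- by rewrite (addrC _ (R *m E a *m R)) addrA; apply: compress_blocks.
Qed.

(** A block diagonal [x] is a combination of reductions of the operators [blk (a i)], which
    stabilize [M] even when the [a i] do not. *)
Let group_of_blocks (x : MK) : chain_group sdL cm x -> PK *m x *m QK = 0 -> QK *m x *m PK = 0 ->
  chain_group sd' cm' x.
Proof.
move=> [Ax xx dx] pq0 qp0.
have A'x : A' x.
  rewrite (block_decomp Ax pq0 qp0).
  have /chain_algebraP [l [d [a [a' [ha _ _ -> _]]]]] := Ax.
  rewrite !sum_comm -!big_split /=.
  have -> : \sum_i (d i *: (PK *m emb (E (a i)) *m PK) + d i *: (QK *m emb (E (a i)) *m QK) +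
      d i *: (RK *m emb (E (a i)) *m RK)) = \sum_i d i *: emb (E' (blk (a i))).
    apply: eq_bigr => i _; rewrite refined_E; last first.
      by apply: filt_refined; [apply: blk0|apply: blkM].
    by rewrite Eblkblk // Eblk // -!scalerDr !map_mxD !map_mxM RKE.
  by apply: chain_algebra_sum => i; apply: chain_algebra_E; apply: filt_refined; [apply: blk0|apply: blkM].
by split=> //; case: (algebra_refined A'x) => _ ->.
Qed.

Lemma group0_blocks (x : MK) : chain_group0 sdL cm x -> PK *m x *m QK = 0 /\ QK *m x *m PK = 0.
Proof.
apply: (connected_block_diagonal (bK_two b) AMK AP AQ AS SMK SP SQ SPQ SQP PPK QQK PQK QPK RK_comm).
- exact: component_connected.
- by apply: connected_component_refl; exact: chain_group1.
- by move=> y /connected_component_sub [].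
Qed.

(** Maximality of components, used twice: the refined group is contained in the old one, and the old
    component consists of block diagonal elements, which belong to the refined group. *)
Lemma refined_group0 : chain_group0 sd' cm' = chain_group0 sdL cm.
Proof.
apply/seteqP; split.
  apply: (@connected_component_max (zariski (bK b) (cn cm))).
  - by apply: connected_component_refl; exact: (chain_group1 sd' cm').
  - by move=> x /connected_component_sub /group_refined.
  - exact: component_connected.
apply: (@connected_component_max (zariski (bK b) (cn cm))).
- by apply: connected_component_refl; exact: chain_group1.
- by move=> x hx; have [pq0 qp0] := group0_blocks hx; apply: group_of_blocks => //; apply: connected_component_sub hx.
- exact: component_connected.
Qed.

Let E_blocks g : chain_filt L' 0 g -> PK *m emb (E g) *m QK = 0 ->
  QK *m emb (E g) *m PK = 0 -> E' g = E g.
Proof.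
move=> hg pq0 qp0; have [hg0 _] := refined_filt hg; rewrite refined_E //.
apply: (@map_mx_inj _ _ (bemb b)); rewrite Eblk // !map_mxD !map_mxM RKE.
by rewrite -block_decomp //; apply: chain_algebra_E.
Qed.

Lemma refined_E_group0 g : chain_filt L' 0 g -> chain_group0 sdL cm (emb (E g)) -> E' g = E g.
Proof. by move=> hg /group0_blocks [pq0 qp0]; apply: E_blocks. Qed.

(** Here [g] is not yet known to reduce into the component of the old group. Stability of [M] kills
    the lower corner, and [block_zero] then kills the upper one. *)
Lemma refined_E_isometry g g' : chain_filt L' 0 g -> chain_filt L 0 g' -> adjoint X g g' ->
  (g \o g')%VF = \1%VF -> E' g = E g.
Proof.
move=> hg hg' gg' gg1; have [hg0 gM] := refined_filt hg.
have QgP : QK *m emb (E g) *m PK = 0.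
  rewrite -!map_mxM -!cEM //; try exact: fc.
  rewrite (_ : E _ = 0) ?map_mx0 //; apply/(cE_eq0 sdL); first by do !apply: fc.
  move=> m v hv; rewrite !comp_lfunE pE qE lfun_rscale hformZr mulrA.
  apply: (@scaleL (- c) (j + 1 + ((- c + m + 3) %/ 4)%Z)) => //; last by lia.
  apply: (val_geM nD); first by apply: val_ge_sgn; apply: M_iso => //; apply: gM.
  by apply: (chain_h sdL _ Lf hv); lia.
have [] // := @block_zeroK (emb (E g)); last by move=> *; apply: E_blocks.
- exact: chain_algebra_E.
- rewrite (cS_adjoint sdL cm hg0 gg') -map_mxM -cEM // gg1.
  by rewrite cE_id map_mx1.
- by rewrite QgP mulmx0.
Qed.

End Model.

Section Stabilizers.
Variable R : realType.
Local Notation G := (chain_fun X L : R -> set V).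
Local Notation G' := (chain_fun X L' : R -> set V).
Local Notation sd' := refined_sd_chain.
Hypothesis M_stab : forall g g', connected_stabilizer X G g -> chain_filt L 0 g' ->
  (g \o g')%VF = \1%VF -> (g' \o g)%VF = \1%VF -> forall v, M v -> M (g v) /\ M (g' v).

Lemma refined_connected_stabilizer : connected_stabilizer X G' = connected_stabilizer X G.
Proof.
apply/seteqP; split=> g hg.
  have [[iso [g0 [g' [g'0 gg' g'g]]]] [b [cm1 hE]]] := (connected_stabilizer_chain sd' R g).1 hg.
  move: g0 g'0; rewrite filt0_chain_fun => g0 g'0.
  have [g0L _] := refined_filt g0; have [g'0L _] := refined_filt g'0.
  have adj : adjoint X g g'.
    by move=> v w; rewrite -[in LHS](id_lfunE w) -gg' comp_lfunE iso.1.
  (* The model [cm1] of the refined chain is arbitrary. The comparison needs one refined from a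
     model of [L], and transport passes between the two. *)
  have [cm0 _] := chain_model_ex b sdL.
  apply/(connected_stabilizer_chain sdL R); split.
    by split=> //; rewrite filt0_chain_fun; split=> //; exists g'.
  exists b, cm0; rewrite -refined_group0 -(refined_E_isometry cm0 g0 g'0L adj gg').
  exact: chain_group0_transport hE.
have [[iso [g0 [g' [g'0 gg' g'g]]]] [b [cm hE]]] := (connected_stabilizer_chain sdL R g).1 hg.
move: g0 g'0; rewrite filt0_chain_fun => g0 g'0.
have st := M_stab hg g'0 gg' g'g.
have g1 : chain_filt L' 0 g by apply: filt_refined => // v /st [].
have g'1 : chain_filt L' 0 g' by apply: filt_refined => // v /st [].
apply/(connected_stabilizer_chain sd' R); split.
  by split=> //; rewrite filt0_chain_fun; split=> //; exists g'.
by exists b, (refined_model cm); rewrite refined_group0 refined_E_group0.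
Qed.

(** If the orders agreed, [M] would be some $L_m$ by [chain_stable]. For $m\le c$ it would contain
    $f\varpi^j$, which is not orthogonal to [e]; for $m>c$ the vector [e] would lie in $L_{c+1}$,
    against [h f e = 1]. *)
Lemma refined_filt0_proper : filt0 G' `<` filt0 G.
Proof.
rewrite !filt0_chain_fun; split=> [a /refined_filt [] //|le].
have val1 : ~ val_ge vD 1 (1 : D).
  by move=> []; [move/eqP; rewrite oner_eq0|rewrite (val_one nD)].
have e_neq0 : e != 0.
  apply/eqP => e0; move: hfe; rewrite e0 -(rscale0r 0) hformZr mulr0 => /esym/eqP.
  by rewrite oner_eq0.
have [|m [_ [_ [ME _ _ _]]]] := chain_stable sdL _ ML Me e_neq0.
  by move=> a v /le /refined_filt [_]; apply.
have [mc|mc] := lerP m c.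
  have Mf : M (rscale f (pi ^ j)).
    by rewrite ME; apply: (chain_le sdL mc); apply: fy; apply: val_ge_unifz.
  have := M_iso Me Mf; rewrite hformZr hef => /(@val_ge_sgn _ _ _ X _ _).
  rewrite mulrA sgnK mul1r => hj; apply: val1.
  rewrite -(unifzK X j); apply: (val_geMW nD (m := j + 1) (n := - j)) => //; first by lia.
  exact: val_ge_unifz.
have Me' : L (c + 1) e by apply: (chain_le sdL (n := m)); [lia|rewrite -ME].
by apply: val1; rewrite -hfe; apply: (chain_h sdL _ Lf Me'); lia.
Qed.

End Stabilizers.

End Refinement.

(** * Comparison with another lattice function *)

Section Comparison.
Variables (R : realType) (F : fieldType) (D : falgType F) (V : vectType D^c).
Variable X : hermitian_datum V.
Local Notation h := (hform X).
Local Notation vD := (valD X).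
Local Notation pi := (unif X).
Local Notation d := ((degD X)%:R : R).
Let nD := valD_valuation X.
Variable L : int -> set V.
Hypothesis sdL : sd_chain X L.
Hypothesis two_step0 : L (-1) = L 0.
Hypothesis two_step1 : L 1 = L 2.
Variable Gamma : R -> set V.
Hypothesis sdG : self_dual_lattice_function X Gamma.
Let lfG : lattice_function X Gamma := sdG.1.
Local Notation G := (chain_fun X L : R -> set V).
Implicit Types (v w : V) (x y : 'End(V)).

Let d_gt0 : 0 < d := degDR_gt0 R X.
Let tau (m : int) : R := m%:~R / (4 * d).

Let tau_shift m k : tau (m + 4 * k) = tau m + k%:~R / d.
Proof. by rewrite /tau intrD intrM; field; rewrite gt_eqF. Qed.

Let tau_le m n : m <= n -> tau m <= tau n.
Proof. by move=> mn; rewrite /tau ler_pM2r ?ler_int // invr_gt0 mulr_gt0. Qed.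

(** Its contrapositive produces [M]: if [Gamma] is not the function of [L], some step of [Gamma]
    later than $2j/4d$ meets $L_{2j}$ outside $L_{2j+1}$. *)
Lemma chain_fun_eq :
  (forall j u v, j = 0 \/ j = 1 -> (2 * j)%:~R / (4 * d) < u -> L (2 * j) v -> Gamma u v ->
     L (2 * j + 1) v) ->
  Gamma = G.
Proof.
move=> hyp; have step m u v : tau m < u -> L m v -> Gamma u v -> L (m + 1) v.
  move=> mu hL hG; have [k kE] : exists k, m = 2 * k - 1 \/ m = 2 * k by exists ((m + 1) %/ 2)%Z; lia.
  case: kE => kE.
    by rewrite kE subrK -(chain_even_step sdL two_step0 two_step1) -kE.
  pose i := (k %/ 2)%Z; pose j := (k %% 2)%Z.
  have mE : m = 2 * j + 4 * i by rewrite /j /i; lia.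
  have hLi : L (2 * j) (rscale v (pi ^ (- i))).
    by have := (chain_shift sdL m v (- i)).1 hL; rewrite (_ : m + 4 * - i = 2 * j) //; lia.
  have hGi := (lf_shift lfG u v (- i)).1 hG.
  have := hyp j _ _ _ _ hLi hGi.
  rewrite (_ : m + 1 = 2 * j + 1 + 4 * i); last by lia.
  move=> hh; have /hh {}hh : j = 0 \/ j = 1 by rewrite /j; lia.
  have /hh : (2 * j)%:~R / (4 * d) < u + (- i)%:~R / d.
    by rewrite intrN mulNr ltrBrDr -tau_shift -mE.
  by move/(chain_shift sdL _ _ i).1; rewrite rscaleA unifzNK rscale1.
(* Start from some $L_{m+1-n}$ containing [v] and climb one index at a time by [step]. *)
have up m u v : tau m < u -> Gamma u v -> L (m + 1) v.
  move=> mu hG; have [n hn] := chain_exhaust sdL (m + 1) v.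
  elim: n hn => [|n IH] hn; first by move: hn; rewrite subr0.
  apply: IH; have -> : m + 1 - n%:Z = m - n%:Z + 1 by lia.
  apply: (step _ u) => //; last by rewrite (_ : m - n%:Z = m + 1 - n.+1%:Z) //; lia.
  by apply: le_lt_trans mu; apply: tau_le; lia.
(* The dual of [up]. *)
have down m v : L m v -> Gamma (tau m) v.
  rewrite -(chain_dual sdL) -(sd_dual_right sdG) => hv w [u /= mu hw]; apply: hv.
  rewrite (_ : 1 - m = - m + 1); last by lia.
  by apply: up hw; rewrite /tau intrN mulNr.
apply/funext => t; apply/seteqP; split=> v.
  move=> hv; rewrite /chain_fun -[Num.ceil _](subrK 1).
  apply: up hv; rewrite /tau ltr_pdivrMr ?mulr_gt0 // mulrC.
  by rewrite -ceil_gt_int ltrBlDr ltzD1.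
move=> /down; apply: (lf_mono lfG); rewrite /tau ler_pdivlMr ?mulr_gt0 // mulrC.
exact: ceil_ge.
Qed.

Section Intersection.
Variables (j : int) (u : R).

Definition lattice_meet : set V :=
  [set v | exists a b, [/\ L (2 * j) a, Gamma u a, L (2 * j + 1) b & v = a + b]].
Local Notation M := lattice_meet.

Lemma meet_submodule : submodule X M.
Proof.
have [L0 LD LZ] := chain_sub sdL (2 * j); have [L0' LD' LZ'] := chain_sub sdL (2 * j + 1).
have [G0 GD GZ] := lf_sub lfG u; split.
- by exists 0, 0; rewrite addr0.
- move=> _ _ [a [b [ha ga hb ->]]] [a' [b' [ha' ga' hb' ->]]].
  by exists (a + a'), (b + b'); rewrite addrACA; split; auto.
- move=> _ x [a [b [ha ga hb ->]]] hx.
  by exists (rscale a x), (rscale b x); rewrite rscaleDl; split; auto.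
Qed.

Lemma meet_ge : L (2 * j + 1) `<=` M.
Proof.
move=> v hv; have [L0 _ _] := chain_sub sdL (2 * j); have [G0 _ _] := lf_sub lfG u.
by exists 0, v; rewrite add0r.
Qed.

Lemma meet_le : M `<=` L (2 * j).
Proof.
move=> _ [a [b [ha _ hb ->]]]; case: (chain_sub sdL (2 * j)) => _ + _; apply=> //.
by apply: (chain_le sdL _ hb); lia.
Qed.

Hypothesis ju : (2 * j)%:~R / (4 * d) < u.

(** For $u>j/2d$ one has $u-j/d>-u$. So $\Gamma(u)\varpi^{-j}$ lies in $\Gamma((-u)+)$, whose dual
    is $\Gamma(u)$, and vectors of $\Gamma(u)$ pair into $\mathfrak p_D^{j+1}$. *)
Lemma meet_isotropic v w : M v -> M w -> val_ge vD (j + 1) (h v w).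
Proof.
move=> [a [b [ha ga hb ->]]] Mw.
have hbw : val_ge vD (j + 1) (h b w) by apply: (chain_h sdL _ hb (meet_le Mw)); lia.
case: Mw => [a' [b' [ha' ga' hb' wE]]]; rewrite hDl; apply: (val_geD nD) => //.
rewrite wE hformDr; apply: (val_geD nD); last by apply: (chain_h sdL _ ha hb'); lia.
have hw : right_part Gamma (- u) (rscale a' (pi ^ (- j))).
  exists (u + (- j)%:~R / d); last exact: (lf_shift lfG u a' (- j)).1.
  move: ju; rewrite /= intrM intrN -(ltr_pM2r (mulr_gt0 (ltr0n _ 2) d_gt0)) => ju'.
  rewrite -(ltr_pM2r d_gt0) mulrDl divfK ?gt_eqF // mulNr.
  have e1 : 2 * j%:~R / (4 * d) * (2 * d) = j%:~R by field; rewrite gt_eqF.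
  by move: ju'; rewrite e1 => ju'; lra.
move: ga; rewrite -(sd_dual_right sdG) => /(_ _ hw); rewrite hformZr => h1.
rewrite -[h a a']mulr1 -(unifzNK X j) mulrA.
by apply: (val_geMW nD (m := 1) (n := j)) => //; [lia|exact: val_ge_unifz].
Qed.

Hypothesis sub : connected_stabilizer X G `<=` connected_stabilizer X Gamma.

Lemma meet_stable g g' : connected_stabilizer X G g -> chain_filt L 0 g' ->
  (g \o g')%VF = \1%VF -> (g' \o g)%VF = \1%VF -> forall v, M v -> M (g v) /\ M (g' v).
Proof.
move=> hg g'0 gg' g'g; have [[_ [g0 _]] _] := hg; rewrite filt0_chain_fun in g0.
have [[_ [gG [g'' [g''G gg'' _]]]] _] := sub hg.
have g''E : g'' = g' by rewrite -[g'']comp_lfun1l -g'g -comp_lfunA gg'' comp_lfun1r.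
have st y v : chain_filt L 0 y -> filt0 Gamma y -> M v -> M (y v).
  move=> yL yG [a [b [ha ga hb ->]]]; exists (y a), (y b); rewrite lfunD; split=> //.
  - by have := yL _ _ ha; rewrite addr0.
  - by have := yG _ _ ga; rewrite addr0.
  - by have := yL _ _ hb; rewrite addr0.
by move=> v hv; split; apply: st => //; rewrite -g''E.
Qed.

(* The Cayley transforms of [x] and [-x] differ by [4x] modulo
   [chain_filt L 1]. *)
Lemma meet_skew_stable (b : residue_base X) x : adjoint X x (- x) -> chain_filt L 0 x ->
  chain_filt L 1 (x \o x \o x)%VF -> forall v, M v -> M (x v).
Proof.
move=> xx x0 x3 v hv; have [cm _] := chain_model_ex b sdL.
have stab g : connected_stabilizer X G g -> M (g v).
  move=> hg; have [[_ [_ [g' [g'0 gg' g'g]]]] _] := hg.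
  by rewrite filt0_chain_fun in g'0; case: (meet_stable hg g'0 gg' g'g hv).
have [g [/stab Mg hg]] := cayley_unipotent sdL R cm xx x0 x3.
have Nx3 : chain_filt L 1 (- x \o - x \o - x)%VF.
  by rewrite !comp_lfunNl !comp_lfunNr !comp_lfunNl opprK; apply: (chain_filtN sdL).
have [g1 [/stab Mg1 hg1]] := cayley_unipotent sdL R cm (adjointN xx) (chain_filtN sdL x0) Nx3.
have [_ MD MZ] := meet_submodule; have MB := submoduleB meet_submodule.
have Lv := meet_le hv.
have := MB _ _ (meet_ge (hg1 _ _ Lv)) (meet_ge (hg _ _ Lv)).
rewrite !(add_lfunE, opp_lfunE, id_lfunE, comp_lfunE) linearN opprK.
set t := x v; set q := x t; rewrite -opprD opprK => Mw.
have e4 (a a' q' : V) : a' - (v + (t + t) + q') - (a - (v - (t + t) + q')) =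
    (a' - a) - ((t + t) + (t + t)).
  rewrite opprB [_ - a]addrC addrACA [- _ + _]addrC; congr (_ + _).
  move: (t + t) => T; rewrite (addrAC v T) (addrAC v (- T)).
  by rewrite (opprD (v + q')) addrACA subrr add0r -opprD.
have Mt : M ((t + t) + (t + t)).
  by move: Mw; rewrite e4 => Mw; rewrite -(subKr (g1 v - g v) (_ + _)); apply: (MB) => //; apply: MB.
have two_half w : rscale (w + w) (half D) = w by rewrite rscaleDl -rscaleDr (halfD X) rscale1.
by rewrite -[t]two_half -[t + t]two_half; apply: (MZ); [apply: (MZ) => //|]; exact: val_half.
Qed.

End Intersection.

Lemma refinement_exists (b : residue_base X) :
  connected_stabilizer X G `<=` connected_stabilizer X Gamma -> Gamma <> G ->
  exists L', [/\ sd_chain X L',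
    connected_stabilizer X (chain_fun X L' : R -> set V) = connected_stabilizer X G &
    filt0 (chain_fun X L' : R -> set V) `<` filt0 G].
Proof.
move=> sub neq.
have [j [u [v0 [j01 ju hv0 gv0 nv0]]]] : exists j u v, [/\ j = 0 \/ j = 1,
    (2 * j)%:~R / (4 * d) < u, L (2 * j) v, Gamma u v & ~ L (2 * j + 1) v].
  apply: contrapT => no; apply: neq; apply: chain_fun_eq => j u v j01 ju hv gv.
  by apply: contrapT => nv; apply: no; exists j, u, v.
have M_sub := meet_submodule j u; have LM := @meet_ge j u; have ML := @meet_le j u.
have M_iso := meet_isotropic ju; have M_stab := meet_skew_stable (j := j) (u := u) sub b.
have M_neq : exists2 m, lattice_meet j u m & ~ L (2 * j + 1) m.
  exists v0 => //; exists v0, 0; rewrite addr0; split=> //.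
  by case: (chain_sub sdL (2 * j + 1)).
have cE := erefl (2 * j).
have [e [f [Me Lf hfe hff]]] := hyperbolic_pair sdL cE ML M_neq M_iso.
have M_max := lagrangian_max sdL cE M_sub LM ML M_iso M_stab Me Lf hfe hff.
have M_cotype := lagrangian_cotype sdL cE M_sub ML M_stab Me Lf hfe hff.
have M_type := lagrangian_type sdL cE M_sub ML M_iso M_stab Me Lf hfe hff.
have sym := lagrangian_sym sdL cE M_iso M_stab Me Lf hfe hff.
have sym_neg (y : D) (hy : val_ge vD (- j) y) :=
  lagrangian_sym_neg sdL cE M_iso M_stab Me Lf hfe hff hy j01.
exists (refined X L (2 * j) (lattice_meet j u)); split.
- exact: (refined_sd_chain sdL two_step0 two_step1 j01 cE M_sub LM ML M_iso M_max).
- apply: (refined_connected_stabilizer sdL two_step0 two_step1 j01 cE M_sub LM ML M_iso M_max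
    Me Lf hfe hff M_cotype M_type sym sym_neg) => g g'.
  exact: meet_stable.
- exact: (refined_filt0_proper sdL two_step0 two_step1 j01 cE ML M_iso Me Lf hfe).
Qed.

End Comparison.

Theorem lemmaC1 (R : realType) (F : fieldType) (D : falgType F)
    (V : vectType D^c) (X : hermitian_datum V) (Gamma : R -> set V) :
  self_dual_lattice_function X Gamma ->
  maximal_self_dual_order X (filt0 Gamma) ->
  ~ maximal_parahoric R X (connected_stabilizer X Gamma) ->
  exists Gamma' : R -> set V,
    [/\ self_dual_lattice_function X Gamma',
        connected_stabilizer X Gamma' = connected_stabilizer X Gamma &
        filt0 Gamma' `<` filt0 Gamma].
Proof.
move=> sdG maxG notmax; have [L [sdL GE two_step0 two_step1]] := maximal_two_step sdG maxG.
have [G1 [sdG1 sub neq]] : exists G1 : R -> set V, [/\ self_dual_lattice_function X G1,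
    connected_stabilizer X Gamma `<=` connected_stabilizer X G1 &
    connected_stabilizer X G1 <> connected_stabilizer X Gamma].
  apply: contrapT => no; apply: notmax; split; first by exists Gamma.
  move=> H [G1 sdG1 ->] sub; apply: contrapT => neq.
  by apply: no; exists G1.
(* The larger group is nonempty, since otherwise it would equal the smaller one. Any of its elements
   comes with a residual model, which supplies the residue field and its closure. *)
have [g [_ [M _]]] : exists g, connected_stabilizer X G1 g.
  apply: contrapT => no; apply: neq; apply/seteqP; split=> // g hg.
  by case: no; exists g.
have b := ResidueBase (redF_quotient M) (@redF_onto _ _ _ _ _ _ M) (@resK_algebraic _ _ _ _ _ _ M).
rewrite GE in sub neq *.
have [|L' [sdL' st proper]] := refinement_exists sdL two_step0 two_step1 sdG1 b sub.
  by move=> G1E; apply: neq; rewrite G1E.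
by exists (chain_fun X L'); split=> //; apply: chain_fun_self_dual.
Qed.
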